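(* Let $R$ be an Artin–Schelter regular algebra of global dimension $d$, generated in degree $1$, with Nakayama automorphism $\mu_R$. Let $E=\mathrm{Ext}^*_R({}_R\Bbbk,{}_R\Bbbk)$ be its Yoneda algebra, with Nakayama automorphism $\mu_E$, and assume that $\mu_E|_{E_1}=(-1)^{d+1}(\mu_R|_{R_1})^*$. Let $H$ be a Hopf algebra with antipode of finite order coacting on $R$ from the right, preserving the grading of $R$. Suppose that the $H$-coaction on $R$ is inner-faithful with homological codeterminant $\mathsf{D}\in H$. If one of the following conditions holds: (i) $R$ is central Nakayama, $H$ is involutory (the square of its antipode is the identity), and $\mathsf{D}$ is central in $H$; or (ii) $R$ is power central Nakayama and $\mathsf{D}^m$ is central in $H$ for some $m\ge 1$, then $H$ is cocommutative. If, further, $H$ is finite dimensional, then $H$ must be a group algebra.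
   Context: $\Bbbk$ is an algebraically closed field of characteristic zero; all algebras and Hopf algebras are over $\Bbbk$. AS regular: a connected $\mathbb{N}$-graded algebra $R$ ($R_0=\Bbbk$) is AS regular of global dimension $d$ if it has finite injective dimension $d$ on both sides, $\mathrm{Ext}^i_R({}_R\Bbbk,{}_RR)\cong\mathrm{Ext}^i_R(\Bbbk_R,R_R)=\delta_{i,d}\Bbbk$, and $R$ has finite global dimension. (Finite Gelfand–Kirillov dimension is not assumed.) Nakayama automorphisms. For AS regular $R$, with $R^e=R\otimes R^{op}$, $\mu_R$ is the unique graded algebra automorphism with $\mathrm{Ext}^d_{R^e}(R,R^e)\cong{}^{\mu_R}R^1$ as $R$-bimodules (${}^{\mu}R^1$ is $R$ with left action twisted by $\mu$); the other $\mathrm{Ext}^i_{R^e}(R,R^e)$ vanish. The Yoneda algebra $E$ of $R$ is a Frobenius algebra, and $\mu_E$ is its classical graded Nakayama automorphism: $E^*\cong{}^{\mu_E}E^1$ as bimodules up to shift, i.e. $\langle x,a\rangle=\langle\mu_E(a),x\rangle$ for the Frobenius form. $E_1=\mathrm{Ext}^1_R(\Bbbk,\Bbbk)$ is identified with $R_1^*$, and $(\mu_R|_{R_1})^*$ denotes the dual map. Coactions. $H$ coacts on $R$ if $R$ is a right $H$-comodule algebra. The coaction $\rho:R\to R\otimes H$ is inner-faithful if $\rho(R)\not\subset R\otimes H'$ for every proper Hopf subalgebra $H'\subsetneq H$. The right coaction on $R$ induces a left $H$-coaction $\rho$ on $E$ (dual to the induced right $H$-comodule structure on $\mathrm{Tor}^R_*(\Bbbk,\Bbbk)$).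 Let $0\neq\mathfrak{e}\in\mathrm{Ext}^d_R(\Bbbk,\Bbbk)$, which is one dimensional; the homological codeterminant is the group-like element $\mathsf{D}\in H$ with $\rho(\mathfrak{e})=\mathsf{D}\otimes\mathfrak{e}$. (Some conventions replace $\mathsf{D}$ by $\mathsf{D}^{-1}$; the centrality conditions above do not depend on this.) Central Nakayama. For a matrix $\mathbb{X}\in M_n(\Bbbk)$ let $\mathcal{C}(\mathbb{X})=\{\mathbb{P}\in M_n(\Bbbk):\mathbb{P}\mathbb{X}=\mathbb{X}\mathbb{P}\}$ and $\mathcal{C}_P(\mathbb{X})=\bigcup_{i\ge1}\mathcal{C}(\mathbb{X}^i)$. Regarding $\mu_R|_{R_1}$ as a matrix in a basis of $R_1$, $R$ is central Nakayama if $\mathcal{C}(\mu_R|_{R_1})$ is commutative, and power central Nakayama if $\mathcal{C}_P(\mu_R|_{R_1})$ is commutative. *)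

(* Defs.v *)
From HB Require Import structures.
From mathcomp Require Import all_boot all_order all_fingroup all_algebra.
From mathcomp Require Import generic_quotient boolp classical_sets functions.

Set Implicit Arguments.
Unset Strict Implicit.
Unset Printing Implicit Defensive.

Import GRing.Theory.
Local Open Scope ring_scope.
Local Open Scope quotient_scope.

Reserved Notation "V ⊗ W" (at level 40, left associativity).

Lemma separating_functional (k : fieldType) (V : lmodType k) (v : V) :
  v != 0 -> exists f : V -> k,
    (forall a x y, f (a *: x + y) = a * f x + f y) /\ f v = 1.
Proof.
move=> v0.
pose W0 (W : set V) : set V := fun x => W x \/ x = 0.
pose P (W : set V) :=
  (forall a x y, W0 W x -> W0 W y -> W0 W (a *: x + y)) /\ ~ W0 W v.
have [W [[Wlin Wv] Wmax]] :
    exists W, P W /\ forall B, (W `<` B)%classic -> ~ P B.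
  apply: Zorn_bigcup => F FP Ftot; split; last first.
    case=> [[X FX Xv]|v0']; last by rewrite v0' eqxx in v0.
    by have [_ nXv] := FP _ FX; apply: nXv; left.
  have up X x : F X -> W0 X x -> W0 (\bigcup_(X in F) X)%classic x.
    by move=> FX [Xx|->]; [left; exists X|right].
  move=> a x y [[X FX Xx]|->]; last by rewrite scaler0 add0r.
  case=> [[Y FY Yy]|->].
    have [XY|YX] := Ftot _ _ FX FY.
      by apply: (up Y) => //; apply: (proj1 (FP _ FY)); left => //; apply: XY.
    by apply: (up X) => //; apply: (proj1 (FP _ FX)); left => //; apply: YX.
  by apply: (up X) => //; apply: (proj1 (FP _ FX)); [left|right].
have W00 : W0 W 0 by right.
have WD x y : W0 W x -> W0 W y -> W0 W (x + y).
  by move=> ? ?; rewrite -[x]scale1r; apply: Wlin.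
have WZ a x : W0 W x -> W0 W (a *: x).
  by move=> ?; rewrite -[_ *: _]addr0; apply: Wlin.
have dec x : exists c, W0 W (x - c *: v).
  apply: contrapT => nx.
  pose B : set V := fun y => exists b, W0 W (y - b *: x).
  have BW y : W0 W y -> B y by move=> Wy; exists 0; rewrite scale0r subr0.
  have B0 y : W0 B y -> B y by case=> [//|->]; apply: BW.
  apply: (Wmax B); last split.
  - split=> [y Wy|/(_ x)]; first by apply: BW; left.
    have Bx : B x by exists 1; rewrite scale1r subrr.
    by move=> /(_ Bx) Wx; apply: nx; exists 0; rewrite scale0r subr0; left.
  - move=> a y z /B0 [b Wy] /B0 [c Wz]; left; exists (a * b + c).
    have -> : a *: y + z - (a * b + c) *: x = a *: (y - b *: x) + (z - c *: x).
      by rewrite scalerDl scalerBr scalerA opprD addrACA.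
    exact: Wlin.
  - move=> /B0 [b Wb]; apply: nx.
    have [b0|b0] := eqVneq b 0; first by rewrite b0 scale0r subr0 in Wb.
    exists b^-1; have -> : x - b^-1 *: v = (- b^-1) *: (v - b *: x).
      by rewrite scaleNr scalerBr scalerA mulVf // scale1r opprB.
    exact: WZ.
have uniq x c c' : W0 W (x - c *: v) -> W0 W (x - c' *: v) -> c = c'.
  move=> Wc Wc'; apply/eqP; apply: contrapT => /negP; rewrite -subr_eq0 => cc'.
  apply: Wv; have -> : v = (c - c')^-1 *: ((-1) *: (x - c *: v) + (x - c' *: v)).
    by rewrite scaleN1r opprB addrA subrK -scalerBl scalerA mulVf // scale1r.
  by apply: WZ; apply: Wlin.
pose f x := projT1 (cid (dec x)).
have fP x : W0 W (x - f x *: v) by rewrite /f; case: cid.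
exists f; split=> [a x y|]; last first.
  by apply: (uniq v) => //; rewrite scale1r subrr.
apply: (uniq (a *: x + y)) => //.
have -> : a *: x + y - (a * f x + f y) *: v =
          a *: (x - f x *: v) + (y - f y *: v).
  by rewrite scalerDl scalerBr scalerA opprD addrACA.
exact: Wlin.
Qed.

Section Tensor.
Variable k : fieldType.
Implicit Types V W U : lmodType k.

Definition bilinear_map V W U (b : V -> W -> U) : Prop :=
  (forall w a v v', b (a *: v + v') w = a *: b v w + b v' w) /\
  (forall v a w w', b v (a *: w + w') = a *: b v w + b v w').

Section Def.
Variables V W : lmodType k.

Definition bilin_sum U (b : V -> W -> U) (s : seq (V * W)) : U :=
  \sum_(p <- s) b p.1 p.2.

(* A formal sum of pairs (v, w) stands for the sum of the v ⊗ w; two of them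
   are identified when no bilinear map to a vector space tells them apart. *)
Definition tens_eq (s t : seq (V * W)) : bool :=
  `[< forall U (b : V -> W -> U),
        bilinear_map b -> bilin_sum b s = bilin_sum b t >].

Lemma tens_eq_equiv : equiv_class_of tens_eq.
Proof.
split=> [s|s t|t s u]; first exact/asboolP.
- by apply/asboolP/asboolP => st U b /st ->.
- by move=> /asboolP st /asboolP tu; apply/asboolP => U b bb; rewrite st ?tu.
Qed.

Canonical tens_eq_rel := EquivRelPack tens_eq_equiv.

Definition tens := {eq_quot tens_eq}.

HB.instance Definition _ : EqQuotient (seq (V * W)) tens_eq tens :=
  EqQuotient.on tens.
HB.instance Definition _ := Choice.on tens.

Definition tpure (v : V) (w : W) : tens := \pi_tens [:: (v, w)].

Definition tlift U (b : V -> W -> U) (t : tens) : U := bilin_sum b (repr t).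

Lemma tlift_pi U (b : V -> W -> U) s :
  bilinear_map b -> tlift b (\pi_tens s) = bilin_sum b s.
Proof.
move=> bb; rewrite /tlift; case: piP => t /eqmodP /asboolP st.
by rewrite (st _ _ bb).
Qed.

Lemma tens_ext (x y : tens) :
  (forall U (b : V -> W -> U), bilinear_map b -> tlift b x = tlift b y) ->
  x = y.
Proof.
move=> xy; rewrite -[x]reprK -[y]reprK; apply/eqmodP/asboolP => U b bb.
exact: xy.
Qed.

Lemma bilin_sum_cat U (b : V -> W -> U) s t :
  bilin_sum b (s ++ t) = bilin_sum b s + bilin_sum b t.
Proof. by rewrite /bilin_sum big_cat. Qed.

Lemma bilin_sum_scale U (b : V -> W -> U) a s : bilinear_map b ->
  bilin_sum b [seq (a *: p.1, p.2) | p <- s] = a *: bilin_sum b s.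
Proof.
move=> [bl _]; rewrite /bilin_sum big_map scaler_sumr; apply: eq_bigr => p _ /=.
rewrite -[a *: p.1]addr0 bl -[in RHS](addr0 (_ *: _)); congr (_ + _).
by have := bl p.2 (-1) 0 0; rewrite scaler0 addr0 scaleN1r addNr.
Qed.

Definition tens_zero : tens := \pi_tens [::].
Definition tens_add (x y : tens) : tens := \pi_tens (repr x ++ repr y).
Definition tens_scale (a : k) (x : tens) : tens :=
  \pi_tens [seq (a *: p.1, p.2) | p <- repr x].
Definition tens_opp (x : tens) : tens := tens_scale (-1) x.

Lemma tlift0 U (b : V -> W -> U) : bilinear_map b -> tlift b tens_zero = 0.
Proof. by move=> bb; rewrite tlift_pi // /bilin_sum big_nil. Qed.

Lemma tlift_add U (b : V -> W -> U) x y : bilinear_map b ->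
  tlift b (tens_add x y) = tlift b x + tlift b y.
Proof. by move=> bb; rewrite tlift_pi // bilin_sum_cat. Qed.

Lemma tlift_scale U (b : V -> W -> U) a x : bilinear_map b ->
  tlift b (tens_scale a x) = a *: tlift b x.
Proof. by move=> bb; rewrite tlift_pi // bilin_sum_scale. Qed.

Lemma tens_addA : associative tens_add.
Proof. by move=> x y z; apply: tens_ext => U b bb; rewrite !tlift_add // addrA. Qed.

Lemma tens_addC : commutative tens_add.
Proof. by move=> x y; apply: tens_ext => U b bb; rewrite !tlift_add // addrC. Qed.

Lemma tens_add0 : left_id tens_zero tens_add.
Proof.
by move=> x; apply: tens_ext => U b bb; rewrite tlift_add // tlift0 // add0r.
Qed.

Lemma tens_addN : left_inverse tens_zero tens_opp tens_add.
Proof.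
move=> x; apply: tens_ext => U b bb.
by rewrite tlift_add // tlift_scale // tlift0 // scaleN1r addNr.
Qed.

HB.instance Definition _ :=
  GRing.isZmodule.Build tens tens_addA tens_addC tens_add0 tens_addN.

Lemma tens_scaleA a b x : tens_scale a (tens_scale b x) = tens_scale (a * b) x.
Proof.
by apply: tens_ext => U f bf; rewrite !tlift_scale // scalerA.
Qed.

Lemma tens_scale1 : left_id 1 tens_scale.
Proof.
by move=> x; apply: tens_ext => U f bf; rewrite !tlift_scale // scale1r.
Qed.

Lemma tens_scaleDr : right_distributive tens_scale +%R.
Proof.
move=> a x y; apply: tens_ext => U f bf.
by rewrite !(tlift_add, tlift_scale) // scalerDr.
Qed.

Lemma tens_scaleDl x : {morph tens_scale^~ x : a b / a + b}.
Proof.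
move=> a b; apply: tens_ext => U f bf.
by rewrite !(tlift_add, tlift_scale) // scalerDl.
Qed.

HB.instance Definition _ := GRing.Zmodule_isLmodule.Build k tens
  tens_scaleA tens_scale1 tens_scaleDr tens_scaleDl.

Lemma tlift_linear U (b : V -> W -> U) : bilinear_map b -> linear (tlift b).
Proof.
move=> bb a x y.
by rewrite -tlift_scale // -tlift_add.
Qed.

Lemma tlift_tpure U (b : V -> W -> U) v w :
  bilinear_map b -> tlift b (tpure v w) = b v w.
Proof. by move=> bb; rewrite tlift_pi // /bilin_sum big_seq1. Qed.

Lemma tpure_bilinear : bilinear_map tpure.
Proof.
split=> [w a v v'|v a w w']; apply: tens_ext => U b bb;
  by rewrite (tlift_linear bb) !tlift_tpure //; case: bb.
Qed.

Lemma tens_sum (x : tens) : x = \sum_(p <- repr x) tpure p.1 p.2.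
Proof.
apply: tens_ext => U b bb.
have -> : tlift b (\sum_(p <- repr x) tpure p.1 p.2) =
          \sum_(p <- repr x) tlift b (tpure p.1 p.2).
  elim: (repr x) => [|p s IH]; first by rewrite !big_nil tlift0.
  by rewrite !big_cons tlift_add // IH.
by apply: eq_bigr => p _; rewrite tlift_tpure.
Qed.

Lemma tens_eqP (U : lmodType k) (f g : tens -> U) :
  linear f -> linear g -> (forall v w, f (tpure v w) = g (tpure v w)) -> f =1 g.
Proof.
move=> lf lg fg x; rewrite (tens_sum x).
have lin0 (h : tens -> U) : linear h -> h 0 = 0.
  by move=> lh; have := lh (-1) 0 0; rewrite scaler0 addr0 scaleN1r addNr.
elim: (repr x) => [|p s IH]; first by rewrite !big_nil !lin0.
by rewrite !big_cons -[tpure _ _]scale1r lf lg IH fg.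
Qed.

Lemma tlift_eq U (f g : V -> W -> U) t :
  (forall v w, f v w = g v w) -> tlift f t = tlift g t.
Proof. by move=> fg; rewrite /tlift /bilin_sum; apply: eq_bigr. Qed.

Lemma tlift_comb U a (f g : V -> W -> U) t :
  tlift (fun v w => a *: f v w + g v w) t = a *: tlift f t + tlift g t.
Proof. by rewrite /tlift /bilin_sum big_split scaler_sumr. Qed.

End Def.
End Tensor.

Arguments tlift {k V W U} b t.
Arguments tpure {k V W} v w.
Notation "V ⊗ W" := (tens V%type W%type) : type_scope.
Notation "v ⊗ w" := (tpure v w) : ring_scope.

Section TensorAlgebra.
Variables (k : fieldType) (A B : algType k).

Definition tens_one : A ⊗ B := 1 ⊗ 1.
Definition tens_mul (x y : A ⊗ B) : A ⊗ B :=
  tlift (fun a b => tlift (fun a' b' => (a * a') ⊗ (b * b')) y) x.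

Lemma tens_mul_bil2 a b :
  bilinear_map (fun (a' : A) (b' : B) => (a * a') ⊗ (b * b')).
Proof.
have [tl tr] := tpure_bilinear A B.
by split=> [b' c x y|a' c x y]; rewrite mulrDr -scalerAr (tl, tr).
Qed.

Lemma tens_mul_bil1 y : bilinear_map (fun (a : A) (b : B) =>
  tlift (fun a' b' => (a * a') ⊗ (b * b')) y).
Proof.
have [tl tr] := tpure_bilinear A B.
by split=> [b c a a'|a c b b']; rewrite -tlift_comb; apply: tlift_eq => u v;
  rewrite mulrDl -scalerAl (tl, tr).
Qed.

Lemma tens_mul_linl y : linear (fun x => tens_mul x y).
Proof. exact: tlift_linear (tens_mul_bil1 y). Qed.

Lemma tens_mul_linr x : linear (tens_mul x).
Proof.
move=> c y z; rewrite /tens_mul -tlift_comb; apply: tlift_eq => a b.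
exact: (tlift_linear (tens_mul_bil2 _ _)).
Qed.

Lemma tens_mulE a b a' b' :
  tens_mul (a ⊗ b) (a' ⊗ b') = (a * a') ⊗ (b * b').
Proof.
rewrite /tens_mul tlift_tpure; last exact: tens_mul_bil1.
by rewrite tlift_tpure //; apply: tens_mul_bil2.
Qed.

Lemma tens_mulA : associative tens_mul.
Proof.
move=> x y z.
apply: (tens_eqP (f := fun x => tens_mul x (tens_mul y z))
                 (g := fun x => tens_mul (tens_mul x y) z)).
- exact: tens_mul_linl.
- by move=> c u v; rewrite !tens_mul_linl.
move=> a b; apply: (tens_eqP (f := fun y => tens_mul (a ⊗ b) (tens_mul y z))
                 (g := fun y => tens_mul (tens_mul (a ⊗ b) y) z)).
- by move=> c u v; rewrite tens_mul_linl tens_mul_linr.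
- by move=> c u v; rewrite tens_mul_linr tens_mul_linl.
move=> a' b'; apply: (tens_eqP (f := fun z => tens_mul _ (tens_mul _ z))).
- by move=> c u v; rewrite !tens_mul_linr.
- exact: tens_mul_linr.
by move=> a'' b''; rewrite !tens_mulE !mulrA.
Qed.

Lemma tens_mul1 : left_id tens_one tens_mul.
Proof.
apply: tens_eqP => [|//|a b]; first exact: tens_mul_linr.
by rewrite tens_mulE !mul1r.
Qed.

Lemma tens_mulr1 : right_id tens_one tens_mul.
Proof.
apply: (tens_eqP (f := fun x => tens_mul x tens_one)) => [|//|a b].
  exact: tens_mul_linl.
by rewrite tens_mulE !mulr1.
Qed.

Lemma tens_mulDl : left_distributive tens_mul +%R.
Proof.
by move=> x y z; have := tens_mul_linl z 1 x y; rewrite !scale1r.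
Qed.

Lemma tens_mulDr : right_distributive tens_mul +%R.
Proof.
by move=> x y z; have := tens_mul_linr x 1 y z; rewrite !scale1r.
Qed.

Lemma tens_one_neq0 : tens_one != 0.
Proof.
have [f [flin f1]] := separating_functional (oner_neq0 A).
have [g [glin g1]] := separating_functional (oner_neq0 B).
have bfg : bilinear_map (fun a b => f a * g b : k^o).
  split=> [b c x y|a c x y] /=; first by rewrite flin mulrDl -mulrA.
  by rewrite glin mulrDr mulrCA.
apply/eqP => t10; have := tlift_tpure 1 1 bfg; rewrite -/tens_one t10 f1 g1.
by rewrite (tlift0 bfg) mul1r => /esym/eqP; rewrite oner_eq0.
Qed.

HB.instance Definition _ := GRing.Zmodule_isNzRing.Build (tens A B)
  tens_mulA tens_mul1 tens_mulr1 tens_mulDl tens_mulDr tens_one_neq0.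

Lemma tens_scaleAl (c : k) (x y : A ⊗ B) : c *: (x * y) = (c *: x) * y.
Proof.
have /esym := tens_mul_linl y c x 0; rewrite addr0.
by have -> : tens_mul 0 y = 0 := mul0r y; rewrite addr0.
Qed.

HB.instance Definition _ :=
  GRing.Lmodule_isLalgebra.Build k (tens A B) tens_scaleAl.

Lemma tens_scaleAr (c : k) (x y : A ⊗ B) : c *: (x * y) = x * (c *: y).
Proof.
have /esym := tens_mul_linr x c y 0; rewrite addr0.
by have -> : tens_mul x 0 = 0 := mulr0 x; rewrite addr0.
Qed.

HB.instance Definition _ :=
  GRing.Lalgebra_isAlgebra.Build k (tens A B) tens_scaleAr.

End TensorAlgebra.

Section OppositeAlgebra.
Variables (k : fieldType) (A : algType k).

HB.instance Definition _ := GRing.Lmodule.copy (A^c) A.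

Lemma op_scaleAl (c : k) (x y : A^c) : c *: (x * y) = (c *: x : A^c) * y.
Proof. exact: (@scalerAr k A c y x). Qed.

HB.instance Definition _ := GRing.Lmodule_isLalgebra.Build k (A^c) op_scaleAl.

Lemma op_scaleAr (c : k) (x y : A^c) : c *: (x * y) = x * (c *: y : A^c).
Proof. exact: (@scalerAl k A c y x). Qed.

HB.instance Definition _ := GRing.Lalgebra_isAlgebra.Build k (A^c) op_scaleAr.

End OppositeAlgebra.

(* An R-bimodule is a left module over the enveloping algebra R ⊗ R^c, with
   (a ⊗ b) acting by m |-> a m b; here R itself. *)
Section RegularBimodule.
Variables (k : fieldType) (R : algType k).

Definition enveloping : algType k := tens R R^c.

Definition bimod : Type := R.
HB.instance Definition _ := GRing.Zmodule.copy bimod R.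

Definition bimod_act (x : enveloping) (m : bimod) : bimod :=
  tlift (fun (a : R) (b : R^c) => a * (m : R) * (b : R)) (x : R ⊗ R^c).

Lemma bimod_act_bil (m : R) :
  bilinear_map (fun (a : R) (b : R^c) => a * m * (b : R)).
Proof.
split=> [b c x y|a c x y].
  by rewrite mulrDl mulrDl -!scalerAl.
have -> : (c *: x + y : R^c) = c *: (x : R) + (y : R) by [].
by rewrite mulrDr -scalerAr.
Qed.

Lemma bimod_actDl m : {morph bimod_act^~ m : x y / x + y}.
Proof. by move=> x y; exact: (tlift_add _ _ (bimod_act_bil m)). Qed.

Lemma bimod_act_tpure (a : R) (b : R^c) (m : R) :
  bimod_act (a ⊗ b) m = a * m * (b : R).
Proof. exact: (tlift_tpure _ _ (bimod_act_bil m)). Qed.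

Lemma bimod_actDr : right_distributive bimod_act +%R.
Proof.
move=> x m n; rewrite /bimod_act /tlift /bilin_sum -big_split.
by apply: eq_bigr => p _ /=; rewrite mulrDr mulrDl.
Qed.

Lemma bimod_act1 : left_id 1 bimod_act.
Proof.
move=> m; rewrite (_ : 1 = (1 : R) ⊗ (1 : R^c)) //.
by rewrite bimod_act_tpure mul1r mulr1.
Qed.

Lemma bimod_actA x y m : bimod_act x (bimod_act y m) = bimod_act (x * y) m.
Proof.
have lin n : linear (fun x : tens R R^c => bimod_act x n : R).
  exact: tlift_linear (bimod_act_bil n).
pose f y' x' : R := bimod_act x' (bimod_act y' m).
pose g y' (x' : tens R R^c) : R := bimod_act (tens_mul x' y' : tens R R^c) m.
have flin y' : linear (f y') by exact: lin.
have glin y' : linear (g y').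
  by move=> c u v; rewrite /g tens_mul_linl (lin m).
apply: (tens_eqP (flin y) (glin y)) => a b; move: y.
apply: (@tens_eqP _ _ _ _ (fun y' => f y' (a ⊗ b)) (fun y' => g y' (a ⊗ b))).
- move=> c u v; rewrite /f !bimod_act_tpure.
  by rewrite (lin m) mulrDr mulrDl -scalerAr -scalerAl.
- by move=> c u v; rewrite /g tens_mul_linr (lin m).
move=> a' b'; rewrite /f /g tens_mulE !bimod_act_tpure.
by rewrite -[X in _ = _ * X]/((b' : R) * (b : R)) !mulrA.
Qed.

HB.instance Definition _ := GRing.Zmodule_isLmodule.Build enveloping bimod
  bimod_actA bimod_act1 bimod_actDr bimod_actDl.

End RegularBimodule.

(* Restriction of scalars along k -> A. *)
Section Restriction.
Variables (k : fieldType) (A : algType k) (M : lmodType A).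

Definition restr : Type := M.
HB.instance Definition _ := GRing.Zmodule.copy restr M.

Definition restr_scale (c : k) (m : restr) : restr := (c%:A : A) *: (m : M).

Lemma restr_scaleA a b m :
  restr_scale a (restr_scale b m) = restr_scale (a * b) m.
Proof. by rewrite /restr_scale scalerA -scalerAl mul1r scalerA. Qed.

Lemma restr_scale1 : left_id 1 restr_scale.
Proof. by move=> m; rewrite /restr_scale scale1r scale1r. Qed.

Lemma restr_scaleDr : right_distributive restr_scale +%R.
Proof. by move=> a m n; rewrite /restr_scale scalerDr. Qed.

Lemma restr_scaleDl m : {morph restr_scale^~ m : a b / a + b}.
Proof. by move=> a b; rewrite /restr_scale scalerDl scalerDl. Qed.

HB.instance Definition _ := GRing.Zmodule_isLmodule.Build k restr
  restr_scaleA restr_scale1 restr_scaleDr restr_scaleDl.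

End Restriction.

Section QuotientSpace.
Variables (k : fieldType) (V : lmodType k) (S : submodClosed V).

Lemma submodN x : x \in S -> - x \in S.
Proof. by rewrite -scaleN1r; apply: rpredZ. Qed.

Definition quotsp_eqb (x y : V) := x - y \in S.

Lemma quotsp_equiv : equiv_class_of quotsp_eqb.
Proof.
rewrite /quotsp_eqb; split=> [x|x y|y x z]; first by rewrite subrr rpred0.
  by apply/idP/idP => /submodN; rewrite opprB.
by move=> xy yz; rewrite -[x](addrNK y) -addrA rpredD.
Qed.

Canonical quotsp_rel := EquivRelPack quotsp_equiv.

Definition quotsp := {eq_quot quotsp_eqb}.
HB.instance Definition _ : EqQuotient V quotsp_eqb quotsp := EqQuotient.on quotsp.
HB.instance Definition _ := Choice.on quotsp.

Lemma quotsp_eq x y : (\pi_quotsp x == \pi_quotsp y) = (x - y \in S).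
Proof. by rewrite eqmodE. Qed.

Definition quotsp_add (x y : quotsp) : quotsp := \pi_quotsp (repr x + repr y).
Definition quotsp_scale (a : k) (x : quotsp) : quotsp := \pi_quotsp (a *: repr x).

Lemma quotsp_add_pi x y :
  quotsp_add (\pi_quotsp x) (\pi_quotsp y) = \pi_quotsp (x + y).
Proof.
apply/eqP; rewrite quotsp_eq opprD addrACA.
by rewrite rpredD // -quotsp_eq reprK.
Qed.

Lemma quotsp_scale_pi a x : quotsp_scale a (\pi_quotsp x) = \pi_quotsp (a *: x).
Proof.
apply/eqP; rewrite quotsp_eq -scalerBr rpredZ //.
by rewrite -quotsp_eq reprK.
Qed.

Definition quotsp_opp (x : quotsp) : quotsp := quotsp_scale (-1) x.

Lemma quotsp_addA : associative quotsp_add.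
Proof.
elim/quotW => x; elim/quotW => y; elim/quotW => z.
rewrite (quotsp_add_pi y z) (quotsp_add_pi x y).
by rewrite (quotsp_add_pi x) (quotsp_add_pi _ z) addrA.
Qed.

Lemma quotsp_addC : commutative quotsp_add.
Proof. by move=> x y; rewrite /quotsp_add addrC. Qed.

Lemma quotsp_add0 : left_id (\pi_quotsp 0) quotsp_add.
Proof. by elim/quotW => x; rewrite quotsp_add_pi add0r. Qed.

Lemma quotsp_addN : left_inverse (\pi_quotsp 0) quotsp_opp quotsp_add.
Proof.
elim/quotW => x; rewrite /quotsp_opp quotsp_scale_pi quotsp_add_pi.
by rewrite scaleN1r addNr.
Qed.

HB.instance Definition _ := GRing.isZmodule.Build quotsp
  quotsp_addA quotsp_addC quotsp_add0 quotsp_addN.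

Lemma quotsp_scaleA a b x :
  quotsp_scale a (quotsp_scale b x) = quotsp_scale (a * b) x.
Proof. by elim/quotW: x => x; rewrite (quotsp_scale_pi b x) !quotsp_scale_pi scalerA. Qed.

Lemma quotsp_scale1 : left_id 1 quotsp_scale.
Proof. by elim/quotW => x; rewrite quotsp_scale_pi scale1r. Qed.

Lemma quotsp_scaleDr : right_distributive quotsp_scale +%R.
Proof.
move=> a; elim/quotW => x; elim/quotW => y.
transitivity (quotsp_scale a (\pi_quotsp (x + y))).
  by congr quotsp_scale; apply: quotsp_add_pi.
by rewrite !quotsp_scale_pi [RHS]quotsp_add_pi scalerDr.
Qed.

Lemma quotsp_scaleDl x : {morph quotsp_scale^~ x : a b / a + b}.
Proof.
move=> a b; elim/quotW: x => x.
by rewrite !quotsp_scale_pi [RHS]quotsp_add_pi scalerDl.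
Qed.

HB.instance Definition _ := GRing.Zmodule_isLmodule.Build k quotsp
  quotsp_scaleA quotsp_scale1 quotsp_scaleDr quotsp_scaleDl.

End QuotientSpace.

(* Ext^n_A(M, N) is computed with the bar resolution of M, whose n-th term
   A ⊗ A^(⊗ n) ⊗ M is free over A because k is a field.  An A-linear map from
   it to N is a map A^n x M -> N that is k-linear in each argument; A^n is
   encoded by lists, cochains vanishing on lists of any other length. *)
Section Ext.
Variables (k : fieldType) (A : algType k) (M N : lmodType A).

Definition cochain_fun : Type := seq A -> M -> restr N.
HB.instance Definition _ := GRing.Lmodule.copy cochain_fun (seq A -> M -> restr N).

Definition cochain (n : nat) (f : cochain_fun) : Prop :=
  [/\ forall s m, size s <> n -> f s m = 0,
      forall s t c a b m, f (s ++ (c *: a + b) :: t) m =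
        c *: f (s ++ a :: t) m + f (s ++ b :: t) m
    & forall s c m m', f s ((c%:A : A) *: m + m') = c *: f s m + f s m'].

Definition bar_merge (i : nat) (s : seq A) : seq A :=
  take i s ++ s`_i * s`_i.+1 :: drop i.+2 s.

(* (df)(a1, .., an, m) = a1 f(a2, .., an, m)
     + sum_(0 < i < n) (-1)^i f(.., ai a(i+1), .., m)
     + (-1)^n f(a1, .., a(n-1), an m). *)
Definition cobound (f : cochain_fun) : cochain_fun := fun s m =>
  if s is a :: s' then
    a *: (f s' m : N) + \sum_(i < size s') (-1) ^+ i.+1 *: (f (bar_merge i s) m : N)
    + (-1) ^+ size s *: (f (belast a s') (last a s' *: m) : N)
  else 0.

Definition cocycles (n : nat) : {pred cochain_fun} :=
  fun f => `[< cochain n f /\ cobound f = 0 >].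

Lemma restr_scale_comm (a : A) (c : k) (x : restr N) :
  a *: (c *: x : N) = (c *: (a *: (x : N) : restr N) : N).
Proof.
rewrite [LHS]scalerA [RHS]scalerA; congr (_ *: (x : N)).
by rewrite -scalerAr mulr1 -scalerAl mul1r.
Qed.

Lemma cobound_linear : linear cobound.
Proof.
have lin (a : A) c (x y : restr N) :
    a *: (c *: x + y : N) = (c *: (a *: (x : N) : restr N) + (a *: (y : N))).
  by rewrite scalerDr restr_scale_comm.
move=> c f g; apply/funext => -[|a s]; apply/funext => m.
  by rewrite /cobound /= !fctE scaler0 addr0.
rewrite /cobound !fctE /= !lin; under eq_bigr do rewrite lin.
rewrite big_split /= -scaler_sumr !scalerDr.
by rewrite [X in X + _ = _]addrACA [LHS]addrACA.
Qed.

Lemma cochain_linear n c f g :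
  cochain n f -> cochain n g -> cochain n (c *: f + g).
Proof.
have comm (a b : k) (x y x' y' : restr N) :
    a *: (b *: x + y) + (b *: x' + y') =
    b *: (a *: x + x') + (a *: y + y').
  by rewrite !scalerDr !scalerA mulrC addrACA.
move=> [f0 fA fM] [g0 gA gM]; split=> [s m sn|s t a x y m|s a m m'].
- by rewrite !fctE f0 // g0 // scaler0 addr0.
- by rewrite !fctE fA gA comm.
- by rewrite !fctE fM gM comm.
Qed.

Lemma cochain0 n : cochain n 0.
Proof.
by split=> [//|s t c a b m|s c m m']; apply/esym;
  rewrite -[RHS](scaler0 (restr N) c) -[RHS]addr0.
Qed.

Lemma cobound0 : cobound 0 = 0.
Proof. by have := cobound_linear (-1) 0 0; rewrite scaler0 addr0 scaleN1r addNr. Qed.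

Lemma cocycles_submod n : submod_closed (cocycles n).
Proof.
split=> [|c f g /asboolP[f1 f2] /asboolP[g1 g2]]; apply/asboolP; split.
- exact: cochain0.
- exact: cobound0.
- exact: cochain_linear.
- by rewrite cobound_linear f2 g2 scaler0 addr0.
Qed.

HB.instance Definition _ n :=
  GRing.isSubmodClosed.Build k cochain_fun (cocycles n) (cocycles_submod n).

Record cocycle (n : nat) := Cocycle {cocycle_val : cochain_fun;
  _ : cocycle_val \in cocycles n}.

HB.instance Definition _ n := [isSub for @cocycle_val n].
HB.instance Definition _ n := [Choice of cocycle n by <:].
HB.instance Definition _ n := [SubChoice_isSubLmodule of cocycle n by <:].

Definition coboundaries (n : nat) : {pred cocycle n} := fun z =>
  `[< if n is n'.+1 then exists2 g, cochain n' g & val z = cobound g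
      else val z = 0 >].

Lemma coboundaries_submod n : submod_closed (@coboundaries n).
Proof.
have valP' m c (x y : cocycle m) : val (c *: x + y) = c *: val x + val y.
  by rewrite linearP.
split=> [|c x y /asboolP + /asboolP +]; first apply/asboolP; last first.
  move=> xb yb; apply/asboolP; case: n x y xb yb => [|n] x y.
    by move=> x0 y0; rewrite valP' x0 y0 scaler0 addr0.
  move=> [f f1 fx] [g g1 gy]; exists (c *: f + g); first exact: cochain_linear.
  by rewrite valP' fx gy cobound_linear.
by case: n => [|n] //; exists 0; [exact: cochain0|rewrite cobound0].
Qed.

HB.instance Definition _ n :=
  GRing.isSubmodClosed.Build k (cocycle n)
  (@coboundaries n) (coboundaries_submod n).

Definition Ext (n : nat) : lmodType k :=
  quotsp (@coboundaries n : submodClosed (cocycle n)).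

(* The class of f, which is meant to be an n-cocycle; 0 otherwise. *)
Definition ext_class (n : nat) (f : cochain_fun) : Ext n :=
  \pi_(quotsp (@coboundaries n)) (insubd (0 : cocycle n) f : cocycle n).

Definition ext_rep (n : nat) (x : Ext n) : cochain_fun :=
  val (repr (x : quotsp (@coboundaries n)) : cocycle n).

End Ext.


(* Composition Ext^p(N, L) x Ext^q(M, N) -> Ext^(p + q)(M, L), up to the usual
   sign (-1)^(p q), which no statement below depends on. *)
Definition ext_comp (k : fieldType) (A : algType k) (M N L : lmodType A)
    (p q : nat) (x : Ext N L p) (y : Ext M N q) : Ext M L (p + q) :=
  ext_class (p + q)
    (fun s m => ext_rep x (take p s) (ext_rep y (drop p s) m) : restr L).

(* The right A-module structure of Ext^n_A(M, A). *)
Definition ext_mulr (k : fieldType) (A : algType k) (M : lmodType A) (n : nat)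
    (x : Ext M A^o n) (a : A) : Ext M A^o n :=
  ext_class n (fun s m => (ext_rep x s m : A) * a : restr A^o).

Section Dimensions.
Variable A : nzRingType.

Definition projective (P : lmodType A) : Prop :=
  forall (X Y : lmodType A) (p : {linear X -> Y}) (f : {linear P -> Y}),
    (forall y, exists x, p x = y) ->
    exists g : {linear P -> X}, forall x, p (g x) = f x.

Definition injective_mod (I : lmodType A) : Prop :=
  forall (X Y : lmodType A) (i : {linear X -> Y}) (f : {linear X -> I}),
    injective i -> exists g : {linear Y -> I}, forall x, g (i x) = f x.

Definition short_exact (X Y Z : lmodType A)
    (i : {linear X -> Y}) (p : {linear Y -> Z}) : Prop :=
  [/\ injective i, forall z, exists y, p y = z
    & forall y, p y = 0 <-> exists x, i x = y].

Fixpoint projdim_le (n : nat) (M : lmodType A) : Prop :=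
  if n is n'.+1 then
    exists (K P : lmodType A) (i : {linear K -> P}) (p : {linear P -> M}),
      [/\ short_exact i p, projective P & projdim_le n' K]
  else projective M.

Fixpoint injdim_le (n : nat) (M : lmodType A) : Prop :=
  if n is n'.+1 then
    exists (I C : lmodType A) (i : {linear M -> I}) (p : {linear I -> C}),
      [/\ short_exact i p, injective_mod I & injdim_le n' C]
  else injective_mod M.

Definition injdim_eq (d : nat) (M : lmodType A) : Prop :=
  injdim_le d M /\ forall n, (n < d)%N -> ~ injdim_le n M.

Definition finite_gldim : Prop := exists n, forall M, projdim_le n M.

End Dimensions.

Definition triv (k : fieldType) (A : algType k) (aug : {lrmorphism A -> k^o}) :
  Type := k.

Section TrivialModule.
Variables (k : fieldType) (A : algType k) (aug : {lrmorphism A -> k^o}).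
Local Notation triv := (triv aug).

HB.instance Definition _ := GRing.Zmodule.copy triv k.

Definition triv_act (a : A) (c : triv) : triv := (aug a : k) * c.

Lemma triv_actA a b c : triv_act a (triv_act b c) = triv_act (a * b) c.
Proof. by rewrite /triv_act rmorphM mulrA. Qed.

Lemma triv_act1 : left_id 1 triv_act.
Proof. by move=> c; rewrite /triv_act rmorph1 mul1r. Qed.

Lemma triv_actDr : right_distributive triv_act +%R.
Proof. by move=> a b c; rewrite /triv_act mulrDr. Qed.

Lemma triv_actDl c : {morph triv_act^~ c : a b / a + b}.
Proof. by move=> a b; rewrite /triv_act rmorphD mulrDl. Qed.

HB.instance Definition _ := GRing.Zmodule_isLmodule.Build A triv
  triv_actA triv_act1 triv_actDr triv_actDl.

Definition op_aug : A^c -> k^o := aug.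

Lemma op_aug_linear : linear op_aug.
Proof. by move=> c x y; exact: (linearP aug c x y). Qed.

Lemma op_aug_monoid : monoid_morphism op_aug.
Proof.
by split=> [|x y]; rewrite /op_aug ?rmorph1 // [LHS](rmorphM aug) [LHS]mulrC.
Qed.

HB.instance Definition _ := GRing.isLinear.Build k A^c k^o *:%R op_aug op_aug_linear.
HB.instance Definition _ := GRing.isMonoidMorphism.Build A^c k^o op_aug op_aug_monoid.

End TrivialModule.

(* Connected N-gradings: gr_proj n is the projection onto degree n and gr_aug
   the projection onto degree 0, which is k. *)
Record connected_grading (k : fieldType) (R : algType k) := ConnectedGrading {
  gr_proj : nat -> {linear R -> R};
  gr_aug : {lrmorphism R -> k^o};
  gr_projK : forall m n x,
    gr_proj m (gr_proj n x) = if m == n then gr_proj n x else 0;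
  gr_sum : forall x, exists N, x = \sum_(i < N) gr_proj i x;
  gr_mul : forall m n x y,
    gr_proj (m + n)%N (gr_proj m x * gr_proj n y) = gr_proj m x * gr_proj n y;
  gr_degree0 : forall x, gr_proj 0%N x = (gr_aug x : k)%:A
}.

Section GradedAlgebra.
Variables (k : fieldType) (R : algType k) (g : connected_grading R).

Definition homog (n : nat) (x : R) : Prop := gr_proj g n x = x.

Definition generated_in_degree1 : Prop :=
  forall P : R -> Prop, P 1 ->
    (forall (c : k) x y, P x -> P y -> P (c *: x + y)) ->
    (forall x y, P x -> P y -> P (x * y)) ->
    (forall x, homog 1 x -> P x) ->
  forall x, P x.

Definition ext_concentrated (A : algType k) (M N : lmodType A) (d : nat) : Prop :=
  (forall i, i <> d -> forall x : Ext M N i, x = 0) /\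
  exists f : {linear Ext M N d -> k^o}, bijective f.

(* Modules need not be graded here; for connected graded algebras of finite
   global dimension this does not change the notion. *)
Definition AS_regular (d : nat) : Prop :=
  [/\ injdim_eq d (R^o) /\ injdim_eq d ((R^c)^o),
      ext_concentrated (triv (gr_aug g)) (R^o) d,
      ext_concentrated (triv (op_aug (gr_aug g))) ((R^c)^o) d
    & finite_gldim R /\ finite_gldim R^c].

(* Ext^d_(R^e)(R, R^e) is isomorphic to R with left action twisted by mu; its
   bimodule structure comes from right multiplication on R^e, so that
   b x a is x (a ⊗ b). *)
Definition nakayama_aut (d : nat) (mu : {lrmorphism R -> R}) : Prop :=
  [/\ bijective mu, forall n x, homog n x -> homog n (mu x)
    & exists f : {linear Ext (bimod R) (enveloping R)^o d -> R},
        bijective f /\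
        forall x (a : R) (b : R^c), f (ext_mulr x (a ⊗ b)) = mu b * f x * a].

(* The Yoneda algebra, degree by degree. *)
Definition yoneda (n : nat) : lmodType k :=
  Ext (triv (gr_aug g)) (triv (gr_aug g)) n.

(* Both orders of composition are in use for the product of the Yoneda algebra:
   x y stands for x after y, or, when rev is true, for y after x. *)
Definition yoneda_form (rev : bool) (l : forall n, {linear yoneda n -> k^o})
    (p q : nat) (x : yoneda p) (y : yoneda q) : k :=
  if rev then l _ (ext_comp y x) else l _ (ext_comp x y).

Definition finite_dim (V : lmodType k) : Prop :=
  exists n (b : 'I_n -> V), forall v, exists c : 'I_n -> k,
    v = \sum_(i < n) c i *: b i.

Definition yoneda_frobenius (rev : bool) (d : nat)
    (l : forall n, {linear yoneda n -> k^o}) : Prop :=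
  [/\ forall n, finite_dim (yoneda n),
      exists N, forall n, (N <= n)%N -> forall x : yoneda n, x = 0,
      forall n, n <> d -> forall x, l n x = 0,
      forall p (x : yoneda p),
        (forall q (y : yoneda q), yoneda_form rev l x y = 0) -> x = 0
    & forall q (y : yoneda q),
        (forall p (x : yoneda p), yoneda_form rev l x y = 0) -> y = 0].

Definition yoneda_nakayama (rev : bool) (d : nat)
    (mu : forall n, {linear yoneda n -> yoneda n}) : Prop :=
  [/\ forall n, bijective (mu n),
      forall p q (x : yoneda p) (y : yoneda q),
        mu _ (ext_comp x y) = ext_comp (mu _ x) (mu _ y)
    & exists l : forall n, {linear yoneda n -> k^o},
        yoneda_frobenius rev d l /\
        forall p q (x : yoneda p) (a : yoneda q),
          yoneda_form rev l x a = yoneda_form rev l (mu _ a) x].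

(* The value at r of a degree 1 class, as a linear form on R_1. *)
Definition yoneda1_eval (x : yoneda 1) (r : R) : k := ext_rep x [:: r] (1 : k).

Definition degree1_matrix (mu : R -> R) (n : nat) (M : 'M[k]_n) : Prop :=
  exists x : 'I_n -> R,
    [/\ forall i, homog 1 (x i),
        forall r, homog 1 r -> exists! c : 'rV[k]_n, r = \sum_i c 0 i *: x i
      & forall j, mu (x j) = \sum_i M i j *: x i].

End GradedAlgebra.

Section Centralizers.
Variables (k : fieldType) (n : nat).

Definition centralizer (X P : 'M[k]_n) : Prop := P *m X = X *m P.
Definition power_centralizer (X P : 'M[k]_n) : Prop :=
  exists2 i, (0 < i)%N & centralizer (X ^+ i) P.
Definition commutative_set (C : 'M[k]_n -> Prop) : Prop :=
  forall P Q, C P -> C Q -> P *m Q = Q *m P.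

End Centralizers.

Definition central_nakayama (k : fieldType) (R : algType k)
    (g : connected_grading R) (mu : R -> R) : Prop :=
  exists n (M : 'M[k]_n),
    degree1_matrix g mu M /\ commutative_set (centralizer M).

Definition power_central_nakayama (k : fieldType) (R : algType k)
    (g : connected_grading R) (mu : R -> R) : Prop :=
  exists n (M : 'M[k]_n),
    degree1_matrix g mu M /\ commutative_set (power_centralizer M).

Section TensorMaps.
Variable k : fieldType.

Definition tmap (V V' W W' : lmodType k) (f : V -> V') (h : W -> W')
  (t : V ⊗ W) : V' ⊗ W' := tlift (fun v w => f v ⊗ h w) t.
Definition tassoc (U V W : lmodType k) (t : (U ⊗ V) ⊗ W) : U ⊗ (V ⊗ W) :=
  tlift (fun x w => tlift (fun u v => u ⊗ (v ⊗ w)) x) t.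
Definition tswap (V W : lmodType k) (t : V ⊗ W) : W ⊗ V :=
  tlift (fun v w => w ⊗ v) t.
Definition tens_sub (V W : lmodType k) (P : V -> Prop) (Q : W -> Prop)
    (t : V ⊗ W) : Prop :=
  exists s : seq (V * W), (forall p, p \in s -> P p.1 /\ Q p.2) /\
    t = \sum_(p <- s) p.1 ⊗ p.2.

End TensorMaps.

Record hopf_structure (k : fieldType) (H : algType k) := HopfStructure {
  comul : {lrmorphism H -> tens H H};
  counit : {lrmorphism H -> k^o};
  antipode : {linear H -> H};
  comulA : forall h, tassoc (tmap comul idfun (comul h)) =
                     tmap idfun comul (comul h);
  counitl : forall h, tlift (fun a b => (counit a : k) *: b) (comul h) = h;
  counitr : forall h, tlift (fun a b => (counit b : k) *: a) (comul h) = h;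
  antipodel : forall h,
    tlift (fun a b => antipode a * b) (comul h) = (counit h : k)%:A;
  antipoder : forall h,
    tlift (fun a b => a * antipode b) (comul h) = (counit h : k)%:A
}.

Section Hopf.
Variables (k : fieldType) (H : algType k) (hH : hopf_structure H).

Definition cocommutative : Prop := forall h, tswap (comul hH h) = comul hH h.

Definition finite_order_antipode : Prop :=
  exists2 n, (0 < n)%N & forall h, iter n (antipode hH) h = h.

Definition involutory : Prop := forall h, antipode hH (antipode hH h) = h.

Definition central (D : H) : Prop := forall h, D * h = h * D.

Definition hopf_subalgebra (K : H -> Prop) : Prop :=
  [/\ K 1, forall (c : k) x y, K x -> K y -> K (c *: x + y),
      forall x y, K x -> K y -> K (x * y),
      forall x, K x -> K (antipode hH x)
    & forall x, K x -> tens_sub K K (comul hH x)].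

(* H is isomorphic as a Hopf algebra to the group algebra of gT, x : gT
   corresponding to b x. *)
Definition is_group_algebra : Prop :=
  exists (gT : finGroupType) (b : gT -> H),
    [/\ b 1%g = 1 /\ (forall x y, b (x * y)%g = b x * b y),
        forall x, comul hH (b x) = b x ⊗ b x,
        forall x, (counit hH (b x) : k) = 1,
        forall x, antipode hH (b x) = b x^-1%g
      & forall h, exists! c : {ffun gT -> k}, h = \sum_x c x *: b x].

Variables (R : algType k).

Record coaction := Coaction {
  coact : {lrmorphism R -> tens R H};
  coactA : forall r, tassoc (tmap coact idfun (coact r)) =
                     tmap idfun (comul hH) (coact r);
  coact_counit : forall r,
    tlift (fun x h => (counit hH h : k) *: x) (coact r) = r
}.

Definition preserves_grading (g : connected_grading R) (rho : coaction) : Prop :=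
  forall n r, homog g n r -> tens_sub (homog g n) (fun=> True) (coact rho r).

Definition inner_faithful (rho : coaction) : Prop :=
  forall K, hopf_subalgebra K ->
    (forall r, tens_sub (fun=> True) K (coact rho r)) -> forall h, K h.

End Hopf.

(* Tor^R(k, k) is the homology of k ⊗_R (bar resolution of k), which is
   R^(⊗ n) in degree n. *)
Section Bar.
Variables (k : fieldType) (R : algType k) (aug : {lrmorphism R -> k^o}).

Fixpoint tpow (n : nat) : lmodType k :=
  if n is n'.+1 then tens R (tpow n') else k^o.

(* Left action of R on R^(⊗ n) through the first factor. *)
Definition tpow_act (n : nat) (r : R) : tpow n -> tpow n :=
  match n with
  | 0 => fun c => (aug r : k) * c
  | n'.+1 => tlift (fun r' t => (r * r') ⊗ t)
  end.

(* b(r1 ⊗ .. ⊗ rn ⊗ r) = r1 r2 ⊗ .. - .. + (-1)^n r1 ⊗ .. ⊗ rn aug(r): the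
   differential of the bar resolution, R ⊗ R^(⊗ n) being its n-th term. *)
Fixpoint bar_diff (n : nat) : tpow n.+1 -> tpow n :=
  match n with
  | 0 => tlift (fun r t => tpow_act (n := 0) r t)
  | n'.+1 => tlift (fun r (t : tpow n'.+1) =>
               tpow_act (n := n'.+1) r t - r ⊗ bar_diff t)
  end.

Definition tor_diff (n : nat) : tpow n -> tpow n.-1 :=
  match n with
  | 0 => fun=> 0
  | n'.+1 => fun t => tlift (fun r x => (aug r : k) *: x) t - bar_diff t
  end.

Fixpoint tpow_eval (n : nat) (f : seq R -> k) : tpow n -> k :=
  match n with
  | 0 => fun c => f [::] * c
  | n'.+1 => tlift (fun r t => tpow_eval (n := n') (fun s => f (r :: s)) t : k^o)
  end.

End Bar.

Section HomologicalCodeterminant.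
Variables (k : fieldType) (R : algType k) (g : connected_grading R).
Variables (H : algType k) (hH : hopf_structure H) (rho : coaction hH R).
Local Notation tpow := (@tpow k R).

(* The diagonal coaction
   r1 ⊗ .. ⊗ rn |-> r1_(0) ⊗ .. ⊗ rn_(0) ⊗ r1_(1) .. rn_(1). *)
Fixpoint tpow_coact (n : nat) : tpow n -> tpow n ⊗ H :=
  match n with
  | 0 => fun c => c ⊗ (1 : H)
  | n'.+1 => tlift (fun r t =>
      tlift (fun r0 r1 => tlift (fun t0 t1 => (r0 ⊗ t0) ⊗ (r1 * t1))
        (tpow_coact (n := n') t)) (coact rho r))
  end.

(* The pairing of Ext^n(k, k) with the cycles that represent Tor_n(k, k). *)
Definition tor_pairing (n : nat) (x : yoneda g n) (z : tpow n) : k :=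
  tpow_eval (fun s => ext_rep x s (1 : k)) z.

(* The left coaction x |-> x_(-1) ⊗ x_(0) on E is dual to the right coaction
   z |-> z_(0) ⊗ z_(1) on Tor: x_(-1) <x_(0), z> = <x, z_(0)> z_(1). *)
Definition dual_coaction
    (rhoE : forall n, {linear yoneda g n -> tens H (yoneda g n)}) : Prop :=
  forall n (x : yoneda g n) (z : tpow n), tor_diff (gr_aug g) z = 0 ->
    tlift (fun h y => tor_pairing y z *: h) (rhoE n x) =
    tlift (fun t h => tor_pairing x t *: h) (tpow_coact z).

Definition homological_codeterminant (d : nat)
    (rhoE : forall n, {linear yoneda g n -> tens H (yoneda g n)}) (D : H) : Prop :=
  exists2 e : yoneda g d, e <> 0 & rhoE d e = D ⊗ e.

End HomologicalCodeterminant.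

(* Main.v *)
Require Import Defs.
From HB Require Import structures.
From mathcomp Require Import all_boot all_order all_fingroup all_algebra.
From mathcomp Require Import generic_quotient boolp.

(** Write x_1, .., x_n for a basis of R_1 and a_1, .., a_n for the dual basis of
    E_1 = Ext^1(k, k).  The coaction rho(x_j) = sum_i x_i ⊗ h_ij is given by a
    matrix h over H, whose entries generate H as a Hopf algebra by
    inner-faithfulness; Δ(h_ij) = sum_s h_is ⊗ h_sj.  Hence it is enough that
    the h_ij are cocommutative.  Applying two linear forms to this formula, this
    holds as soon as the scalar matrices f(h), for f in the dual of H, commute
    with each other.

    The relation that makes them commute comes from the Frobenius form of E.  Let
    b_j be the basis of E_(d-1) dual to a_i, so that a_i b_j = delta_ij e in the
    line E_d, and let g be the matrix of the coaction on the b_j.  As the coaction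
    is multiplicative on E and maps e to D ⊗ e, the products a_i b_j give
    h g^T = D, that is g^T = S(h) D, and the products b_j a_i = Q_ij e then give
    D h Q = Q S^2(h) D (comatrix_twist).  By definition of the Nakayama
    automorphism, Q is the matrix of mu_E on E_1 or its inverse, so Q or its
    inverse is plus or minus the matrix M of mu_R on R_1.  Iterating,
    D^t h Q^t = Q^t S^(2t)(h) D^t; if D^t is central and S^(2t) = 1, then h, and
    every f(h), commutes with M^t (comatrix_centralizes).  This is the case for
    t = 1 under the first set of hypotheses, and for a suitable multiple t of m
    under the second one; the centralizer of M^t is commutative in both.

    The coaction on E is only given by its duality with the coaction on cycles of
    the bar complex, so multiplicativity has to be proved on cochains
    (rhoE_comp_left, rhoE_comp_right).  A product of classes is represented by
    the cup product, but the two factors of a cycle of degree d are not cycles.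
    This is repaired by coboundary_of_eval: a cochain that vanishes on cycles is
    a coboundary, and by the Leibniz rule the cup product of a coboundary and a
    cocycle vanishes on cycles.  The same device shows that D is group-like.

    If H is moreover finite-dimensional, it is spanned by group-like elements.
    Otherwise, as the contractions h |-> f(h_(1)) h_(2) commute, they have a
    common eigenvector modulo the span of the group-likes.  Multiplied by a
    group-like element and corrected by a combination of group-likes, it becomes
    a nonzero primitive element, and there is none in a finite-dimensional Hopf
    algebra in characteristic 0 (group_like_span, primitive_eq0). *)

Set Implicit Arguments.
Unset Strict Implicit.
Unset Printing Implicit Defensive.

Import GRing.Theory.
Local Open Scope ring_scope.
Local Open Scope quotient_scope.

(** * Linear forms and tensors *)

Section Tensors.
Variable k : fieldType.
Implicit Types V W U : lmodType k.

(** Linearity is a property of plain functions here, since most of the forms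
    below are written on the spot in terms of others. *)
Definition linear_form V (f : V -> k) : Prop :=
  forall a x y, f (a *: x + y) = a * f x + f y.

Definition linear_map V W (f : V -> W) : Prop :=
  forall a x y, f (a *: x + y) = a *: f x + f y.

Lemma linear_map0 V W (f : V -> W) : linear_map f -> f 0 = 0.
Proof. by move=> fl; have := fl (-1) 0 0; rewrite scaler0 addr0 scaleN1r addNr. Qed.

Lemma linear_mapD V W (f : V -> W) : linear_map f -> {morph f : x y / x + y}.
Proof. by move=> fl x y; have := fl 1 x y; rewrite !scale1r. Qed.

Lemma linear_mapZ V W (f : V -> W) : linear_map f ->
  forall a, {morph f : x / a *: x}.
Proof. by move=> fl a x; have := fl a x 0; rewrite (linear_map0 fl) !addr0. Qed.

Lemma linear_map_sum V W (f : V -> W) : linear_map f ->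
  forall I (r : seq I) P (F : I -> V),
  f (\sum_(i <- r | P i) F i) = \sum_(i <- r | P i) f (F i).
Proof.
by move=> fl I r P F; exact: (big_morph f (linear_mapD fl) (linear_map0 fl)).
Qed.

Lemma linear_form0 V (f : V -> k) : linear_form f -> f 0 = 0.
Proof. exact: (@linear_map0 V k^o). Qed.

Lemma linear_formD V (f : V -> k) : linear_form f -> {morph f : x y / x + y}.
Proof. exact: (@linear_mapD V k^o). Qed.

Lemma linear_formZ V (f : V -> k) : linear_form f ->
  forall a x, f (a *: x) = a * f x.
Proof. exact: (@linear_mapZ V k^o). Qed.

Lemma linear_form_sum V (f : V -> k) : linear_form f ->
  forall I (r : seq I) P (F : I -> V),
  f (\sum_(i <- r | P i) F i) = \sum_(i <- r | P i) f (F i).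
Proof. exact: (@linear_map_sum V k^o). Qed.

Lemma bundled_linear V W (f : {linear V -> W}) : linear_map f.
Proof. by move=> a x y; rewrite linearP. Qed.

Lemma separated V (x y : V) :
  (forall f, linear_form f -> f x = f y) -> x = y.
Proof.
move=> xy; apply/eqP; rewrite -subr_eq0; apply: contrapT => /negP nxy.
have [f [fl f1]] := separating_functional nxy.
move/eqP: f1; rewrite linear_formD // -scaleN1r linear_formZ // (xy f fl).
by rewrite mulN1r subrr eq_sym oner_eq0.
Qed.

Lemma tlift_comp V W U U' (f : U -> U') (b : V -> W -> U) (t : V ⊗ W) :
  linear_map f -> f (tlift b t) = tlift (fun v w => f (b v w)) t.
Proof. by move=> fl; rewrite /tlift /bilin_sum linear_map_sum. Qed.

Lemma tlift_form V W U (f : U -> k) (b : V -> W -> U) (t : V ⊗ W) :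
  linear_form f -> f (tlift b t) = tlift (fun v w => f (b v w) : k^o) t.
Proof. exact: (@tlift_comp V W U k^o). Qed.

Lemma tlift_sum V W U I (r : seq I) (F : I -> V -> W -> U) (t : V ⊗ W) :
  tlift (fun v w => \sum_(i <- r) F i v w) t = \sum_(i <- r) tlift (F i) t.
Proof. by rewrite /tlift /bilin_sum exchange_big. Qed.

Lemma tlift_exchange V W V' W' U (F : V -> W -> V' -> W' -> U)
    (t : V ⊗ W) (t' : V' ⊗ W') :
  tlift (fun v w => tlift (F v w) t') t =
  tlift (fun v' w' => tlift (fun v w => F v w v' w') t) t'.
Proof. by rewrite /tlift /bilin_sum exchange_big. Qed.

Lemma tlift_map V W (b : V -> W -> V ⊗ W) t :
  (forall v w, b v w = v ⊗ w) -> tlift b t = t.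
Proof.
move=> bE; rewrite [RHS](tens_sum t) /tlift /bilin_sum.
by apply: eq_bigr => p _; rewrite bE.
Qed.

Lemma form_mul_bilinear V W (f : V -> k) (h : W -> k) :
  linear_form f -> linear_form h -> bilinear_map (fun v w => f v * h w : k^o).
Proof.
move=> fl hl; split=> [w a x y|v a x y]; first by rewrite fl mulrDl -mulrA.
by rewrite hl mulrDr mulrCA.
Qed.

Lemma bilin_linl V W U (b : V -> W -> U) : bilinear_map b ->
  forall w, linear_map (b^~ w).
Proof. by move=> [bl _] w a x y; apply: bl. Qed.

Lemma bilin_linr V W U (b : V -> W -> U) : bilinear_map b ->
  forall v, linear_map (b v).
Proof. by move=> [_ br] v a x y; apply: br. Qed.

Lemma tpure_linl V W (w : W) : linear_map (fun v : V => v ⊗ w).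
Proof. exact: bilin_linl (tpure_bilinear V W) w. Qed.

Lemma tpure_linr V W (v : V) : linear_map (fun w : W => v ⊗ w).
Proof. exact: bilin_linr (tpure_bilinear V W) v. Qed.


Lemma contract_bilinear V W (f : V -> k) : linear_form f ->
  bilinear_map (fun (v : V) (w : W) => f v *: w).
Proof.
move=> fl; split=> [w a x y|v a x y]; first by rewrite fl scalerDl scalerA.
by rewrite scalerDr !scalerA mulrC.
Qed.

(** If a form f has f vn = 1, then the vanishing of the contraction by f
    expresses wn through the other wi and shortens the sum of the vi ⊗ wi by
    one term. *)
Lemma tens_contract_eq0 V W (t : V ⊗ W) :
  (forall f, linear_form f -> tlift (fun v w => f v *: w) t = 0) -> t = 0.
Proof.
have bil f : linear_form f -> bilinear_map (fun (v : V) (w : W) => f v *: w).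
  exact: contract_bilinear.
rewrite (tens_sum t); move: (repr t) => s.
have [n] := ubnP (size s); elim: n s => // n IH [|[v w] s] /=.
  by rewrite big_nil.
rewrite ltnS big_cons /= => sn ts.
have [v0|v0] := eqVneq v 0.
  have v0w : v ⊗ w = 0 by rewrite v0 (linear_map0 (tpure_linl w)).
  rewrite v0w add0r in ts *; exact: IH.
have [f [fl f1]] := separating_functional v0.
have fw : w = - \sum_(p <- s) f p.1 *: p.2.
  apply/eqP; rewrite -addr_eq0; have := ts f fl.
  have lf := tlift_linear (bil f fl).
  rewrite (linear_mapD lf) (linear_map_sum lf) tlift_tpure; last exact: bil.
  rewrite f1 scale1r => E; rewrite -[X in _ == X]E; apply/eqP; congr (_ + _).
  by apply: eq_bigr => p _; rewrite tlift_tpure //; apply: bil.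
have E : v ⊗ w + \sum_(p <- s) p.1 ⊗ p.2 =
         \sum_(p <- [seq (p.1 - f p.1 *: v, p.2) | p <- s]) p.1 ⊗ p.2.
  rewrite big_map /= fw -sumrN (linear_map_sum (tpure_linr v)) -big_split /=.
  apply: eq_bigr => p _; rewrite -scaleNr (linear_mapZ (tpure_linr v)) addrC.
  by rewrite -scaleNr (linear_mapD (tpure_linl p.2)) (linear_mapZ (tpure_linl _)).
rewrite E; apply: IH; first by rewrite size_map.
by rewrite -E.
Qed.

Lemma tens_contract_inj V W (t u : V ⊗ W) :
  (forall f, linear_form f ->
     tlift (fun v w => f v *: w) t = tlift (fun v w => f v *: w) u) -> t = u.
Proof.
move=> tu; apply/eqP; rewrite -subr_eq0; apply/eqP.
apply: tens_contract_eq0 => f fl.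
have lf := tlift_linear (contract_bilinear W fl).
by rewrite (linear_mapD lf) -scaleN1r (linear_mapZ lf) tu // scaleN1r subrr.
Qed.

Lemma eq_tens_forms V W (f h : V ⊗ W -> k) : linear_form f -> linear_form h ->
  (forall v w, f (v ⊗ w) = h (v ⊗ w)) -> forall t, f t = h t.
Proof. exact: (@tens_eqP k V W k^o). Qed.

Lemma tens_forms_inj V W (t u : V ⊗ W) :
  (forall f h, linear_form f -> linear_form h ->
     tlift (fun v w => f v * h w : k^o) t =
     tlift (fun v w => f v * h w : k^o) u) -> t = u.
Proof.
move=> tu; apply: tens_contract_inj => f fl; apply: separated => h hl.
rewrite !(tlift_form _ _ hl).
rewrite (tlift_eq (g := fun v w => f v * h w : k^o)); last first.
  by move=> v w; rewrite linear_formZ.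
by rewrite tu //; apply: (@tlift_eq _ _ _ k^o) => v w; rewrite linear_formZ.
Qed.

End Tensors.

Section LinearMaps.
Variable k : fieldType.
Implicit Types U V W X : lmodType k.

Lemma bilinear_mapP V W U (b : V -> W -> U) :
  (forall w, linear_map (fun v => b v w)) -> (forall v, linear_map (b v)) ->
  bilinear_map b.
Proof. by move=> bl br; split=> [w a x y|v a x y]; [apply: bl|apply: br]. Qed.

Lemma linear_map_id V : linear_map (fun x : V => x).
Proof. by []. Qed.

Lemma linear_map_comp U V W (f : V -> W) (h : U -> V) :
  linear_map f -> linear_map h -> linear_map (fun x => f (h x)).
Proof. by move=> fl hl a x y; rewrite hl fl. Qed.

Lemma linear_map_tlift X V W U (F : X -> V -> W -> U) t :
  (forall v w, linear_map (fun x => F x v w)) ->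
  linear_map (fun x => tlift (F x) t).
Proof.
by move=> Fl a x y; rewrite -tlift_comb; apply: tlift_eq => v w; apply: Fl.
Qed.

Lemma linear_map_tlift_arg X V W U (b : V -> W -> U) (f : X -> V ⊗ W) :
  bilinear_map b -> linear_map f -> linear_map (fun x => tlift b (f x)).
Proof. by move=> /tlift_linear; apply: linear_map_comp. Qed.

Lemma linear_map_mull V (A : algType k) (f : V -> A) c :
  linear_map f -> linear_map (fun x => f x * c).
Proof. by move=> fl a x y; rewrite fl mulrDl scalerAl. Qed.

Lemma linear_map_mulr V (A : algType k) (f : V -> A) c :
  linear_map f -> linear_map (fun x => c * f x).
Proof. by move=> fl a x y; rewrite fl mulrDr scalerAr. Qed.

Lemma linear_map_tpurel V W X (f : V -> W) (w : X) :
  linear_map f -> linear_map (fun x => f x ⊗ w).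
Proof. exact: linear_map_comp (tpure_linl w). Qed.

Lemma linear_map_tpurer V W X (f : V -> W) (w : X) :
  linear_map f -> linear_map (fun x => w ⊗ f x).
Proof. exact: linear_map_comp (tpure_linr w). Qed.

Lemma linear_map_scale V W (f : V -> W) c :
  linear_map f -> linear_map (fun x => c *: f x).
Proof. by move=> fl a x y; rewrite fl scalerDr !scalerA mulrC. Qed.

Lemma linear_map_scalel V W (f : V -> k^o) (w : W) :
  linear_map f -> linear_map (fun x => (f x : k) *: w).
Proof. by move=> fl a x y; rewrite fl scalerDl scalerA. Qed.

End LinearMaps.

Ltac linear_tac := repeat first
  [ apply: bundled_linear
  | apply linear_map_id
  | assumption
  | apply linear_map_mull
  | apply linear_map_mulr
  | apply linear_map_tpurel
  | apply linear_map_tpurer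
  | apply linear_map_scale
  | apply linear_map_scalel
  | apply linear_map_tlift; intros
  | apply linear_map_tlift_arg
  | (apply bilinear_mapP; intros)
  | match goal with |- linear_map (fun x => ?F (@?h x)) =>
      apply (@linear_map_comp _ _ _ _ F h); [solve [apply: bundled_linear | assumption] | ]
    end
  ].

Section Coassociativity.
Variable k : fieldType.
Implicit Types U V W X : lmodType k.

Definition trilinear_map U V W X (T : U -> V -> W -> X) : Prop :=
  [/\ forall v w, linear_map (fun u => T u v w),
      forall u w, linear_map (fun v => T u v w)
    & forall u v, linear_map (T u v)].

(** Contracted by a trilinear map, the two sides of a coassociativity axiom are
    iterated sums over the two coproducts. *)
Lemma tlift_tassoc_tmapl U V V' W X (f : U -> V ⊗ V') (t : U ⊗ W)
    (T : V -> V' -> W -> X) : linear_map f -> trilinear_map T ->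
  tlift (fun v y => tlift (T v) y) (tassoc (tmap f idfun t)) =
  tlift (fun u w => tlift (fun v v' => T v v' w) (f u)) t.
Proof.
move=> fl [T1 T2 T3].
have bT : bilinear_map (fun v y => tlift (T v) y) by linear_tac.
have bA : bilinear_map (fun (x : V ⊗ V') (w : W) =>
   tlift (fun u v => u ⊗ (v ⊗ w)) x) by linear_tac.
rewrite /tassoc /tmap (tlift_comp _ _ (tlift_linear bA)).
rewrite (tlift_comp _ _ (tlift_linear bT)).
apply: tlift_eq => u w; rewrite tlift_tpure // (tlift_comp _ _ (tlift_linear bT)).
apply: tlift_eq => v v'; rewrite tlift_tpure // tlift_tpure //.
by linear_tac.
Qed.

Lemma tlift_tmapr U V V' W X (f : W -> V ⊗ V') (t : U ⊗ W)
    (T : U -> V -> V' -> X) : linear_map f -> trilinear_map T ->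
  tlift (fun v y => tlift (T v) y) (tmap idfun f t) =
  tlift (fun u w => tlift (T u) (f w)) t.
Proof.
move=> fl [T1 T2 T3].
have bT : bilinear_map (fun v y => tlift (T v) y) by linear_tac.
rewrite /tmap (tlift_comp _ _ (tlift_linear bT)).
by apply: tlift_eq => u w; rewrite tlift_tpure.
Qed.

End Coassociativity.

(** * The antipode *)

Section Antipode.
Variables (k : fieldType) (H : algType k) (hH : hopf_structure H).
Local Notation Δ := (comul hH).
Local Notation ε := (counit hH).
Local Notation S := (antipode hH).

Lemma comul_coassoc (X : lmodType k) (T : H -> H -> H -> X) a : trilinear_map T ->
  tlift (fun x y => tlift (fun u v => T u v y) (Δ x)) (Δ a) =
  tlift (fun x y => tlift (T x) (Δ y)) (Δ a).
Proof.
move=> Tl; rewrite -(tlift_tmapr (f := Δ)) //; last exact: bundled_linear.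
by rewrite -comulA tlift_tassoc_tmapl //; apply: bundled_linear.
Qed.

Lemma comul_counitl (X : lmodType k) (f : H -> X) a : linear_map f ->
  tlift (fun x y => (ε x : k) *: f y) (Δ a) = f a.
Proof.
move=> fl; rewrite -[in RHS](counitl hH a) (tlift_comp _ _ fl).
by apply: tlift_eq => x y; rewrite linear_mapZ.
Qed.

Lemma comul_counitr (X : lmodType k) (f : H -> X) a : linear_map f ->
  tlift (fun x y => (ε y : k) *: f x) (Δ a) = f a.
Proof.
move=> fl; rewrite -[in RHS](counitr hH a) (tlift_comp _ _ fl).
by apply: tlift_eq => x y; rewrite linear_mapZ.
Qed.

Lemma tlift_mul (A B : algType k) (X : lmodType k) (b : A -> B -> X) x y :
  bilinear_map b ->
  tlift b (x * y) =
  tlift (fun u v => tlift (fun u' v' => b (u * u') (v * v')) y) x.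
Proof.
move=> bb; rewrite [x * y](_ : _ = tlift (fun a b => tlift (fun a' b' =>
  (a * a') ⊗ (b * b')) y) x) //.
rewrite (tlift_comp _ _ (tlift_linear bb)); apply: tlift_eq => u v.
rewrite (tlift_comp _ _ (tlift_linear bb)); apply: tlift_eq => u' v'.
by rewrite tlift_tpure.
Qed.

Lemma antipode1 : S 1 = 1.
Proof.
have := antipodel hH 1; rewrite rmorph1 -[1 in LHS]/(1 ⊗ 1 : H ⊗ H).
rewrite tlift_tpure; last by linear_tac.
by rewrite mulr1 rmorph1 scale1r.
Qed.

(** Both sides are convolution inverses of the multiplication H ⊗ H -> H, the
    left one on the left and the right one on the right.  Between them,
    S(a1 b1) a2 b2 S(b3) S(a3) is evaluated in two ways. *)
Lemma antipodeM a b : S (a * b) = S b * S a.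
Proof.
pose T b1 x y z := S (x * b1) * y * S z.
transitivity (tlift (fun a1 a2 => tlift (fun b1 b2 =>
    ((ε a2 : k) * (ε b2 : k)) *: S (a1 * b1)) (Δ b)) (Δ a)).
  rewrite -(comul_counitr (f := fun x => S (x * b))); last by linear_tac.
  apply: tlift_eq => a1 a2.
  rewrite -(comul_counitr (f := fun y => S (a1 * y))); last by linear_tac.
  rewrite (tlift_comp _ _ (linear_map_scale _ (@linear_map_id _ _))).
  by apply: tlift_eq => b1 b2; rewrite scalerA.
transitivity (tlift (fun a1 a2 => tlift (fun b1 b2 =>
    tlift (fun a21 a22 => tlift (fun b21 b22 =>
      S (a1 * b1) * (a21 * b21) * (S b22 * S a22)) (Δ b2)) (Δ a2)) (Δ b)) (Δ a)).
  apply: tlift_eq => a1 a2; apply: tlift_eq => b1 b2.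
  transitivity (tlift (fun a21 a22 => S (a1 * b1) * a21 * (ε b2 : k)%:A * S a22)
     (Δ a2)); last first.
    apply: tlift_eq => a21 a22; rewrite -antipoder.
    pose f x := S (a1 * b1) * a21 * x * S a22.
    have fl : linear_map f by rewrite /f; linear_tac.
    rewrite -[LHS]/(f _) (tlift_comp _ _ fl).
    by apply: tlift_eq => b21 b22; rewrite /f !mulrA.
  pose f x := (ε b2 : k) *: (S (a1 * b1) * x).
  have fl : linear_map f by rewrite /f; linear_tac.
  transitivity (f (ε a2 : k)%:A).
    by rewrite /f -scalerAr mulr1 scalerA mulrC.
  rewrite -antipoder (tlift_comp _ _ fl); apply: tlift_eq => a21 a22.
  by rewrite /f -scalerAr mulr1 -scalerAl mulrA.
transitivity (tlift (fun a1 a2 => tlift (fun b1 b2 =>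
    tlift (fun a11 a12 => tlift (fun b11 b12 =>
      S (a11 * b11) * (a12 * b12) * (S b2 * S a2)) (Δ b1)) (Δ a1)) (Δ b)) (Δ a)).
  transitivity (tlift (fun b1 b2 => tlift (fun b21 b22 =>
      tlift (fun a1 a2 => tlift (fun a21 a22 =>
      S (a1 * b1) * (a21 * b21) * (S b22 * S a22)) (Δ a2)) (Δ a)) (Δ b2)) (Δ b)).
    rewrite tlift_exchange; apply: tlift_eq => b1 b2.
    rewrite [RHS]tlift_exchange; apply: tlift_eq => a1 a2.
    by rewrite tlift_exchange.
  rewrite [RHS]tlift_exchange -comul_coassoc; last first.
    by split=> *; linear_tac.
  apply: tlift_eq => b1 b2.
  transitivity (tlift (fun a1 a2 => tlift (fun a11 a12 => tlift (fun b11 b12 =>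
      S (a11 * b11) * (a12 * b12) * (S b2 * S a2)) (Δ b1)) (Δ a1)) (Δ a)); last first.
    by apply: tlift_eq => a1 a2.
  rewrite comul_coassoc; last by split=> *; linear_tac.
  rewrite tlift_exchange; apply: tlift_eq => a1 a2.
  by rewrite tlift_exchange; apply: tlift_eq.
transitivity (tlift (fun a1 a2 => tlift (fun b1 b2 =>
    (ε a1 : k) *: ((ε b1 : k) *: (S b2 * S a2))) (Δ b)) (Δ a)).
  apply: tlift_eq => a1 a2; apply: tlift_eq => b1 b2.
  have := antipodel hH (a1 * b1); rewrite rmorphM tlift_mul; last by linear_tac.
  move=> E; rewrite scalerA -[_ * _ :> k]/((ε a1 * ε b1 : k^o)).
  rewrite rmorphM in E.
  pose f x := x * (S b2 * S a2).
  have fl : linear_map f by rewrite /f; linear_tac.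
  transitivity (f ((ε a1 * ε b1 : k)%:A)); last by rewrite /f -scalerAl mul1r.
  rewrite -E (tlift_comp _ _ fl); apply: tlift_eq => u v.
  by rewrite (tlift_comp _ _ fl).
rewrite -[RHS](comul_counitl (f := fun y => S b * S y)); last by linear_tac.
apply: tlift_eq => a1 a2; rewrite -[in RHS](comul_counitl (f := fun y => S y * S a2)).
  by rewrite [RHS](tlift_comp _ _ (linear_map_scale _ (@linear_map_id _ _))).
by linear_tac.
Qed.

Lemma antipode_conv_comul a :
  tlift (fun x y => Δ x * tlift (fun u v => S v ⊗ S u) (Δ y)) (Δ a) =
  (ε a : k) *: (1 ⊗ 1).
Proof.
transitivity (tlift (fun x y => tlift (fun u v =>
    tlift (fun u' v' => (u * S v') ⊗ (v * S u')) (Δ y)) (Δ x)) (Δ a)).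
  apply: tlift_eq => x y; pose f t := (t : H ⊗ H) * tlift (fun u v => S v ⊗ S u) (Δ y).
  have fl : linear_map f by rewrite /f; linear_tac.
  rewrite -[LHS]/(f _) -[in LHS](tlift_map (b := fun u v => u ⊗ v) (Δ x)) //.
  rewrite (tlift_comp _ _ fl); apply: tlift_eq => u v; rewrite /f.
  pose h t := u ⊗ v * (t : H ⊗ H).
  have hl : linear_map h by rewrite /h; linear_tac.
  rewrite -[LHS]/(h _) (tlift_comp _ _ hl); apply: tlift_eq => u' v'.
  exact: tens_mulE.
rewrite comul_coassoc; last by split=> *; linear_tac.
transitivity (tlift (fun x y => (x * S y) ⊗ (1 : H)) (Δ a)); last first.
  have := tlift_comp (fun x y => x * S y) (Δ a) (tpure_linl (1 : H)).
  by rewrite antipoder (linear_mapZ (tpure_linl (1 : H))) => ->.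
apply: tlift_eq => x y.
rewrite -(comul_coassoc (T := fun u v w => (x * S w) ⊗ (u * S v))); last first.
  by split=> *; linear_tac.
rewrite -[RHS](comul_counitl (f := fun z => (x * S z) ⊗ (1 : H))); last by linear_tac.
apply: tlift_eq => u v.
have := tlift_comp (fun x y => x * S y) (Δ u) (tpure_linr (x * S v)).
by rewrite antipoder (linear_mapZ (tpure_linr _)) => ->.
Qed.

(** Again two convolution inverses, here of the comultiplication H -> H ⊗ H. *)
Lemma comul_antipode a : Δ (S a) = tlift (fun x y => S y ⊗ S x) (Δ a).
Proof.
pose G a := tlift (fun x y => S y ⊗ S x) (Δ a).
rewrite -(comul_counitr (f := fun x => Δ (S x))); last by linear_tac.
transitivity (tlift (fun x y => tlift (fun u v => Δ (S x) * Δ u * G v) (Δ y)) (Δ a)).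
  apply: tlift_eq => x y.
  have fl : linear_map (fun t => Δ (S x) * t) by linear_tac.
  have := tlift_comp (fun u v => Δ u * G v) (Δ y) fl.
  rewrite antipode_conv_comul (linear_mapZ fl) [1 ⊗ 1](_ : _ = 1) // mulr1 => ->.
  by apply: tlift_eq => u v; rewrite mulrA.
rewrite -comul_coassoc; last by rewrite /G; split=> *; linear_tac.
rewrite -[RHS](comul_counitl (f := G)); last by rewrite /G; linear_tac.
apply: tlift_eq => x y.
have fl : linear_map (fun t => Δ t * G y) by linear_tac.
have := tlift_comp (fun u v => S u * v) (Δ x) fl.
rewrite antipodel (linear_mapZ fl) rmorph1 mul1r => ->.
by apply: tlift_eq => u v; rewrite rmorphM.
Qed.

End Antipode.

(** * Hopf subalgebras generated by cocommutative elements *)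

Section SubTensors.
Variable k : fieldType.
Implicit Types V W U : lmodType k.

Lemma tens_sub0 V W (P : V -> Prop) (Q : W -> Prop) : tens_sub P Q 0.
Proof. by exists [::]; rewrite big_nil. Qed.

Lemma tens_sub_pure V W (P : V -> Prop) (Q : W -> Prop) v w :
  P v -> Q w -> tens_sub P Q (v ⊗ w).
Proof.
by move=> Pv Qw; exists [:: (v, w)]; rewrite big_seq1; split=> // p /[!inE] /eqP->.
Qed.

Lemma tens_subD V W (P : V -> Prop) (Q : W -> Prop) x y :
  tens_sub P Q x -> tens_sub P Q y -> tens_sub P Q (x + y).
Proof.
move=> [s [sPQ ->]] [t [tPQ ->]]; exists (s ++ t); rewrite big_cat; split=> // p.
by rewrite mem_cat => /orP[/sPQ|/tPQ].
Qed.

Lemma tens_sub_sum V W (P : V -> Prop) (Q : W -> Prop) (I : eqType) (r : seq I) F :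
  (forall i, i \in r -> tens_sub P Q (F i)) -> tens_sub P Q (\sum_(i <- r) F i).
Proof.
elim: r => [_|i r IH Fr]; first by rewrite big_nil; apply: tens_sub0.
rewrite big_cons; apply: tens_subD; first by apply: Fr; rewrite mem_head.
by apply: IH => j jr; apply: Fr; rewrite inE jr orbT.
Qed.

Lemma tens_sub_map V W V' W' (P : V -> Prop) (Q : W -> Prop)
    (P' : V' -> Prop) (Q' : W' -> Prop) (f : V ⊗ W -> V' ⊗ W') x :
  linear_map f -> (forall v w, P v -> Q w -> tens_sub P' Q' (f (v ⊗ w))) ->
  tens_sub P Q x -> tens_sub P' Q' (f x).
Proof.
move=> fl fPQ [s [sPQ ->]]; rewrite linear_map_sum //.
by apply: tens_sub_sum => p /sPQ[]; apply: fPQ.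
Qed.

Lemma tens_subP V W (P : V -> Prop) (Q : W -> Prop) c x y :
  (forall v, P v -> P (c *: v)) ->
  tens_sub P Q x -> tens_sub P Q y -> tens_sub P Q (c *: x + y).
Proof.
move=> Pc Px Py; apply: tens_subD => //.
apply: (tens_sub_map (f := fun x => c *: x) _ _ Px) => [|v w Pv Qw].
  by apply: linear_map_scale.
by rewrite -(linear_mapZ (tpure_linl w)); apply: tens_sub_pure; first exact: Pc.
Qed.

Lemma tens_subM (A B : algType k) (P : A -> Prop) (Q : B -> Prop) x y :
  (forall u v, P u -> P v -> P (u * v)) -> (forall u v, Q u -> Q v -> Q (u * v)) ->
  tens_sub P Q x -> tens_sub P Q y -> tens_sub P Q (x * y).
Proof.
move=> PM QM Px Py.
apply: (tens_sub_map (f := fun x => x * y) _ _ Px) => [|u v Pu Qv].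
  by apply: linear_map_mull.
apply: (tens_sub_map (f := fun y => u ⊗ v * y) _ _ Py) => [|u' v' Pu' Qv'].
  by apply: linear_map_mulr.
rewrite [_ * _](tens_mulE u v u' v').
by apply: tens_sub_pure; [apply: PM|apply: QM].
Qed.

End SubTensors.

Section Generation.
Variables (k : fieldType) (H : algType k) (hH : hopf_structure H).
Local Notation Δ := (comul hH).
Local Notation S := (antipode hH).

Inductive hopf_span (X : H -> Prop) : H -> Prop :=
| hopf_span_gen x : X x -> hopf_span X x
| hopf_span1 : hopf_span X 1
| hopf_span_lin c x y : hopf_span X x -> hopf_span X y -> hopf_span X (c *: x + y)
| hopf_spanM x y : hopf_span X x -> hopf_span X y -> hopf_span X (x * y)
| hopf_spanS x : hopf_span X x -> hopf_span X (S x).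

Lemma hopf_spanZ X c x : hopf_span X x -> hopf_span X (c *: x).
Proof.
move=> Xx; rewrite -[_ *: _]addr0; apply: hopf_span_lin => //.
rewrite -(addNr (1 : H)) -scaleN1r.
by apply: hopf_span_lin; apply: hopf_span1.
Qed.

Lemma hopf_span_subalgebra (X : H -> Prop) :
  (forall x, X x -> tens_sub X X (Δ x)) -> hopf_subalgebra hH (hopf_span X).
Proof.
move=> XΔ; split; [exact: hopf_span1|exact: hopf_span_lin|exact: hopf_spanM
  |exact: hopf_spanS|].
move=> x; elim=> {x} [x /XΔ|||x y _ IHx _ IHy|x _ IH].
- case=> s [sX ->]; exists s; split=> // p /sX[Xp Xp'].
  by split; apply: hopf_span_gen.
- rewrite rmorph1; apply: tens_sub_pure; exact: hopf_span1.
- move=> c x y _ IHx _ IHy; rewrite linearP; apply: tens_subP => // v.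
  exact: hopf_spanZ.
- by rewrite rmorphM; apply: tens_subM => //; apply: hopf_spanM.
rewrite comul_antipode.
apply: (tens_sub_map (f := tlift (fun x y => S y ⊗ S x)) _ _ IH) => [|u v Xu Xv].
  by apply: tlift_linear; linear_tac.
rewrite tlift_tpure; last by linear_tac.
by apply: tens_sub_pure; apply: hopf_spanS.
Qed.

Lemma tswap_linear (V W : lmodType k) : linear_map (@tswap k V W).
Proof. by apply: tlift_linear; linear_tac. Qed.

Lemma tswap_pure (V W : lmodType k) (v : V) (w : W) : tswap (v ⊗ w) = w ⊗ v.
Proof. by rewrite /tswap tlift_tpure //; linear_tac. Qed.

Lemma tswapM (A B : algType k) (x y : A ⊗ B) : tswap (x * y) = tswap x * tswap y.
Proof.
rewrite [LHS]tlift_mul; last by linear_tac.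
have fl : linear_map (fun t => t * tswap y) by linear_tac.
rewrite (tlift_comp _ _ fl); apply: tlift_eq => u v.
have hl : linear_map (fun t => v ⊗ u * t) by linear_tac.
rewrite (tlift_comp _ _ hl); apply: tlift_eq => u' v'.
exact/esym/tens_mulE.
Qed.

Lemma hopf_span_cocommutative (X : H -> Prop) :
  (forall x, X x -> tswap (Δ x) = Δ x) ->
  forall x, hopf_span X x -> tswap (Δ x) = Δ x.
Proof.
move=> Xc x; elim=> {x} [x /Xc//|||x y _ IHx _ IHy|x _ IH].
- rewrite rmorph1; exact: tswap_pure.
- by move=> c x y _ IHx _ IHy; rewrite linearP tswap_linear IHx IHy.
- by rewrite rmorphM tswapM IHx IHy.
rewrite comul_antipode (tlift_comp _ _ (@tswap_linear H H)) -[in RHS]IH.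
have Sl : linear_map (tlift (fun x y => S y ⊗ S x)) by apply: tlift_linear; linear_tac.
rewrite [in RHS]/tswap (tlift_comp _ _ Sl).
apply: tlift_eq => u v; rewrite tswap_pure tlift_tpure //.
by linear_tac.
Qed.

Variables (R : algType k) (g : connected_grading R) (rho : coaction hH R).

(** The elements sent by the coaction into R ⊗ K form a subalgebra when K is
    one, so that it suffices to look at degree 1. *)
Lemma coaction_in_subalgebra (K : H -> Prop) :
  generated_in_degree1 g -> hopf_subalgebra hH K ->
  (forall r, homog g 1 r -> tens_sub (fun=> True) K (coact rho r)) ->
  forall r, tens_sub (fun=> True) K (coact rho r).
Proof.
move=> gen1 [K1 Klin KM _ _] K_1; apply: gen1 => //.
- by rewrite rmorph1; apply: tens_sub_pure.
- by move=> c x y Kx Ky; rewrite linearP; apply: tens_subP.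
by move=> x y Kx Ky; rewrite rmorphM; apply: tens_subM.
Qed.

End Generation.

(** * Matrix coefficients that commute with a scalar matrix *)

Section Comatrix.
Variables (k : fieldType) (H : algType k) (hH : hopf_structure H).
Local Notation Δ := (comul hH).
Local Notation ε := (counit hH).
Local Notation S := (antipode hH).

Definition comatrix n (h : 'I_n -> 'I_n -> H) : Prop :=
  (forall i j, Δ (h i j) = \sum_l h i l ⊗ h l j) /\
  forall i j, (ε (h i j) : k) = (i == j)%:R.

Definition group_like (D : H) : Prop := Δ D = D ⊗ D /\ (ε D : k) = 1.

Lemma bilin_sum_tpure (V W U : lmodType k) (b : V -> W -> U) I (r : seq I) F G :
  bilinear_map b ->
  tlift b (\sum_(i <- r) F i ⊗ G i) = \sum_(i <- r) b (F i) (G i).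
Proof.
move=> bb; rewrite (linear_map_sum (tlift_linear bb)).
by apply: eq_bigr => i _; rewrite tlift_tpure.
Qed.

Lemma comatrix_antipodel n (h : 'I_n -> 'I_n -> H) : comatrix h ->
  forall i j, \sum_l S (h i l) * h l j = (i == j)%:R.
Proof.
move=> [hΔ hε] i j; have := antipodel hH (h i j); rewrite hΔ hε.
rewrite bilin_sum_tpure; last by linear_tac.
by move=> ->; rewrite -scaler_nat; case: eqP; rewrite ?scale1r ?scale0r.
Qed.

Lemma comatrix_antipoder n (h : 'I_n -> 'I_n -> H) : comatrix h ->
  forall i j, \sum_l h i l * S (h l j) = (i == j)%:R.
Proof.
move=> [hΔ hε] i j; have := antipoder hH (h i j); rewrite hΔ hε.
rewrite bilin_sum_tpure; last by linear_tac.
by move=> ->; rewrite -scaler_nat; case: eqP; rewrite ?scale1r ?scale0r.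
Qed.

Lemma group_like_antipodel D : group_like D -> S D * D = 1.
Proof.
move=> [DΔ Dε]; have := antipodel hH D; rewrite DΔ Dε scale1r tlift_tpure //.
by linear_tac.
Qed.

Lemma group_like_antipoder D : group_like D -> D * S D = 1.
Proof.
move=> [DΔ Dε]; have := antipoder hH D; rewrite DΔ Dε scale1r tlift_tpure //.
by linear_tac.
Qed.

Lemma group_like_antipode2 D : group_like D -> S (S D) = D.
Proof.
move=> gD; rewrite -[RHS]mul1r -(antipode1 hH) -(group_like_antipoder gD).
by rewrite antipodeM -mulrA group_like_antipodel // mulr1.
Qed.

Lemma antipode_sum I (r : seq I) F : S (\sum_(i <- r) F i) = \sum_(i <- r) S (F i).
Proof. exact: raddf_sum. Qed.

(** The two hypotheses say that the coaction on a Frobenius pairing is by D,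
    once for each order of the two factors.  The first gives g as S(h) D, and
    then the second becomes this relation after multiplication by S^2(h). *)
Lemma comatrix_twist n (h g : 'I_n -> 'I_n -> H) (Q : 'M[k]_n) (D : H) :
  comatrix h ->
  (forall i j, \sum_l h i l * g j l = (i == j)%:R * D) ->
  (forall i j, \sum_l \sum_p Q l p *: (g j p * h i l) = Q i j *: D) ->
  forall i p, \sum_l Q l p *: (D * h i l) = \sum_j Q i j *: (S (S (h j p)) * D).
Proof.
move=> hc hD hQ i p.
have gE j l : g j l = S (h l j) * D.
  transitivity (\sum_q (\sum_r S (h l r) * h r q) * g j q).
    rewrite (bigD1 l) //= comatrix_antipodel // eqxx mul1r big1 ?addr0 // => q ql.
    by rewrite comatrix_antipodel // eq_sym (negPf ql) mul0r.
  under eq_bigr do rewrite mulr_suml.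
  rewrite exchange_big (bigD1 j) //= [X in _ + X]big1 ?addr0 => [|r rj].
    under eq_bigr do rewrite -mulrA.
    by rewrite -mulr_sumr hD eqxx mul1r.
  under eq_bigr do rewrite -mulrA.
  by rewrite -mulr_sumr hD (negPf rj) mul0r mulr0.
have S2 l : \sum_j S (S (h j p)) * S (h l j) = (l == p)%:R.
  under eq_bigr do rewrite -antipodeM.
  rewrite -antipode_sum comatrix_antipoder //.
  by case: eqP => _; rewrite ?antipode1 ?linear0.
transitivity (\sum_j S (S (h j p)) * \sum_l \sum_q Q l q *: (g j q * h i l)).
  under [RHS]eq_bigr do rewrite mulr_sumr.
  rewrite exchange_big; apply: eq_bigr => l _ /=.
  under eq_bigr do rewrite mulr_sumr.
  rewrite exchange_big (bigD1 p) //= [X in _ + X]big1 ?addr0 => [|q qp].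
    under eq_bigr do rewrite gE -scalerAr !mulrA.
    by rewrite -scaler_sumr -!mulr_suml S2 eqxx mul1r.
  under eq_bigr do rewrite gE -scalerAr !mulrA.
  by rewrite -scaler_sumr -!mulr_suml S2 (negPf qp) !mul0r scaler0.
by apply: eq_bigr => j _; rewrite hQ -scalerAr.
Qed.

(** One more step multiplies the relation by D on the left and applies S^2 to
    the rest, which fixes D and is multiplicative. *)
Lemma comatrix_twist_iter n (h : 'I_n -> 'I_n -> H) (Q : 'M[k]_n) (D : H) :
  group_like D ->
  (forall i p, \sum_l Q l p *: (D * h i l) =
               \sum_j Q i j *: (S (S (h j p)) * D)) ->
  forall t i p, \sum_l (Q ^+ t) l p *: (D ^+ t * h i l) =
               \sum_j (Q ^+ t) i j *: (iter (2 * t) S (h j p) * D ^+ t).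
Proof.
move=> gD hQ; elim=> [|t IH] i p.
  rewrite (bigD1 p) //= [in RHS](bigD1 i) //= -[Q ^+ 0]/(1%:M) !mxE !eqxx.
  rewrite !expr0 mul1r mulr1 !scale1r.
  by rewrite !big1 // => l /negPf lE; rewrite mxE ?lE 1?eq_sym ?lE scale0r.
have QS : Q ^+ t.+1 = Q *m Q ^+ t := exprS Q t.
have -> : (2 * t.+1)%N = (2 * t).+2 by rewrite mulnS.
have SSM x y : S (S (x * y)) = S (S x) * S (S y) by rewrite !antipodeM.
have SSD s : S (S (D ^+ s)) = D ^+ s.
  elim: s => [|s IHs]; first by rewrite !antipode1.
  by rewrite exprS SSM IHs group_like_antipode2.
transitivity (\sum_q (Q ^+ t) q p *: (D ^+ t * \sum_l Q l q *: (D * h i l))).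
  under [RHS]eq_bigr do rewrite mulr_sumr scaler_sumr.
  rewrite exchange_big; apply: eq_bigr => l _ /=.
  rewrite QS mxE scaler_suml; apply: eq_bigr => q _.
  by rewrite -scalerAr scalerA mulrC exprSr mulrA.
transitivity (\sum_j Q i j *: (S (S (\sum_q (Q ^+ t) q p *: (D ^+ t * h j q))) * D)).
  under eq_bigr do rewrite hQ mulr_sumr scaler_sumr.
  rewrite exchange_big; apply: eq_bigr => j _ /=.
  rewrite !antipode_sum mulr_suml scaler_sumr; apply: eq_bigr => q _.
  by rewrite -scalerAr !linearZ /= SSM SSD -scalerAl !scalerA mulrC mulrA.
under eq_bigr do rewrite IH.
under [RHS]eq_bigr do rewrite QS mxE scaler_suml.
rewrite [RHS]exchange_big; apply: eq_bigr => j _ /=.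
rewrite !antipode_sum mulr_suml scaler_sumr; apply: eq_bigr => q _.
rewrite !linearZ /= SSM SSD -scalerAl scalerA; congr (_ *: _).
by rewrite -mulrA -exprSr.
Qed.

(** D^t is invertible and cancels from the iterated relation. *)
Lemma comatrix_centralizes n (h : 'I_n -> 'I_n -> H) (Q : 'M[k]_n) (D : H) t :
  group_like D ->
  (forall i p, \sum_l Q l p *: (D * h i l) =
               \sum_j Q i j *: (S (S (h j p)) * D)) ->
  central (D ^+ t) -> (forall x, iter (2 * t) S x = x) ->
  forall f, linear_form f -> centralizer (Q ^+ t) (\matrix_(i, j) f (h i j)).
Proof.
move=> gD hQ Dc St f fl; apply/matrixP => i p; rewrite !mxE.
have D1 : S D ^+ t * D ^+ t = 1.
  elim: t {Dc St} => [|t IH]; first by rewrite mulr1.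
  by rewrite exprSr exprS mulrA -(mulrA _ (S D)) group_like_antipodel // mulr1.
have := congr1 (fun x => f (S D ^+ t * x)) (comatrix_twist_iter gD hQ t i p).
rewrite /= !mulr_sumr !linear_form_sum // => E.
transitivity (\sum_j f (S D ^+ t * ((Q ^+ t) j p *: (D ^+ t * h i j)))).
  apply: eq_bigr => j _; rewrite -scalerAr mulrA D1 mul1r linear_formZ // mxE.
  by rewrite mulrC.
rewrite E; apply: eq_bigr => j _.
by rewrite St -Dc -scalerAr mulrA D1 mul1r linear_formZ // mxE.
Qed.

(** The products of the matrices f(h) and f'(h) in the two orders have the
    entries (f ⊗ f')(Δ(h_ij)) and (f' ⊗ f)(Δ(h_ij)). *)
Lemma comatrix_cocommutative n (h : 'I_n -> 'I_n -> H) (M : 'M[k]_n) :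
  comatrix h -> commutative_set (centralizer M) ->
  (forall f, linear_form f -> centralizer M (\matrix_(i, j) f (h i j))) ->
  forall i j, tswap (Δ (h i j)) = Δ (h i j).
Proof.
move=> [hΔ _] Mc hM i j; apply: tens_forms_inj => f f' fl fl'.
rewrite hΔ (linear_map_sum (@tswap_linear k H H)).
under eq_bigr do rewrite tswap_pure.
rewrite !bilin_sum_tpure; try exact: form_mul_bilinear.
have /matrixP/(_ i j) := Mc _ _ (hM f' fl') (hM f fl); rewrite !mxE => E.
transitivity (\sum_l f' (h i l) * f (h l j)).
  by apply: eq_bigr => l _; rewrite mulrC.
have -> : \sum_l f' (h i l) * f (h l j) = \sum_l f (h i l) * f' (h l j).
  by move: E; under eq_bigr do rewrite !mxE; under [in RHS]eq_bigr do rewrite !mxE.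
by [].
Qed.

End Comatrix.

Section Subspaces.
Variables (k : fieldType) (V : lmodType k).

Definition subspace (W : V -> Prop) : Prop :=
  W 0 /\ forall c x y, W x -> W y -> W (c *: x + y).

Section Pred.
Variables (W : V -> Prop) (W_subspace : subspace W).

(** The proof is an argument so that the closure properties of W can be found
    from the predicate. *)
Definition subspace_pred of subspace W : {pred V} := fun x => `[< W x >].

Lemma subspace_pred_closed : submod_closed (subspace_pred W_subspace).
Proof.
case: W_subspace => W0 Wl; split; first exact/asboolP.
by move=> c x y /asboolP Wx /asboolP Wy; apply/asboolP; apply: Wl.
Qed.

HB.instance Definition _ := GRing.isSubmodClosed.Build k V
  (subspace_pred W_subspace) subspace_pred_closed.

(** The form is pulled back from the quotient by W. *)
Lemma separating_form_mod v : ~ W v ->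
  exists f : V -> k, [/\ linear_form f, forall w, W w -> f w = 0 & f v = 1].
Proof.
move=> nWv; pose Q := quotsp (subspace_pred W_subspace).
have nv : \pi_Q v != 0.
  apply/negP => /eqP E; apply: nWv; apply/asboolP.
  have /eqP : \pi_Q v = \pi_Q 0 by [].
  by rewrite quotsp_eq subr0.
have [f [fl fv]] := separating_functional nv.
exists (fun x => f (\pi_Q x)); split=> // [c x y|w Ww].
  by rewrite -fl -quotsp_add_pi -quotsp_scale_pi.
have -> : \pi_Q w = 0 by apply/eqP; rewrite quotsp_eq subr0; apply/asboolP.
exact: linear_form0.
Qed.

End Pred.

Lemma subspaceD W x y : subspace W -> W x -> W y -> W (x + y).
Proof. by move=> [_ Wl] Wx Wy; rewrite -[x]scale1r; apply: Wl. Qed.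

Lemma subspaceZ W c x : subspace W -> W x -> W (c *: x).
Proof. by move=> [W0 Wl] Wx; rewrite -[_ *: _]addr0; apply: Wl. Qed.

Lemma subspaceB W x y : subspace W -> W x -> W y -> W (x - y).
Proof. by move=> [_ Wl] Wx Wy; rewrite addrC -scaleN1r; apply: Wl. Qed.

Lemma subspace_sum W (I : eqType) (r : seq I) F : subspace W ->
  (forall i, i \in r -> W (F i)) -> W (\sum_(i <- r) F i).
Proof.
move=> Ws; elim: r => [_|i r IH Fr]; first by rewrite big_nil; case: Ws.
rewrite big_cons; apply: subspaceD => //; first by apply: Fr; rewrite mem_head.
by apply: IH => j jr; apply: Fr; rewrite inE jr orbT.
Qed.

End Subspaces.

(** * Finite-dimensional cocommutative Hopf algebras *)

Section FiniteDimension.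
Variables (k : closedFieldType) (V : lmodType k).

(** This is the theorem of Cayley and Hamilton, with the characteristic
    polynomial split into linear factors. *)
Lemma annihilating_factors (T : V -> V) : finite_dim V -> linear_map T ->
  exists s : seq k, forall v, foldl (fun v a => T v - a *: v) v s = 0.
Proof.
move=> [n [b bV]] Tl; case: n b bV => [|n] b bV.
  by exists [::] => v /=; have [c ->] := bV v; rewrite big_ord0.
have [A AE] : exists A : 'M[k]_n.+1, forall i, T (b i) = \sum_j A i j *: b j.
  have /boolp.choice[A AE] : forall i, exists c : 'I_n.+1 -> k,
    T (b i) = \sum_j c j *: b j by move=> i; apply: bV.
  by exists (\matrix_(i, j) A i j) => i; rewrite AE; apply: eq_bigr => j _; rewrite mxE.
pose f (u : 'rV[k]_n.+1) := \sum_i u 0 i *: b i.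
have fT u a : T (f u) - a *: f u = f (u *m (A - a%:M)).
  rewrite linear_map_sum // scaler_sumr -sumrB.
  under eq_bigr do rewrite linear_mapZ // AE scalerA scaler_sumr.
  rewrite sumrB exchange_big -sumrB /=; apply: eq_bigr => j _.
  rewrite mulmxBr mul_mx_scalar !mxE scalerBl scaler_suml; congr (_ - _).
  by apply: eq_bigr => i _; rewrite scalerA.
have [s sE] := closed_field_poly_normal (char_poly A).
have := Cayley_Hamilton A; rewrite sE (monicP (char_poly_monic A)) scale1r.
rewrite rmorph_prod; under eq_bigr do rewrite rmorphB /= horner_mx_X horner_mx_C.
move=> A0; exists s => v; have [c ->] := bV v.
have -> : \sum_i c i *: b i = f (\row_i c i).
  by apply: eq_bigr => i _; rewrite mxE.
suff E u : foldl (fun v a => T v - a *: v) (f u) s =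
    f (u *m \prod_(z <- s) (A - z%:M)).
  by rewrite E A0 mulmx0 /f big1 // => i _; rewrite mxE scale0r.
elim: s {sE A0} u => [|a s IH] u /=; first by rewrite big_nil mulmx1.
by rewrite fT IH big_cons mulmxA.
Qed.

(** The last vector outside C in the sequence v, (T - a1) v,
    (T - a2) (T - a1) v, ... is an eigenvector modulo C. *)
Lemma eigenvector_mod (T : V -> V) (C E : V -> Prop) v :
  finite_dim V -> linear_map T -> C 0 ->
  (forall a w, E w -> E (T w - a *: w)) -> E v -> ~ C v ->
  exists w a, [/\ E w, ~ C w & C (T w - a *: w)].
Proof.
move=> fV Tl C0 TE Ev Cv; have [s sP] := annihilating_factors fV Tl.
have : C (foldl (fun v a => T v - a *: v) v s) by rewrite sP.
elim: s {sP} v Ev Cv => [//|a s IH] v Ev Cv /=.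
have [Ca _|nCa] := pselect (C (T v - a *: v)); first by exists v, a.
exact/IH/nCa/TE.
Qed.

(** A spanning family of minimal size is a basis; the forms are its
    coordinates. *)
Lemma finite_dim_basis : finite_dim V ->
  exists n (b : 'I_n -> V) (f : 'I_n -> V -> k),
    (forall i, linear_form (f i)) /\ forall v, v = \sum_i f i v *: b i.
Proof.
move=> fV.
have ex : exists n, `[< exists b : 'I_n -> V, forall v, exists c : 'I_n -> k,
    v = \sum_(i < n) c i *: b i >].
  by have [n fn] := fV; exists n; apply/asboolP.
have [n /asboolP[b bV] nmin] := ex_minnP ex.
have free (c : 'I_n -> k) : \sum_i c i *: b i = 0 -> forall i, c i = 0.
  case: n b bV nmin c => [|n] b bV nmin c c0 i; first by case: i.
  apply/eqP; apply: contrapT => /negP ci.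
  suff /nmin : `[< exists b : 'I_n -> V, forall v, exists c : 'I_n -> k,
      v = \sum_(i < n) c i *: b i >] by rewrite ltnn.
  apply/asboolP; exists (fun j => b (lift i j)) => v.
  have bi : b i = \sum_j (- (c i)^-1 * c (lift i j)) *: b (lift i j).
    move: c0; rewrite (bigD1_ord i) //= => /eqP.
    rewrite addr_eq0 => /eqP /(congr1 (fun x => (c i)^-1 *: x)).
    rewrite scalerA mulVf // scale1r => ->.
    rewrite scalerN -scaleNr scaler_sumr.
    by apply: eq_bigr => j _; rewrite scalerA.
  have [d ->] := bV v.
  exists (fun j => d i * (- (c i)^-1 * c (lift i j)) + d (lift i j)).
  rewrite (bigD1_ord i) //= bi scaler_sumr -big_split /=.
  by apply: eq_bigr => j _; rewrite scalerA scalerDl.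
have /boolp.choice[c cV] := bV.
exists n, b, (fun i v => c v i); split=> [i a x y|//].
apply/eqP; rewrite -subr_eq0; apply/eqP; move: i; apply: free.
under eq_bigr do rewrite scalerBl scalerDl -scalerA.
by rewrite sumrB big_split -scaler_sumr -!cV subrr.
Qed.

End FiniteDimension.

Section FirstContraction.
Variables (k : fieldType) (H : algType k) (hH : hopf_structure H).
Local Notation Δ := (comul hH).
Local Notation ε := (counit hH).
Local Notation S := (antipode hH).

(** These operators commute when H is cocommutative, and have the group-likes as
    their common eigenvectors, up to scalars; the eigenvalue at g is f g. *)
Definition contract (f : H -> k) (h : H) : H := tlift (fun x y => f x *: y) (Δ h).

Lemma contract_linear f : linear_form f -> linear_map (contract f).
Proof.
move=> fl; apply: linear_map_tlift_arg; last exact: bundled_linear.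
exact: contract_bilinear.
Qed.

Lemma contract_comb I (r : seq I) c (f : I -> H -> k) h :
  contract (fun x => \sum_(i <- r) c i * f i x) h =
  \sum_(i <- r) c i *: contract (f i) h.
Proof.
transitivity (\sum_(i <- r) tlift (fun x y => c i *: (f i x *: y)) (Δ h)).
  rewrite -tlift_sum; apply: tlift_eq => x y; rewrite scaler_suml.
  by apply: eq_bigr => i _; rewrite scalerA.
apply: eq_bigr => i _.
by rewrite /contract (tlift_comp _ _ (linear_map_scale _ (@linear_map_id _ _))).
Qed.

Lemma counit_contract f h : linear_form f -> (ε (contract f h) : k) = f h.
Proof.
move=> fl; have := tlift_comp (fun x y : H => f x *: y) (Δ h)
  (bundled_linear (counit hH)).
rewrite -[LHS]/(ε (contract f h)) => ->.
rewrite -[RHS](comul_counitr hH (f := f : H -> k^o)) //.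
by apply: (@tlift_eq _ _ _ k^o) => x y; rewrite linearZ [RHS]mulrC.
Qed.

Lemma contractM f x y : linear_form f ->
  contract f (x * y) =
  tlift (fun u v => v * contract (fun z => f (u * z)) y) (Δ x).
Proof.
move=> fl; rewrite /contract rmorphM tlift_mul; last exact: contract_bilinear.
apply: tlift_eq => u v.
rewrite (tlift_comp _ _ (linear_map_mulr v (@linear_map_id _ H))).
by apply: tlift_eq => u' v'; rewrite scalerAr.
Qed.

Lemma contract_contract f f' h : linear_form f -> linear_form f' ->
  contract f (contract f' h) =
  tlift (fun x y => (tlift (fun u v => f' u * f v : k^o) (Δ x) : k) *: y) (Δ h).
Proof.
move=> fl fl'.
rewrite [contract f' h]/contract (tlift_comp _ _ (contract_linear fl)).
transitivity (tlift (fun x y => tlift (fun u v => f' x *: (f u *: v)) (Δ y)) (Δ h)).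
  apply: tlift_eq => x y; rewrite (linear_mapZ (contract_linear fl)).
  by rewrite (tlift_comp _ _ (linear_map_scale _ (@linear_map_id _ _))).
rewrite -(comul_coassoc hH (T := fun x u v => f' x *: (f u *: v))); last first.
  split=> *; try by do !apply: linear_map_scale; apply: linear_map_id.
    exact: (linear_map_scalel (f := f' : H -> k^o)).
  apply: linear_map_scale; exact: (linear_map_scalel (f := f : H -> k^o)).
apply: tlift_eq => x y.
have yl : linear_map (fun a : k^o => (a : k) *: y).
  exact: (linear_map_scalel (f := fun a : k^o => a)).
rewrite (tlift_comp _ _ yl); apply: tlift_eq => u v.
by rewrite scalerA.
Qed.

Lemma contract_commute f f' h : cocommutative hH ->
  linear_form f -> linear_form f' ->
  contract f (contract f' h) = contract f' (contract f h).
Proof.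
move=> Hc fl fl'; rewrite !contract_contract //; apply: tlift_eq => x y.
congr (_ *: _).
have bl := form_mul_bilinear fl' fl.
rewrite -[in LHS]Hc /tswap (tlift_comp _ _ (tlift_linear bl)).
by apply: (@tlift_eq _ _ _ k^o) => u v; rewrite tlift_tpure // mulrC.
Qed.

Local Notation group_like := (group_like hH).

Lemma contract_group_like f g : linear_form f -> group_like g ->
  contract f g = f g *: g.
Proof.
move=> fl [gΔ _]; rewrite /contract gΔ tlift_tpure //.
exact: contract_bilinear.
Qed.

Lemma contract_mul_group_like f x g : linear_form f -> group_like g ->
  contract f (x * g) = contract (fun z => f (z * g)) x * g.
Proof.
move=> fl [gΔ _]; rewrite /contract.
have -> : Δ (x * g) = Δ x * (g ⊗ g) by rewrite -gΔ rmorphM.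
rewrite tlift_mul; last exact: contract_bilinear.
rewrite (tlift_comp _ _ (linear_map_mull g (@linear_map_id _ H))).
apply: tlift_eq => u v; rewrite tlift_tpure.
  by rewrite scalerAl.
apply: bilinear_mapP => *; last exact/linear_map_scale/linear_map_mulr/linear_map_id.
apply: (linear_map_scalel (f := (fun z => f (u * z)) : H -> k^o)) => c a b.
by rewrite mulrDr -scalerAr fl.
Qed.

Lemma group_like1 : group_like 1.
Proof. by split; rewrite rmorph1. Qed.

Lemma group_likeM x y : group_like x -> group_like y -> group_like (x * y).
Proof.
move=> [xΔ xε] [yΔ yε]; split.
  have -> : Δ (x * y) = (x ⊗ x) * (y ⊗ y) by rewrite -xΔ -yΔ rmorphM.
  exact: tens_mulE.
by rewrite rmorphM; change (ε x * ε y = 1 :> k); rewrite xε yε mulr1.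
Qed.

Lemma group_likeS x : group_like x -> group_like (S x).
Proof.
move=> gx; have [xΔ xε] := gx; split.
  by rewrite comul_antipode xΔ tlift_tpure //; linear_tac.
have := congr1 ε (group_like_antipodel gx); rewrite rmorphM rmorph1.
by change (ε (S x) * (ε x : k) = 1 -> (ε (S x) : k) = 1); rewrite xε mulr1.
Qed.

(** Different group-likes are eigenvectors of some contraction for different
    eigenvalues. *)
Lemma group_like_free g (s : seq (k * H)) c : group_like g ->
  (forall p, p \in s -> group_like p.2 /\ p.2 <> g) ->
  c *: g = \sum_(p <- s) p.1 *: p.2 -> c = 0.
Proof.
move=> gg; have g0 : g != 0.
  apply/eqP => g0; have [_] := gg; rewrite g0 linear0 => /eqP.
  by rewrite eq_sym oner_eq0.
have [n] := ubnP (size s); elim: n s c => // n IH [|q s] c /=.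
  by rewrite big_nil => _ _ /eqP; rewrite scaler_eq0 (negPf g0) orbF => /eqP.
rewrite ltnS => sn sP; have [gq qg] := sP q (mem_head _ _).
have [f [fl fg]] : exists f, linear_form f /\ f g <> f q.2.
  apply: contrapT => nf; apply: qg; apply: separated => f fl.
  by apply: contrapT => fne; apply: nf; exists f; split=> // /esym.
rewrite big_cons => cE.
have lf := contract_linear fl.
pose t p : k * H := (p.1 * (f p.2 - f q.2), p.2).
have tP : forall p, p \in [seq t p | p <- s] -> group_like p.2 /\ p.2 <> g.
  by move=> _ /mapP[p ps ->]; apply: (sP p); rewrite inE ps orbT.
suff /IH/eqP : (c * (f g - f q.2)) *: g = \sum_(p <- [seq t p | p <- s]) p.1 *: p.2.
  rewrite size_map mulf_eq0 subr_eq0 => /(_ sn tP) /orP[/eqP//|/eqP//].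
transitivity (contract f (c *: g) - f q.2 *: (c *: g)).
  rewrite linear_mapZ // contract_group_like // !scalerA -scalerBl mulrBr.
  by rewrite [f q.2 * _]mulrC.
rewrite cE linear_mapD // linear_mapZ // contract_group_like // scalerDr !scalerA.
rewrite [q.1 * _]mulrC opprD addrACA subrr add0r big_map linear_map_sum //.
rewrite scaler_sumr -sumrB; apply: eq_big_seq => p ps.
have [|gp _] := sP p; first by rewrite inE ps orbT.
rewrite linear_mapZ // contract_group_like //= !scalerA -scalerBl mulrBr.
by rewrite [f q.2 * _]mulrC.
Qed.

End FirstContraction.

Section PrimitiveElements.
Variables (k : closedFieldType) (char_k : [pchar k] =i pred0).
Variables (H : algType k) (hH : hopf_structure H) (H_fd : finite_dim H).
Local Notation Δ := (comul hH).
Local Notation ε := (counit hH).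
Local Notation contract := (contract hH).

Variables (x : H) (xΔ : Δ x = x ⊗ 1 + 1 ⊗ x).

Lemma primitive_contractM f y : linear_form f ->
  contract f (x * y) = contract (fun z => f (x * z)) y + x * contract f y.
Proof.
move=> fl; rewrite contractM // xΔ.
have fl' u : linear_form (fun z => f (u * z)).
  by move=> c a b; rewrite mulrDr -scalerAr fl.
have bl : bilinear_map (fun u v => v * contract (fun z => f (u * z)) y).
  apply: bilinear_mapP => [v c u u'|u]; last first.
    by apply: linear_map_mull; apply: linear_map_id.
  rewrite scalerAr -mulrDr; congr (_ * _).
  rewrite -tlift_comb; apply: tlift_eq => a b.
  by rewrite mulrDl -scalerAl fl scalerDl scalerA.
rewrite (linear_mapD (tlift_linear bl)) !tlift_tpure // mul1r; congr (_ + x * _).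
by apply: tlift_eq => a b; rewrite mul1r.
Qed.

Lemma primitive_contract_exp m f : linear_form f ->
  (forall j, (j < m)%N -> f (x ^+ j) = 0) ->
  contract f (x ^+ m) = f (x ^+ m) *: 1.
Proof.
elim: m f => [|m IH] f fl f0.
  by rewrite contract_group_like //; apply: group_like1.
have fl' : linear_form (fun z => f (x * z)).
  by move=> c a b; rewrite mulrDr -scalerAr fl.
rewrite exprS primitive_contractM // !IH // ?f0 // ?scale0r ?mulr0 ?addr0 -?exprS //.
  by move=> j jm; apply: f0; apply: ltnW.
by move=> j jm; rewrite -exprS f0.
Qed.

(** The coproduct of x^m is the binomial sum of the x^j ⊗ x^(m-j); only the terms
    j = m and j = m + 1 of that of x^(m+1) survive here. *)
Lemma primitive_contract_expS m f : linear_form f ->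
  (forall j, (j < m)%N -> f (x ^+ j) = 0) ->
  contract f (x ^+ m.+1) = f (x ^+ m.+1) *: 1 + (f (x ^+ m) *+ m.+1) *: x.
Proof.
have fl' (h : H -> k) : linear_form h -> linear_form (fun z => h (x * z)).
  by move=> hl c a b; rewrite mulrDr -scalerAr hl.
elim: m f => [|m IH] f fl f0.
  rewrite expr1 -[x in LHS]mulr1 primitive_contractM //.
  rewrite !contract_group_like ?mulr1 //; try exact: group_like1; last exact: fl'.
  by rewrite -scalerAr mulr1.
rewrite exprS primitive_contractM // IH ?primitive_contract_exp //; first last.
- by move=> j jm; rewrite -exprS f0.
- exact: fl'.
- by rewrite -!exprS -addrA -scalerAr mulr1 -scalerDl -mulrSr.
Qed.

(** Let x^n be the first power of x in the span of the smaller ones, and f a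
    form with f (x^(n-1)) = 1 that vanishes on these.  Contracting the relation
    by f leaves n x = c 1. *)
Lemma primitive_eq0 : x = 0.
Proof.
pose pspan m (y : H) := exists c : 'I_m -> k, y = \sum_(i < m) c i *: x ^+ i.
have pspan_sub m : subspace (pspan m).
  split=> [|a y z [c ->] [d ->]].
    by exists (fun=> 0); rewrite big1 // => i _; rewrite scale0r.
  exists (fun i => a * c i + d i); rewrite scaler_sumr -big_split.
  by apply: eq_bigr => i _ /=; rewrite scalerDl scalerA.
have pspan_exp m j : (j < m)%N -> pspan m (x ^+ j).
  move=> jm; exists (fun i => (i == Ordinal jm)%:R).
  rewrite (bigD1 (Ordinal jm)) //= eqxx scale1r big1 ?addr0 // => i /negPf->.
  by rewrite scale0r.
have pspan_mul m y : pspan m y -> pspan m.+1 (x * y).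
  move=> [c ->]; rewrite mulr_sumr; apply: subspace_sum => // i _.
  by rewrite -scalerAr -exprS; apply: (subspaceZ _ (pspan_sub _)); apply: pspan_exp; rewrite ltnS.
have pspan_le m y : pspan m y -> pspan m.+1 y.
  move=> [c ->]; apply: subspace_sum => // i _.
  by apply: (subspaceZ _ (pspan_sub _)); apply: pspan_exp; apply: leqW.
have ex : exists n, `[< pspan n (x ^+ n) >].
  have [s sP] := annihilating_factors H_fd (linear_map_mulr x (@linear_map_id _ H)).
  exists (size s); apply/asboolP.
  suff : forall m v, pspan m (x ^+ m - v) ->
      pspan (m + size s)%N (x ^+ (m + size s) - foldl (fun v a => x * v - a *: v) v s).
    by move=> /(_ 0%N 1); rewrite sP subr0; apply; rewrite subrr; case: (pspan_sub 0%N).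
  elim: s {sP} => [|a s IH] m v mv /=; first by rewrite addn0.
  rewrite addnS -addSn; apply: IH.
  have -> : x ^+ m.+1 - (x * v - a *: v) = x * (x ^+ m - v) - a *: (x ^+ m - v) + a *: x ^+ m.
    rewrite mulrBr -exprS scalerBr !opprD !opprK -!addrA; congr (_ + (_ + _)).
    by rewrite addrCA addNr addr0.
  apply: subspaceD => //.
    apply: subspaceB => //; first exact: pspan_mul.
    by apply: subspaceZ => //; apply: pspan_le.
  by apply: subspaceZ => //; apply: pspan_exp.
have [n /asboolP nP nmin] := ex_minnP ex.
case: n nP nmin => [|n] nP nmin.
  by have [c] := nP; rewrite big_ord0 => /eqP; rewrite oner_eq0.
have /(separating_form_mod (pspan_sub n)) [f [fl f0 f1]] : ~ pspan n (x ^+ n).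
  by move=> /asboolP /nmin; rewrite ltnn.
have f0' j : (j < n)%N -> f (x ^+ j) = 0 by move=> jn; apply: f0; apply: pspan_exp.
have [c cE] := nP.
have := primitive_contract_expS fl f0'; rewrite {1}cE.
have fL := contract_linear hH fl.
rewrite (linear_map_sum fL) big_ord_recr /= big1 ?add0r => [|i _]; last first.
  rewrite linear_mapZ // primitive_contract_exp // ?f0' ?scale0r ?scaler0 //.
  by move=> j ji; apply: f0'; apply: ltn_trans (ltn_ord i).
rewrite linear_mapZ // primitive_contract_exp // f1 scale1r => E.
have n0 : (n.+1)%:R != 0 :> k by have /pcharf0P -> := char_k.
have xE : x = ((n.+1)%:R^-1 * (c ord_max - f (x ^+ n.+1))) *: 1.
  rewrite -scalerA scalerBl E addrC addKr scalerA mulVf ?scale1r //.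
have xε : (ε x : k) = 0.
  have := counitl hH x; rewrite xΔ.
  have bl : bilinear_map (fun a b : H => (ε a : k) *: b) by linear_tac.
  rewrite (linear_mapD (tlift_linear bl)) !tlift_tpure // rmorph1 scale1r.
  by move=> /eqP; rewrite -subr_eq0 addrK scaler_eq0 oner_eq0 orbF => /eqP.
rewrite xE; have := congr1 (fun y => (ε y : k)) xE; rewrite /= xε linearZ /= rmorph1.
by rewrite [_ *: _]mulr1 => <-; rewrite scale0r.
Qed.

End PrimitiveElements.

Section GroupAlgebra.
Variables (k : closedFieldType) (char_k : [pchar k] =i pred0).
Variables (H : algType k) (hH : hopf_structure H) (H_fd : finite_dim H).
Variable (Hc : cocommutative hH).
Local Notation Δ := (comul hH).
Local Notation ε := (counit hH).
Local Notation S := (antipode hH).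
Local Notation contract := (contract hH).
Local Notation group_like := (group_like hH).

Definition group_span (P : H -> Prop) (x : H) : Prop :=
  exists s : seq (k * H), (forall p, p \in s -> group_like p.2 /\ P p.2) /\
    x = \sum_(p <- s) p.1 *: p.2.

Lemma group_span_subspace P : subspace (group_span P).
Proof.
split=> [|c x y [s [sP ->]] [t [tP ->]]]; first by exists [::]; rewrite big_nil.
exists ([seq (c * p.1, p.2) | p <- s] ++ t); split=> [p|].
  by rewrite mem_cat => /orP[/mapP[q /sP qP ->]|/tP].
rewrite big_cat big_map scaler_sumr; congr (_ + _).
by apply: eq_bigr => p _; rewrite scalerA.
Qed.

Lemma group_span_base (P : H -> Prop) g : group_like g -> P g -> group_span P g.
Proof.
move=> gg Pg; exists [:: (1, g)]; rewrite big_seq1 scale1r.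
by split=> // p /[!inE] /eqP->.
Qed.

Lemma group_span_contract P f x : linear_form f ->
  group_span P x -> group_span P (contract f x).
Proof.
move=> fl [s [sP ->]]; rewrite (linear_map_sum (contract_linear hH fl)).
have ss := group_span_subspace P.
apply: subspace_sum => // p /sP[gp Pp].
rewrite (linear_mapZ (contract_linear hH fl)) contract_group_like //.
by do 2!apply: subspaceZ => //; apply: group_span_base.
Qed.

Lemma group_spanM x g : group_span (fun=> True) x -> group_like g ->
  group_span (fun=> True) (x * g).
Proof.
move=> [s [sP ->]] gg; exists [seq (p.1, p.2 * g) | p <- s]; split=> [p|].
  by move=> /mapP[q /sP[gq _] ->]; split=> //; apply: group_likeM.
by rewrite big_map mulr_suml; apply: eq_bigr => p _; rewrite scalerAl.
Qed.

(** The contractions commute, and finitely many of them span all: they have a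
    common eigenvector modulo C. *)
Lemma common_eigenvector_mod (C : H -> Prop) v : subspace C ->
  (forall f x, linear_form f -> C x -> C (contract f x)) -> ~ C v ->
  exists2 w, ~ C w & forall f, linear_form f -> exists a, C (contract f w - a *: w).
Proof.
move=> Cs CL Cv; have [n [b [f [fl fV]]]] := finite_dim_basis H_fd.
suff [w Cw wP] : exists2 w, ~ C w &
    forall i, i \in enum 'I_n -> exists a, C (contract (f i) w - a *: w).
  have /boolp.choice[a aP] : forall i, exists a, C (contract (f i) w - a *: w).
    by move=> i; apply: wP; rewrite mem_enum.
  exists w => // h hl; exists (\sum_i h (b i) * a i).
  have -> : contract h w = \sum_i h (b i) *: contract (f i) w.
    rewrite -contract_comb; apply: tlift_eq => x y; congr (_ *: _).
    rewrite [in LHS](fV x) linear_form_sum //; apply: eq_bigr => i _.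
    by rewrite linear_formZ // mulrC.
  rewrite scaler_suml -sumrB; apply: subspace_sum => // i _.
  by rewrite -scalerA -scalerBr; apply: subspaceZ.
elim: (enum 'I_n) => [|i s [w Cw wP]]; first by exists v.
pose E w := forall i, i \in s -> exists a, C (contract (f i) w - a *: w).
have EL a u : E u -> E (contract (f i) u - a *: u).
  move=> Eu j /Eu[c cP]; exists c.
  have lj := contract_linear hH (fl j); have li := contract_linear hH (fl i).
  rewrite linear_mapD // contract_commute // -scaleNr (linear_mapZ lj).
  have -> : contract (f i) (contract (f j) u) + - a *: contract (f j) u -
      c *: (contract (f i) u + - a *: u) =
      contract (f i) (contract (f j) u - c *: u) - a *: (contract (f j) u - c *: u).
    rewrite (linear_mapD li) -[- (c *: u)]scaleNr (linear_mapZ li) !scalerDr.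
    rewrite !scaleNr !scalerN !opprD !opprK !scalerA [c * a]mulrC.
    by rewrite addrACA.
  by apply: subspaceB; [|exact: CL|exact: subspaceZ].
have [u [a [Eu Cu ua]]] :=
  eigenvector_mod H_fd (contract_linear hH (fl i)) Cs.1 EL wP Cw.
exists u => // j; rewrite inE => /orP[/eqP->|]; last exact: Eu.
by exists a.
Qed.

(** The eigenvalue of f is f γ for a group-like γ, since it is multiplicative in
    f for the convolution product; dividing v by γ turns it into f 1. *)
Lemma contract_group_like_shift v : ~ group_span (fun=> True) v ->
  (forall f, linear_form f -> exists a,
     group_span (fun=> True) (contract f v - a *: v)) ->
  exists2 w, ~ group_span (fun=> True) w &
    forall f, linear_form f -> group_span (fun=> True) (contract f w - f 1 *: w).
Proof.
set C := group_span _; have Cs : subspace C by apply: group_span_subspace.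
move=> Cv vP; have [p [pl pC pv]] := separating_form_mod Cs Cv.
pose γ := tlift (fun x y => p y *: x) (Δ v).
have pf f : linear_form f -> p (contract f v) = f γ.
  move=> fl; rewrite /contract (tlift_form _ _ pl) (tlift_form _ _ fl).
  by apply: (@tlift_eq _ _ _ k^o) => x y; rewrite !linear_formZ // mulrC.
have vγ f : linear_form f -> C (contract f v - f γ *: v).
  move=> fl; have [a aP] := vP f fl.
  have := pC _ aP; rewrite -scaleNr linear_formD // linear_formZ // pf // pv mulr1.
  by move/eqP; rewrite addr_eq0 opprK => /eqP->.
have gγ : group_like γ.
  split; last first.
    have := pf _ (bundled_linear ε : linear_form (ε : H -> k)).
    by rewrite /contract (counitl hH) pv => <-.
  apply: tens_forms_inj => f f' fl fl'.
  have bl := form_mul_bilinear fl fl'.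
  rewrite tlift_tpure //.
  pose F x : k := tlift (fun a b => f a * f' b : k^o) (Δ x).
  have Fl : linear_form F.
    move=> c a b; rewrite /F linearP.
    exact: (tlift_linear bl).
  have FE : contract F v = contract f' (contract f v) by rewrite contract_contract.
  rewrite -/(F γ) -pf // FE -{1}[contract f v](subrK (f γ *: v)).
  have lf' := contract_linear hH fl'.
  rewrite linear_mapD // linear_formD // (pC (contract f' (_ - _))); last first.
    by apply: group_span_contract => //; apply: vγ.
  by rewrite add0r linear_mapZ // linear_formZ // pf.
have γS := group_likeS gγ.
exists (v * S γ).
  move=> Cw; apply: Cv; rewrite -[v]mulr1 -(group_like_antipodel gγ) mulrA.
  exact: group_spanM.
move=> f fl; rewrite contract_mul_group_like //.
have fl' : linear_form (fun z => f (z * S γ)).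
  by move=> c a b; rewrite mulrDl -scalerAl fl.
have := vγ _ fl'; rewrite /= group_like_antipoder // => vf.
rewrite [f 1 *: _]scalerAl -mulrBl.
exact: group_spanM.
Qed.

(** Let C be the span of the group-likes, W that of the group-likes other than 1,
    and e a form with e 1 = 1 that vanishes on W.  The contraction by e projects C
    onto the line of 1.  Adding an element of W to the eigenvector v gives a
    generalized eigenvector u of this operator, and then all contractions of u
    lie in f 1 u + k 1: up to a multiple of 1, u is primitive. *)
Theorem group_like_span h : group_span (fun=> True) h.
Proof.
apply: contrapT => Ch.
set C := group_span _ in Ch; have Cs : subspace C by apply: group_span_subspace.
have [v0 Cv0 v0P] :=
  common_eigenvector_mod Cs (fun f x fl => @group_span_contract _ f x fl) Ch.
have [v Cv vP] := contract_group_like_shift Cv0 v0P.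
pose W := group_span (fun g => g <> 1).
have Ws : subspace W by apply: group_span_subspace.
have WC w : W w -> C w.
  by move=> [s [sP ->]]; exists s; split=> // p /sP[].
have C1 : C 1 by apply: group_span_base => //; apply: group_like1.
have W1 : ~ W 1.
  move=> [s [sP sE]]; have := group_like_free (group_like1 hH) sP (c := 1).
  by rewrite scale1r => /(_ sE) /eqP; rewrite oner_eq0.
have CW c : C c -> exists a w, W w /\ c = a *: 1 + w.
  move=> [s [sP ->]]; elim: s sP => [|p s IH] sP.
    by exists 0, 0; rewrite big_nil scale0r addr0; split=> //; case: Ws.
  have [q qs|a [w [Ww wE]]] := IH; first by apply: sP; rewrite inE qs orbT.
  have [gp _] := sP p (mem_head _ _).
  have [p1|p1] := pselect (p.2 = 1).
    by exists (p.1 + a), w; rewrite big_cons wE p1 addrA scalerDl.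
  exists a, (p.1 *: p.2 + w); rewrite big_cons wE addrCA; split=> //.
  by apply: subspaceD => //; apply: subspaceZ => //; apply: group_span_base.
have [e [el eW e1]] := separating_form_mod Ws W1.
have le := contract_linear hH el.
have e_1 : contract e 1 = 1.
  by rewrite contract_group_like ?e1 ?scale1r //; apply: group_like1.
have e_W w : W w -> contract e w = 0.
  move=> [s [sP ->]]; rewrite linear_map_sum // big_seq big1 // => p /sP[gp p1].
  rewrite linear_mapZ // contract_group_like // eW ?scale0r ?scaler0 //.
  exact: group_span_base.
have [a [w [Ww evE]]] := CW _ (vP e el).
rewrite e1 scale1r in evE.
pose u := v + w.
have Cu : ~ C u.
  by move=> Cu; apply: Cv; rewrite -[v](addrK w); apply: subspaceB => //; apply: WC.
have eu : contract e u = u + a *: 1.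
  rewrite /u linear_mapD // (e_W w) // addr0 -[LHS](subrK v) evE.
  by rewrite addrC -addrA [a *: 1 + w]addrC.
have uP f : linear_form f -> exists c, contract f u = f 1 *: u + c *: 1.
  move=> fl; have lf := contract_linear hH fl.
  have [c [w' [Ww' cE]]] : exists c w', W w' /\
      contract f u - f 1 *: u = c *: 1 + w'.
    apply: CW; rewrite /u linear_mapD // scalerDr opprD addrACA.
    apply: subspaceD => //; first exact: vP.
    apply: subspaceB => //; last by apply: subspaceZ => //; apply: WC.
    by apply: group_span_contract => //; apply: WC.
  exists c; suff w'0 : w' = 0 by rewrite -[LHS](subrK (f 1 *: u)) cE w'0 addr0 addrC.
  have eA : contract e (contract f u) = contract f u + (f 1 * a) *: 1.
    rewrite contract_commute // eu linear_mapD // linear_mapZ //.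
    by rewrite (contract_group_like fl (group_like1 hH)) scalerA [a * _]mulrC.
  have eE : contract e (contract f u - f 1 *: u) = contract f u - f 1 *: u.
    rewrite (linear_mapD le) eA -scaleNr (linear_mapZ le) eu scalerDr !scaleNr scalerA.
    by rewrite addrACA subrr addr0.
  have := eE; rewrite cE linear_mapD // (e_W w') // addr0 linear_mapZ // e_1.
  by move=> /esym/eqP; rewrite addrC -subr_eq0 addrK => /eqP.
pose x := u - (ε u : k) *: 1.
have xΔ : Δ x = x ⊗ 1 + 1 ⊗ x.
  apply: tens_contract_inj => f fl; have lf := contract_linear hH fl.
  have bl := contract_bilinear H fl.
  rewrite (linear_mapD (tlift_linear bl)) !tlift_tpure // -/(contract f x).
  have [c cE] := uP f fl.
  have cε : f u = f 1 * (ε u : k) + c.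
    rewrite -(counit_contract hH u fl) cE linearD !linearZ /= rmorph1.
    by rewrite [c *: _]mulr1.
  have fx : f x = c.
    rewrite /x -scaleNr linear_formD // linear_formZ // cε addrAC mulNr.
    by rewrite [f 1 * _]mulrC subrr add0r.
  rewrite fx /x -scaleNr (linear_mapD lf) (linear_mapZ lf) cE.
  rewrite (contract_group_like fl (group_like1 hH)) [f 1 *: (u + _)]scalerDr.
  by rewrite !scalerA [f 1 * _]mulrC addrAC addrC.
apply: Cu; have := primitive_eq0 char_k H_fd xΔ => /eqP.
by rewrite subr_eq0 => /eqP->; apply: subspaceZ.
Qed.

End GroupAlgebra.

Section GroupLikeGroup.
Variables (k : fieldType) (H : algType k) (hH : hopf_structure H) (s : seq H).
Local Notation S := (antipode hH).
Local Notation group_like := (group_like hH).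

Definition lists_group_likes : Prop := forall x, x \in s <-> group_like x.

(** The group-likes of H, listed by s; the proof is an argument so that the group
    structure can be found from the type. *)
Definition group_likes of lists_group_likes : Type := seq_sub s.

Variable (sP : lists_group_likes).
Local Notation G := (group_likes sP).

HB.instance Definition _ := Finite.copy G (seq_sub s).

Definition group_like_val (x : G) : H := ssval x.

Lemma group_like_valP x : group_like (group_like_val x).
Proof. by apply/sP; apply: ssvalP. Qed.

Lemma group_like_val_inj : injective group_like_val.
Proof. exact: val_inj. Qed.

Definition group_like_elt x (gx : group_like x) : G := SeqSub (proj2 (sP x) gx).

Definition group_like_one : G := group_like_elt (group_like1 hH).
Definition group_like_mul (x y : G) : G :=
  group_like_elt (group_likeM (group_like_valP x) (group_like_valP y)).
Definition group_like_inv (x : G) : G :=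
  group_like_elt (group_likeS (group_like_valP x)).

Lemma group_like_mulA : associative group_like_mul.
Proof. by move=> x y z; apply: group_like_val_inj; apply: mulrA. Qed.

Lemma group_like_mul1 : left_id group_like_one group_like_mul.
Proof. by move=> x; apply: group_like_val_inj; apply: mul1r. Qed.

Lemma group_like_mulV : left_inverse group_like_one group_like_inv group_like_mul.
Proof.
by move=> x; apply: group_like_val_inj; apply: group_like_antipodel (group_like_valP x).
Qed.

HB.instance Definition _ := Finite_isGroup.Build G
  group_like_mulA group_like_mul1 group_like_mulV.

Lemma group_algebra_of_span : uniq s ->
  (forall h, exists c : H -> k, h = \sum_(x <- s) c x *: x) ->
  is_group_algebra hH.
Proof.
move=> us spans; exists G, group_like_val; split=> //.
- by move=> x; have [] := group_like_valP x.
- by move=> x; have [] := group_like_valP x.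
have sumE (c : H -> k) : \sum_(x <- s) c x *: x =
    \sum_(x : G) c (group_like_val x) *: group_like_val x.
  rewrite -(big_map group_like_val xpredT (fun x => c x *: x)).
  apply: perm_big; apply: uniq_perm => //.
    by rewrite map_inj_uniq ?index_enum_uniq //; apply: group_like_val_inj.
  move=> x; apply/idP/mapP => [/sP gx|[y _ ->]]; last exact: ssvalP.
  by exists (group_like_elt gx); rewrite ?mem_index_enum.
move=> h; have [c hE] := spans h.
exists [ffun x => c (group_like_val x)]; split.
  by rewrite hE sumE; apply: eq_bigr => x _; rewrite ffunE.
move=> d dE; apply/ffunP => x; rewrite ffunE; apply/eqP; rewrite -subr_eq0; apply/eqP.
pose t y : k * H := (d y - c (group_like_val y), group_like_val y).
have tP p : p \in [seq t y | y <- enum (predC1 x)] ->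
    group_like p.2 /\ p.2 <> group_like_val x.
  move=> /mapP[y + ->]; rewrite mem_enum !inE => /eqP yx.
  by split; [apply: group_like_valP|move/group_like_val_inj].
apply: (group_like_free (group_like_valP x) tP).
rewrite big_map big_enum /=; apply/eqP; rewrite scalerBl subr_eq.
have E : \sum_y c (group_like_val y) *: group_like_val y =
         \sum_y d y *: group_like_val y by rewrite -sumE -hE.
move: E; rewrite (bigD1 x) //= => /(canRL (addrK _)) ->.
rewrite [in X in _ == X + _](eq_bigr (fun y => d y *: group_like_val y -
  c (group_like_val y) *: group_like_val y)); last by move=> y _; rewrite scalerBl.
by rewrite sumrB [X in X - _](bigD1 x) //= -addrA addrC.
Qed.

End GroupLikeGroup.

(** The group-likes that occur in expressions of a basis already span H, and
    there are no others, as different group-likes are independent. *)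
Theorem cocommutative_group_algebra (k : closedFieldType)
    (char_k : [pchar k] =i pred0) (H : algType k) (hH : hopf_structure H) :
  finite_dim H -> cocommutative hH -> is_group_algebra hH.
Proof.
move=> H_fd Hc; have [n [b bH]] := H_fd.
have /boolp.choice[t tP] : forall i, exists t : seq (k * H),
    (forall p, p \in t -> group_like hH p.2) /\ b i = \sum_(p <- t) p.1 *: p.2.
  move=> i; have [t [tP ->]] := group_like_span char_k H_fd Hc (b i).
  by exists t; split=> // p /tP[].
pose s := undup (flatten [seq [seq p.2 | p <- t i] | i <- enum 'I_n]).
have us : uniq s by apply: undup_uniq.
have ts i p : p \in t i -> p.2 \in s.
  move=> pt; rewrite mem_undup; apply/flattenP.
  exists [seq p.2 | p <- t i]; last exact: map_f.
  by apply/map_f; rewrite mem_enum.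
have sg x : x \in s -> group_like hH x.
  rewrite mem_undup => /flattenP[_ /mapP[i _ ->] /mapP[p pt ->]].
  exact: (tP i).1.
pose W h := exists c : H -> k, h = \sum_(x <- s) c x *: x.
have Ws : subspace W.
  split=> [|a x y [c ->] [d ->]].
    by exists (fun=> 0); rewrite big1 // => x _; rewrite scale0r.
  exists (fun z => a * c z + d z); rewrite scaler_sumr -big_split.
  by apply: eq_bigr => z _ /=; rewrite scalerDl scalerA.
have WH h : W h.
  have [c ->] := bH h; apply: subspace_sum => // i _; apply: subspaceZ => //.
  rewrite (tP i).2; apply: subspace_sum => // p /ts ps; apply: subspaceZ => //.
  exists (fun y => (y == p.2)%:R); rewrite (bigD1_seq p.2) //= eqxx scale1r.
  by rewrite big1 ?addr0 // => y /negPf->; rewrite scale0r.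
have sP : lists_group_likes hH s.
  move=> g; split=> [|gg]; first exact: sg.
  apply: contrapT => /negP gs; have [c gE] := WH g.
  have := group_like_free gg (s := [seq (c x, x) | x <- s]) (c := 1).
  rewrite scale1r big_map /= => /(_ _ gE)/eqP; rewrite oner_eq0; move=> F.
  suff : false by []; apply: F => _ /mapP[x xs ->]; split; first exact: sg.
  by move=> /= xg; rewrite -xg xs in gs.
exact: (group_algebra_of_span sP).
Qed.

(** * Scalar cochains *)

Section Cochains.
Variables (k : fieldType) (R : algType k) (aug : {lrmorphism R -> k^o}).
Implicit Types (f g : seq R -> k) (s : seq R).
Local Notation α r := (aug r : k).

Definition multilinear f : Prop :=
  forall s t c a b, f (s ++ (c *: a + b) :: t) = c * f (s ++ a :: t) + f (s ++ b :: t).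

Definition supported n f : Prop := forall s, size s <> n -> f s = 0.

Definition ncochain n f : Prop := supported n f /\ multilinear f.

(** The coboundary up to sign and without its first face.  The recursion, dual to
    that of the bar differential, turns statements on alternating sums into
    inductions on lists. *)
Fixpoint bar_delta f s : k :=
  if s is a :: t then
    if t is b :: u then f (a * b :: u) - bar_delta (fun v => f (a :: v)) t
    else α a * f [::]
  else 0.

Definition delta f s : k := if s is a :: t then α a * f t - bar_delta f s else 0.

Definition cup p f g s : k := f (take p s) * g (drop p s).

Arguments bar_delta : simpl never.
Arguments delta : simpl never.

Lemma bar_delta1 f a : bar_delta f [:: a] = α a * f [::].
Proof. by []. Qed.

Lemma bar_delta2 f a b s :
  bar_delta f (a :: b :: s) = f (a * b :: s) - bar_delta (fun v => f (a :: v)) (b :: s).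
Proof. by []. Qed.

Lemma delta_cons f a s : delta f (a :: s) = α a * f s - bar_delta f (a :: s).
Proof. by []. Qed.

Lemma multilinear_cons f a : multilinear f -> multilinear (fun s => f (a :: s)).
Proof. by move=> fl s t c x y; apply: (fl (a :: s)). Qed.

Lemma multilinear_head f s : multilinear f -> linear_form (fun a => f (a :: s)).
Proof. by move=> fl c x y; apply: (fl [::]). Qed.

Lemma ncochain_comb n c f g : ncochain n f -> ncochain n g -> ncochain n (fun s => c * f s + g s).
Proof.
move=> [f0 fl] [g0 gl]; split=> [s sn|s t d a b].
  by rewrite f0 // g0 // mulr0 addr0.
by rewrite fl gl !mulrDr addrACA mulrCA.
Qed.

Lemma ncochain0 n : ncochain n (fun=> 0).
Proof. by split=> // s t c a b; rewrite mulr0 addr0. Qed.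

Lemma ncochainZ n c f : ncochain n f -> ncochain n (fun s => c * f s).
Proof.
move=> fn; have := ncochain_comb c fn (ncochain0 n).
by rewrite (_ : (fun s => _) = fun s => c * f s) //; apply: funext => s; rewrite addr0.
Qed.

Lemma ncochainB n f g : ncochain n f -> ncochain n g -> ncochain n (fun s => f s - g s).
Proof.
move=> fn gn; have := ncochain_comb (-1) gn fn.
rewrite (_ : (fun s => _) = fun s => f s - g s) //; apply: funext => s.
by rewrite mulN1r addrC.
Qed.

Lemma ncochain_sum n I (r : seq I) c (F : I -> seq R -> k) :
  (forall i, ncochain n (F i)) -> ncochain n (fun s => \sum_(i <- r) c i * F i s).
Proof.
move=> Fn; elim: r => [|i r IH].
  rewrite (_ : (fun s => _) = fun=> 0); first exact: ncochain0.
  by apply: funext => s; rewrite big_nil.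
rewrite (_ : (fun s => _) = fun s => c i * F i s + \sum_(i <- r) c i * F i s).
  exact: ncochain_comb.
by apply: funext => s; rewrite big_cons.
Qed.

Lemma bar_delta_comb c f g s :
  bar_delta (fun u => c * f u + g u) s = c * bar_delta f s + bar_delta g s.
Proof.
elim: s f g => [|a [|b s] IH] f g; first by rewrite /bar_delta mulr0 addr0.
  by rewrite !bar_delta1 mulrDr mulrCA.
by rewrite !bar_delta2 IH mulrBr opprD addrACA.
Qed.

Lemma bar_delta0 s : bar_delta (fun=> 0) s = 0.
Proof.
by elim: s => [//|a [|b s] IH]; rewrite ?bar_delta1 ?mulr0 // bar_delta2 IH subrr.
Qed.

Lemma bar_delta_sum I (r : seq I) (F : I -> seq R -> k) s :
  bar_delta (fun u => \sum_(i <- r) F i u) s = \sum_(i <- r) bar_delta (F i) s.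
Proof.
elim: r => [|i r IH].
  by rewrite big_nil -[RHS](bar_delta0 s); congr bar_delta; apply: funext => u; rewrite big_nil.
rewrite big_cons -IH -[bar_delta (F i) s]mul1r -bar_delta_comb.
by congr bar_delta; apply: funext => u; rewrite big_cons mul1r.
Qed.

Lemma bar_delta_multilinear f : multilinear f -> multilinear (bar_delta f).
Proof.
move=> fl s; elim: s f fl => [|x s IH] f fl t c a b; last first.
  have IHx := IH _ (multilinear_cons x fl) t c a b.
  case: s IHx {IH} => [|y s] IHx.
    rewrite ![[::] ++ _]/= in IHx; rewrite ![[:: x] ++ _]/= !bar_delta2 IHx.
    by rewrite mulrDr -scalerAr (fl [::]) mulrBr opprD addrACA.
  rewrite ![(y :: s) ++ _]/= in IHx; rewrite ![[:: x, y & s] ++ _]/= !bar_delta2 IHx.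
  by rewrite (fl (_ :: s)) mulrBr opprD addrACA.
case: t => [|y t]; rewrite ![[::] ++ _]/=.
  by rewrite !bar_delta1 linearP mulrDl [_ *: _]/(_ * _) -mulrA.
rewrite !bar_delta2 mulrDl -scalerAl (fl [::]) mulrBr addrACA -opprD -bar_delta_comb.
by congr (_ - bar_delta _ _); apply: funext => u; apply: (fl [::]).
Qed.

Lemma bar_delta_supported n f : supported n f -> supported n.+1 (bar_delta f).
Proof.
move=> f0 s; elim: s n f f0 => [|a [|b s] IH] n f f0 // sn.
  by rewrite bar_delta1 f0 ?mulr0 //= => n0; apply: sn; rewrite -n0.
rewrite bar_delta2 f0 ?sub0r; last by move=> /= E; apply: sn; rewrite -E.
case: n f0 sn => [|n] f0 sn.
  have -> : (fun v => f (a :: v)) = fun=> 0 by apply: funext => v; apply: f0.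
  by rewrite bar_delta0 oppr0.
rewrite (IH n) ?oppr0 // => [v vn|E]; last by apply: sn; rewrite -E.
by apply: f0 => -[].
Qed.

Lemma delta_ncochain n f : ncochain n f -> ncochain n.+1 (delta f).
Proof.
move=> [f0 fl]; have b0 := bar_delta_supported f0; have bl := bar_delta_multilinear fl.
split=> [[|a s] sn //|[|x s] t c a b]; rewrite ?cat0s ?cat_cons !delta_cons.
- by rewrite b0 // f0 ?mulr0 ?subr0 // => E; apply: sn; rewrite /= E.
- rewrite (bl [::]) linearP mulrDl [_ *: _]/(_ * _) mulrBr opprD addrACA.
  by rewrite -mulrA.
by rewrite -!cat_cons (bl (x :: s)) fl mulrBr mulrDr mulrCA opprD addrACA.
Qed.

Lemma delta_comb c f g s : delta (fun u => c * f u + g u) s = c * delta f s + delta g s.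
Proof.
case: s => [|a s]; first by rewrite /delta mulr0 addr0.
by rewrite /delta bar_delta_comb mulrDr mulrBr opprD addrACA mulrCA.
Qed.

Lemma delta0 s : delta (fun=> 0) s = 0.
Proof. by case: s => // a s; rewrite delta_cons bar_delta0 mulr0 subrr. Qed.

Lemma deltaZ c f s : delta (fun u => c * f u) s = c * delta f s.
Proof.
rewrite -[RHS]addr0 -(delta0 s) -delta_comb; congr delta; apply: funext => u.
by rewrite addr0.
Qed.

Lemma cup_ncochain p q f g : ncochain p f -> ncochain q g -> ncochain (p + q) (cup p f g).
Proof.
move=> [f0 fl] [g0 gl]; split=> [s sn|s t c a b]; rewrite /cup.
  have [sp|sp] := ltnP (size s) p.
    rewrite f0 ?mul0r // size_take ltnNge (ltnW sp) /= => E.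
    by rewrite E ltnn in sp.
  rewrite g0 ?mulr0 // size_drop => E; apply: sn.
  by rewrite -E subnKC.
rewrite !take_cat !drop_cat; case: ltnP => sp; first by rewrite gl mulrDr mulrCA.
case: (p - size s)%N => [|m] /=.
  by rewrite cats0 (gl [::]) mulrDr mulrCA.
by rewrite fl mulrDl mulrA.
Qed.

(** This is the Leibniz rule in the form that passes through the recursion. *)
Lemma bar_delta_cup p f g a s : (p <= size s)%N ->
  bar_delta (cup p f g) (a :: s) = bar_delta f (a :: take p s) * g (drop p s)
    - (-1) ^+ p * f (take p (a :: s)) * delta g (drop p (a :: s)).
Proof.
elim: p f a s => [|p IH] f a s sp.
  have -> : cup 0 f g = fun u => f [::] * g u + 0.
    by apply: funext => u; rewrite /cup take0 drop0 addr0.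
  rewrite (bar_delta_comb _ _ (fun=> 0)) bar_delta0 addr0 !take0 !drop0 bar_delta1 delta_cons.
  by rewrite expr0 mul1r mulrBr opprB addrC mulrCA mulrA subrK.
case: s sp => [//|b s]; rewrite ltnS => sp.
rewrite bar_delta2 -[X in _ - X]/(bar_delta (cup p (fun v => f (a :: v)) g) (b :: s)) IH //.
rewrite ![take p.+1 (_ :: _)]/= ![drop p.+1 (_ :: _)]/= bar_delta2 mulrBl.
by rewrite exprS mulN1r !mulNr opprK opprB addrA addrAC.
Qed.

Lemma delta_cup p f g s : (p < size s)%N ->
  delta (cup p f g) s = delta f (take p.+1 s) * g (drop p.+1 s)
    + (-1) ^+ p * f (take p s) * delta g (drop p s).
Proof.
case: s => [//|a s]; rewrite ltnS => sp.
rewrite delta_cons bar_delta_cup // ![take p.+1 _]/= [drop p.+1 _]/= delta_cons mulrBl.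
by rewrite /cup opprB mulrA [X in _ + X]addrC addrA.
Qed.


(** * Chains and the pairing with cochains *)

Local Notation tpow := (@tpow k R).

Lemma tpow_eval_sum n I (r : seq I) (F : I -> seq R -> k) (z : tpow n) :
  tpow_eval (fun s => \sum_(i <- r) F i s) z = \sum_(i <- r) tpow_eval (F i) z.
Proof.
elim: n F z => [|n IH] F z /=; first by rewrite mulr_suml.
apply: etrans (@tlift_sum k _ _ k^o I r
  (fun i (a : R) (t : tpow n) => tpow_eval (fun s => F i (a :: s)) t) z).
by apply: (@tlift_eq _ _ _ k^o) => a t; apply: IH.
Qed.

Lemma tpow_evalZ n c f (z : tpow n) :
  tpow_eval (fun s => c * f s) z = c * tpow_eval f z.
Proof.
elim: n f z => [|n IH] f z /=; first by rewrite mulrA.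
have fl : linear_map (fun x : k^o => c *: x) by apply/linear_map_scale/linear_map_id.
rewrite -[RHS]/(c *: (_ : k^o)) (tlift_comp _ _ fl).
by apply: (@tlift_eq _ _ _ k^o) => a t; apply: IH.
Qed.

Lemma tpow_evalD n f g (z : tpow n) :
  tpow_eval (fun s => f s + g s) z = tpow_eval f z + tpow_eval g z.
Proof.
have := tpow_eval_sum [:: true; false] (fun b : bool => if b then f else g) z.
rewrite !big_cons big_nil addr0 => <-; congr (tpow_eval _ z); apply: funext => s.
by rewrite !big_cons big_nil addr0.
Qed.

Lemma tpow_evalB n f g (z : tpow n) :
  tpow_eval (fun s => f s - g s) z = tpow_eval f z - tpow_eval g z.
Proof.
rewrite -[X in _ = _ + X]mulN1r -tpow_evalZ -tpow_evalD; congr (tpow_eval _ z).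
by apply: funext => s; rewrite mulN1r.
Qed.

Lemma tpow_eval_bilinear n f : multilinear f ->
  (forall h, multilinear h -> linear_form (fun z : tpow n => tpow_eval h z)) ->
  bilinear_map (fun (a : R) (t : tpow n) => tpow_eval (fun s => f (a :: s)) t : k^o).
Proof.
move=> fl IH; apply: bilinear_mapP => [t c a b|a]; last first.
  exact: (IH _ (multilinear_cons a fl)).
rewrite -[RHS]/(_ * _ + _) -tpow_evalZ -tpow_evalD; congr (tpow_eval _ t : k).
by apply: funext => s; apply: (fl [::]).
Qed.

Lemma tpow_eval_linear n f : multilinear f -> linear_form (fun z : tpow n => tpow_eval f z).
Proof.
elim: n f => [|n IH] f fl; first by move=> c x y /=; rewrite mulrDr mulrCA.
exact: (tlift_linear (tpow_eval_bilinear fl IH)).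
Qed.

Lemma tpow_eval_cons n f (a : R) (t : tpow n) : multilinear f ->
  tpow_eval (n := n.+1) f (a ⊗ t) = tpow_eval (fun s => f (a :: s)) t.
Proof.
move=> fl; apply: (tlift_tpure (U := k^o)); apply: tpow_eval_bilinear => //.
exact: tpow_eval_linear.
Qed.

Fixpoint tpow_of_list n (s : seq R) : tpow n :=
  if n is n'.+1 then (head 0 s) ⊗ (tpow_of_list n' (behead s)) else (1 : k).

Lemma tpow_of_list_linear n s t c a b : (size s + size t).+1 = n ->
  tpow_of_list n (s ++ (c *: a + b) :: t) =
  c *: tpow_of_list n (s ++ a :: t) + tpow_of_list n (s ++ b :: t).
Proof.
elim: s n => [|x s IH] [|n] // [sn] /=; first by rewrite tpure_linl.
by rewrite IH // tpure_linr.
Qed.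

Lemma tpow_eval_list n f s : multilinear f -> size s = n ->
  tpow_eval f (tpow_of_list n s) = f s.
Proof.
elim: n f s => [|n IH] f [|a s] // fl; first by rewrite /= mulr1.
move=> [sn]; rewrite [tpow_of_list _ _]/= tpow_eval_cons // IH //.
exact: multilinear_cons.
Qed.

Lemma tpow_act_linear n r : linear_map (tpow_act aug (n := n) r).
Proof.
case: n => [|n]; first by move=> c x y /=; rewrite mulrDr mulrCA.
by apply: tlift_linear; linear_tac.
Qed.

Lemma tpow_act_linearl n (t : tpow n) : linear_map (fun r => tpow_act aug r t).
Proof.
case: n t => [|n] t; first by move=> c x y /=; rewrite linearP mulrDl -mulrA.
by apply: linear_map_tlift => v w; linear_tac.
Qed.

Lemma bar_diff_bilinear n : linear_map (bar_diff aug (n := n)) ->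
  bilinear_map (fun r (t : tpow n.+1) => tpow_act aug r t - r ⊗ bar_diff aug t).
Proof.
move=> bl; apply: bilinear_mapP => [t c a b|a c t u].
  by rewrite tpow_act_linearl tpure_linl scalerBr opprD addrACA.
by rewrite tpow_act_linear bl tpure_linr scalerBr opprD addrACA.
Qed.

Lemma bar_diff_linear n : linear_map (bar_diff aug (n := n)).
Proof.
elim: n => [|n IH]; last exact/tlift_linear/bar_diff_bilinear.
apply: tlift_linear; apply: bilinear_mapP => [t|r].
  exact: (@tpow_act_linearl 0 t).
exact: (@tpow_act_linear 0 r).
Qed.

Lemma bar_diff_cons n a (t : tpow n.+1) :
  bar_diff aug (n := n.+1) (a ⊗ t) = tpow_act aug a t - a ⊗ bar_diff aug t.
Proof. by apply: tlift_tpure; apply/bar_diff_bilinear/bar_diff_linear. Qed.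

Lemma tpow_eval_bar_diff n f (z : tpow n.+1) : multilinear f ->
  tpow_eval f (bar_diff aug z) = tpow_eval (bar_delta f) z.
Proof.
elim: n f z => [|n IH] f z fl.
  have fle := tpow_eval_linear (n := 0) fl.
  have ble := tpow_eval_linear (n := 1) (bar_delta_multilinear fl).
  apply: (@eq_tens_forms k R (tpow 0) (fun z => tpow_eval f (bar_diff aug (n := 0) z))
    (fun z => tpow_eval (n := 1) (bar_delta f) z)) => // [|a c].
    apply: (linear_map_comp (f := tpow_eval f : tpow 0 -> k^o)) => //.
    exact: (@bar_diff_linear 0).
  rewrite tpow_eval_cons; last exact: bar_delta_multilinear.
  rewrite /= tlift_tpure /= ?bar_delta1 ?mulrA ?[f _ * _]mulrC //.
  by apply: bilinear_mapP => [t|r]; [apply: (@tpow_act_linearl 0 t)|apply: (@tpow_act_linear 0 r)].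
have fle := tpow_eval_linear (n := n.+1) fl.
have ble := tpow_eval_linear (n := n.+2) (bar_delta_multilinear fl).
apply: (@eq_tens_forms k R (tpow n.+1) (fun z => tpow_eval f (bar_diff aug (n := n.+1) z))
  (fun z => tpow_eval (n := n.+2) (bar_delta f) z)) => // [|a t].
  apply: (linear_map_comp (f := tpow_eval f : tpow n.+1 -> k^o)) => //.
  exact: (@bar_diff_linear n.+1).
have fal := multilinear_cons a fl.
have bal := multilinear_cons a (bar_delta_multilinear fl).
have bl := tpow_eval_linear (n := n.+1) bal.
rewrite tpow_eval_cons; last exact: bar_delta_multilinear.
rewrite bar_diff_cons -scaleN1r addrC fle mulN1r tpow_eval_cons // IH // addrC.
have bfl := tpow_eval_linear (n := n.+1) (bar_delta_multilinear fal).
apply: (@eq_tens_forms k R (tpow n) (fun t => tpow_eval (n := n.+1) f (tpow_act aug (n := n.+1) a t)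
  - tpow_eval (n := n.+1) (bar_delta (fun s => f (a :: s))) t)
  (fun t => tpow_eval (n := n.+1) (fun s => bar_delta f (a :: s)) t)) => // [c u v|b u].
  by rewrite tpow_act_linear fle bfl mulrBr opprD addrACA.
rewrite [tpow_act _ _ _]tlift_tpure; last by linear_tac.
rewrite !tpow_eval_cons //; last exact: bar_delta_multilinear.
rewrite -tpow_evalB; congr tpow_eval.
Qed.

(** The coboundary is dual to the differential of the complex computing Tor. *)
Lemma tpow_eval_tor_diff n f (z : tpow n.+1) : multilinear f ->
  tpow_eval f (tor_diff aug z) = tpow_eval (delta f) z.
Proof.
move=> fl; have fle := tpow_eval_linear (n := n) fl.
rewrite /tor_diff -scaleN1r addrC fle mulN1r addrC tpow_eval_bar_diff //.
rewrite (tlift_form _ _ fle).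
suff -> : tpow_eval (delta f) z =
    tlift (fun r x => α r * tpow_eval f x : k^o) z - tpow_eval (bar_delta f) z.
  by congr (_ - _); apply: (@tlift_eq _ _ _ k^o) => r x; rewrite linear_formZ.
apply/eqP; rewrite -subr_eq opprK -tpow_evalD; apply/eqP.
apply: (@tlift_eq _ _ _ k^o) => r x; rewrite -tpow_evalZ; congr (tpow_eval _ x).
by apply: funext => s; rewrite delta_cons subrK.
Qed.

End Cochains.

Arguments bar_delta : simpl never.
Arguments delta : simpl never.

Section Coboundaries.
Variables (k : fieldType) (R : algType k) (aug : {lrmorphism R -> k^o}).
Implicit Types (f g : seq R -> k) (s : seq R).
Local Notation delta := (delta aug).
Local Notation tpow := (@tpow k R).

Lemma eq_tpow_forms n (F G : tpow n -> k) : linear_form F -> linear_form G ->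
  (forall s, size s = n -> F (tpow_of_list n s) = G (tpow_of_list n s)) -> F =1 G.
Proof.
elim: n F G => [|n IH] F G Fl Gl FG.
  move=> z; rewrite -[z]mulr1 -[_ * _]/(z *: (1 : k^o)) (linear_formZ Fl) (linear_formZ Gl).
  by rewrite (FG [::]).
apply: (@eq_tens_forms k R (tpow n) F G Fl Gl) => a t.
apply: (IH (fun t => F (a ⊗ t)) (fun t => G (a ⊗ t))) => [||s sn].
- by move=> c x y; rewrite tpure_linr Fl.
- by move=> c x y; rewrite tpure_linr Gl.
by apply: (FG (a :: s)); rewrite /= sn.
Qed.

Definition coboundary n f : Prop :=
  if n is m.+1 then exists2 h, ncochain m h & f =1 delta h else f =1 fun=> 0.

Lemma coboundary_delta n m h : n = m.+1 -> ncochain m h -> coboundary n (delta h).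
Proof. by move=> -> hm; exists h. Qed.

Lemma coboundary0 n : coboundary n (fun=> 0).
Proof. by case: n => // n; exists (fun=> 0); [exact: ncochain0|move=> s; rewrite delta0]. Qed.

Lemma coboundary_comb n c f g : coboundary n f -> coboundary n g ->
  coboundary n (fun s => c * f s + g s).
Proof.
case: n => [f0 g0 s|n [h hn fE] [h' hn' gE]]; first by rewrite f0 g0 mulr0 addr0.
exists (fun s => c * h s + h' s); first exact: ncochain_comb.
by move=> s; rewrite fE gE delta_comb.
Qed.

Lemma eq_coboundary n f g : f =1 g -> coboundary n f -> coboundary n g.
Proof. by move=> /funext ->. Qed.

Lemma coboundary_eval n f (z : tpow n) : coboundary n f -> tor_diff aug z = 0 ->
  tpow_eval f z = 0.
Proof.
case: n z => [z f0 _|n z [h [h0 hl] /funext->] z0].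
  by rewrite /= f0 mul0r.
by rewrite -tpow_eval_tor_diff // z0 (linear_form0 (tpow_eval_linear hl)).
Qed.

(** A form on chains that vanishes on the cycles factors through the
    differential; the quotient by a graph extends the resulting form from the
    boundaries to all chains. *)
Lemma coboundary_of_eval n f : ncochain n f ->
  (forall z : tpow n, tor_diff aug z = 0 -> tpow_eval f z = 0) -> coboundary n f.
Proof.
case: n => [|n] [f0 fl] fz.
  move=> [|a s]; last exact: f0.
  by have /= := fz (1 : k) erefl; rewrite mulr1.
have fle := tpow_eval_linear (n := n.+1) fl.
have tdl : linear_map (tor_diff aug (n := n.+1)).
  have bl : linear_map (bar_diff aug (n := n)) by apply: bar_diff_linear.
  have al : bilinear_map (fun (r : R) (x : tpow n) => (aug r : k) *: x) by linear_tac.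
  move=> c x y; rewrite /tor_diff bl (tlift_linear al) scalerBr opprD.
  by rewrite addrACA.
pose V : lmodType k := (tpow n * k^o)%type.
pose W (v : V) := exists z : tpow n.+1, v = (tor_diff aug z, - tpow_eval f z).
have Ws : subspace W.
  split=> [|c _ _ [z ->] [y ->]].
    by exists 0; rewrite (linear_map0 tdl) (linear_form0 fle) oppr0.
  exists (c *: z + y); rewrite tdl fle opprD -mulrN.
  by [].
have nW : ~ W (0, 1).
  move=> [z zE]; have /esym/fz fz0 : 0 = tor_diff aug z := congr1 fst zE.
  have /eqP : 1 = - tpow_eval f z := congr1 snd zE.
  by rewrite fz0 oppr0 oner_eq0.
have [p [pl pW p1]] := separating_form_mod Ws nW.
have ql : linear_form (fun v : tpow n => p (v, 0)).
  move=> c x y; rewrite -pl; congr p; congr pair.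
  by rewrite [RHS]addr0 [RHS]mulr0.
have qE (z : tpow n.+1) : p (tor_diff aug z, 0) = tpow_eval f z.
  have -> : (tor_diff aug z, 0) = ((tor_diff aug z, - tpow_eval f z) : V) +
      tpow_eval f z *: ((0, 1) : V).
    have E (c : k) (t : tpow n) : t = t + c *: 0 by rewrite scaler0 addr0.
    congr pair; first exact: E.
    have E' (c : k) : 0 = - c + c * 1 by rewrite mulr1 addNr.
    exact: E'.
  rewrite linear_formD // linear_formZ // p1 mulr1 pW ?add0r //.
  by exists z.
pose h s := if size s == n then p (tpow_of_list n s, 0) else 0.
have hn : ncochain n h.
  split=> [s|s t c a b]; first by rewrite /h => /eqP/negPf->.
  rewrite /h !size_cat /=; case: eqP => [sn|_]; last by rewrite mulr0 addr0.
  by rewrite tpow_of_list_linear ?ql // -sn addnS.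
have hE : forall z : tpow n, tpow_eval h z = p (z, 0).
  apply: eq_tpow_forms => // [|s sn]; first exact: tpow_eval_linear hn.2.
  by rewrite (tpow_eval_list hn.2 sn) /h sn eqxx.
exists h => // s; have [sn|sn] := eqVneq (size s) n.+1; last first.
  by rewrite f0 ?(delta_ncochain aug hn).1 //; apply/eqP.
rewrite -(tpow_eval_list (n := n.+1) fl sn) -(tpow_eval_list (n := n.+1) _ sn); last first.
  exact: (delta_ncochain aug hn).2.
by rewrite -tpow_eval_tor_diff ?hE ?qE //; apply: hn.2.
Qed.

Lemma cup_cocycle p q f g : ncochain p f -> ncochain q g -> delta f =1 (fun=> 0) ->
  delta g =1 (fun=> 0) -> delta (cup p f g) =1 fun=> 0.
Proof.
move=> fp gq f0 g0 s.
have [sp|sp] := ltnP p (size s); first by rewrite delta_cup // f0 g0 mul0r mulr0 addr0.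
apply: (delta_ncochain aug (cup_ncochain fp gq)).1 => E.
by rewrite E ltnNge leq_addr in sp.
Qed.

Lemma cup_coboundaryl p q f g : coboundary p f -> ncochain q g -> delta g =1 (fun=> 0) ->
  coboundary (p + q) (cup p f g).
Proof.
case: p => [|p] fb gq g0.
  by apply: eq_coboundary (coboundary0 _) => s; rewrite /cup fb mul0r.
have [h hp fE] := fb.
exists (cup p h g) => [|s]; first exact: cup_ncochain.
have [sp|sp] := ltnP p (size s).
  by rewrite delta_cup // g0 mulr0 addr0 -fE.
have hg := delta_ncochain aug (cup_ncochain hp gq).
rewrite hg.1 => [|E]; last by rewrite E ltnNge leq_addr in sp.
rewrite /cup fE (delta_ncochain aug hp).1 ?mul0r // size_take ltnNge (leqW sp) /= => E.
by rewrite E ltnn in sp.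
Qed.

Lemma cup_coboundaryr p q f g : ncochain p f -> delta f =1 (fun=> 0) -> coboundary q g ->
  coboundary (p + q) (cup p f g).
Proof.
case: q => [|q] fp f0 gb.
  by apply: eq_coboundary (coboundary0 _) => s; rewrite /cup gb mulr0.
have [h hq gE] := gb.
pose h' s := (-1) ^+ p * cup p f h s.
have hm : ncochain (p + q) h' by apply/ncochainZ/cup_ncochain.
apply: (@eq_coboundary _ (delta h')); last exact: coboundary_delta (addnS p q) hm.
move=> s; rewrite deltaZ; have [sp|sp] := ltnP p (size s).
  by rewrite delta_cup // f0 mul0r add0r !mulrA -expr2 sqrr_sign mul1r /cup gE.
rewrite (delta_ncochain aug (cup_ncochain fp hq)).1 ?mulr0.
  have [sp'|sp'] := eqVneq (size s) p.
    rewrite /cup gE (delta_ncochain aug hq).1 ?mulr0 // size_drop sp' subnn //.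
  rewrite /cup fp.1 ?mul0r // size_take ltnNge sp /=; exact/eqP.
by move=> E; rewrite E ltnNge leq_addr in sp.
Qed.

End Coboundaries.

(** * The Yoneda algebra in terms of scalar cochains *)

Section Yoneda.
Variables (k : fieldType) (R : algType k) (g : connected_grading R).
Local Notation aug := (gr_aug g).
Local Notation delta := (delta aug).
Local Notation coboundary := (coboundary aug).
Local Notation kM := (triv aug).
Implicit Types (f h : seq R -> k) (s : seq R).

Definition rep_cochain n (x : yoneda g n) : seq R -> k := fun s => ext_rep x s (1 : k).

Definition cochain_of f : cochain_fun kM kM := fun s m => (m : k) * f s.

Definition cochain_class n f : yoneda g n := ext_class n (cochain_of f).

Lemma bar_delta_bar_merge f a s :
  bar_delta aug f (a :: s) =
    \sum_(i < size s) (-1) ^+ i * f (bar_merge i (a :: s))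
    + (-1) ^+ size s * ((aug (last a s) : k) * f (belast a s)).
Proof.
elim: s f a => [|b s IH] f a; first by rewrite big_ord0 add0r mul1r.
rewrite bar_delta2 IH [size (b :: s)]/= big_ord_recl expr0 mul1r opprD addrA.
congr (_ + _ + _); last by rewrite exprS mulN1r !mulNr.
  by rewrite /bar_merge /= drop0.
rewrite -sumrN; apply: eq_bigr => i _.
by rewrite /bar_merge /bump /= ?add1n exprS mulN1r !mulNr.
Qed.

Lemma cobound_cochain_of f : cobound (cochain_of f) = cochain_of (delta f).
Proof.
apply/funext => -[|a s]; apply/funext => m; first by rewrite /cochain_of mulr0.
have auX i : aug ((-1) ^+ i) = (-1) ^+ i :> k.
  by rewrite rmorphXn rmorphN rmorph1.
rewrite /cobound /cochain_of delta_cons bar_delta_bar_merge.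
rewrite [LHS](_ : _ = (aug a : k) * (m * f s)
  + \sum_(i < size s) (aug ((-1) ^+ i.+1) : k) * (m * f (bar_merge i (a :: s)))
  + (aug ((-1) ^+ (size s).+1) : k) * ((aug (last a s) : k) * m * f (belast a s))) //.
rewrite auX mulrBr mulrDr opprD addrA; congr (_ + _ + _).
- by rewrite mulrCA.
- rewrite mulr_sumr -sumrN; apply: eq_bigr => i _.
  by rewrite auX exprS mulN1r mulNr mulrCA.
by rewrite exprS mulN1r mulNr [_ * m]mulrC -mulrA mulrCA.
Qed.

Lemma triv_scale (c : k) (x : restr kM) : c *: x = c * (x : k) :> k.
Proof.
have augc : (aug c%:A : k) = c by rewrite linearZ /= rmorph1; apply: mulr1.
by rewrite [LHS](_ : _ = (aug c%:A : k) * (x : k)) // augc.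
Qed.

Lemma cochain_of_cochain n f : ncochain n f -> cochain n (cochain_of f).
Proof.
move=> [f0 fl]; split=> [s m sn|s t c a b m|s c m m'].
- by rewrite /cochain_of f0 // mulr0.
- rewrite [RHS](_ : _ = c * ((m : k) * f (s ++ a :: t)) + (m : k) * f (s ++ b :: t)).
    by rewrite /cochain_of fl mulrDr mulrCA.
  by congr (_ + _); apply: triv_scale.
rewrite [RHS](_ : _ = c * ((m : k) * f s) + (m' : k) * f s).
  rewrite /cochain_of [X in X * _ = _](_ : _ = c * m + m' :> k) ?mulrDl ?mulrA //.
  by congr (_ + _); apply: triv_scale.
by congr (_ + _); apply: triv_scale.
Qed.

Lemma cochain_scalar n (F : cochain_fun kM kM) : cochain n F ->
  F = cochain_of (fun s => F s (1 : k)).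
Proof.
move=> [F0 Fl Fm]; apply/funext => s; apply/funext => m.
have Fm0 : F s 0 = 0.
  have := Fm s (-1) 0 0; rewrite scaler0 addr0 scaleN1r => ->; exact: addNr.
have := Fm s (m : k) (1 : k) 0; rewrite Fm0 [RHS]addr0.
rewrite [X in F s X = _](_ : _ = m); first by move=> ->; apply: triv_scale.
by rewrite addr0; apply: etrans (triv_scale _ _) _; rewrite mulr1.
Qed.

Lemma rep_cochainP n (x : yoneda g n) :
  ncochain n (rep_cochain x) /\ delta (rep_cochain x) =1 fun=> 0.
Proof.
have := valP (repr (x : quotsp _) : cocycle kM kM n).
rewrite -/(ext_rep x) => /asboolP[Fc Fd].
have FE := cochain_scalar Fc; split; last first.
  move=> s; have <- : cobound (ext_rep x) s (1 : k) = delta (rep_cochain x) s.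
    by rewrite {1}FE cobound_cochain_of /cochain_of mul1r.
  by rewrite Fd.
have [F0 Fl _] := Fc; split=> [s sn|s t c a b]; first exact: F0.
by rewrite /rep_cochain Fl; congr (_ + _); apply: triv_scale.
Qed.

Lemma cochain_class_rep n f : ncochain n f -> delta f =1 (fun=> 0) ->
  val (insubd (0 : cocycle kM kM n) (cochain_of f)) = cochain_of f.
Proof.
move=> fn f0; apply: insubdK; apply/asboolP; split; first exact: cochain_of_cochain.
rewrite cobound_cochain_of; apply/funext => s; apply/funext => m.
by rewrite /cochain_of f0 mulr0.
Qed.

Lemma coboundaries_coboundary n (z : cocycle kM kM n) :
  z \in @coboundaries _ _ kM kM n <-> coboundary n (fun s => val z s (1 : k)).
Proof.
split=> [/asboolP|].
  case: n z => [|n] z; first by move=> -> s.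
  move=> [h hn zE]; have [hc _ _] := hn; have hE := cochain_scalar hn.
  exists (fun s => h s (1 : k)); last first.
    by move=> s; rewrite zE {1}hE cobound_cochain_of /cochain_of mul1r.
  have [h0 hl _] := hn; split=> [s sn|s t c a b]; first exact: h0.
  by rewrite hl; congr (_ + _); apply: triv_scale.
have /asboolP[zc _] := valP z; have zE := cochain_scalar zc.
move=> zb; apply/asboolP; case: n z zc zE zb => [|n] z zc zE.
  move=> z0; rewrite zE; apply/funext => s; apply/funext => m.
  by rewrite /cochain_of z0 mulr0.
move=> [h hn hE]; exists (cochain_of h); first exact: cochain_of_cochain.
by rewrite zE cobound_cochain_of; congr cochain_of; apply/funext.
Qed.

Lemma yoneda_pi n (z z' : cocycle kM kM n) :
  \pi_(quotsp (@coboundaries _ _ kM kM n)) z = \pi z' <->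
  coboundary n (fun s => (val z s (1 : k) : k) - (val z' s (1 : k) : k)).
Proof.
split=> [/eqP|zz'].
  rewrite quotsp_eq => /coboundaries_coboundary; apply: eq_coboundary => s.
  by rewrite raddfB.
apply/eqP; rewrite quotsp_eq; apply/coboundaries_coboundary; apply: eq_coboundary zz' => s.
by rewrite raddfB.
Qed.

Lemma yoneda_eq n (x y : yoneda g n) :
  coboundary n (fun s => rep_cochain x s - rep_cochain y s) -> x = y.
Proof.
move=> xy; rewrite -[x](@reprK _ (quotsp _)) -[y](@reprK _ (quotsp _)).
exact/yoneda_pi.
Qed.

Lemma rep_cochain_class n f : ncochain n f -> delta f =1 (fun=> 0) ->
  coboundary n (fun s => rep_cochain (cochain_class n f) s - f s).
Proof.
move=> fn f0; have := cochain_class_rep fn f0; set z := insubd _ _ => zE.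
have /yoneda_pi : \pi_(quotsp (@coboundaries _ _ kM kM n))
    (repr (cochain_class n f : quotsp _)) = \pi z.
  by rewrite reprK.
by apply: eq_coboundary => s; rewrite zE /cochain_of mul1r.
Qed.

Lemma rep_cochain_comb n c (x y : yoneda g n) :
  coboundary n (fun s => rep_cochain (c *: x + y) s - (c * rep_cochain x s + rep_cochain y s)).
Proof.
have /yoneda_pi : \pi_(quotsp (@coboundaries _ _ kM kM n))
    (repr (c *: x + y : quotsp _)) =
    \pi_(quotsp (@coboundaries _ _ kM kM n)) (c *: repr (x : quotsp _) + repr (y : quotsp _)).
  rewrite reprK -quotsp_add_pi -quotsp_scale_pi !reprK //.
apply: eq_coboundary => s; rewrite linearP; congr (_ - _).
by congr (_ + _); apply: triv_scale.
Qed.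

Lemma ext_comp_class p q (x : yoneda g p) (y : yoneda g q) :
  ext_comp x y = cochain_class (p + q) (cup p (rep_cochain x) (rep_cochain y)).
Proof.
rewrite /ext_comp /cochain_class; congr ext_class; apply/funext => s; apply/funext => m.
have coE n (w : yoneda g n) s' (m' : k) : ext_rep w s' m' = m' * rep_cochain w s' :> k.
  have /asboolP[Fc _] := valP (repr (w : quotsp _) : cocycle kM kM n).
  by rewrite /rep_cochain {1}/ext_rep (cochain_scalar Fc).
by rewrite coE (coE _ y) /cochain_of /cup -mulrA [rep_cochain y _ * _]mulrC.
Qed.

End Yoneda.

(** * The coaction on cochains *)

Section CochainCoaction.
Variables (k : fieldType) (R : algType k) (g : connected_grading R).
Variables (H : algType k) (hH : hopf_structure H) (rho : coaction hH R).
Local Notation aug := (gr_aug g).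
Local Notation delta := (delta aug).
Local Notation bar_delta := (bar_delta aug).
Local Notation coboundary := (coboundary aug).
Local Notation Δ := (comul hH).
Local Notation ε := (counit hH).
Local Notation ρ := (coact rho).
Local Notation tpow := (@tpow k R).
Implicit Types (f : seq R -> k) (s : seq R) (p q : H -> k).

(** The cochain s |-> f (s_(0)) p (s_(1)), where s_(1) is the product of the
    components in H of the entries of s.  With the form p, scalar cochains are
    enough to speak of cochains with values in H. *)
Fixpoint twist f p s : k :=
  if s is r :: s' then
    tlift (fun r0 r1 => twist (fun u => f (r0 :: u)) (fun h => p (r1 * h)) s' : k^o) (ρ r)
  else f [::] * p 1.

Lemma twist_suml I (r : seq I) (F : I -> seq R -> k) p s :
  twist (fun u => \sum_(i <- r) F i u) p s = \sum_(i <- r) twist (F i) p s.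
Proof.
elim: s F p => [|a s IH] F p /=; first by rewrite mulr_suml.
apply: etrans (@tlift_sum k _ _ k^o I r (fun i (r0 : R) (r1 : H) =>
  twist (fun u => F i (r0 :: u)) (fun h => p (r1 * h)) s) _).
by apply: (@tlift_eq _ _ _ k^o) => r0 r1; apply: IH.
Qed.

Lemma twist_sumr I (r : seq I) (P : I -> H -> k) f s :
  twist f (fun h => \sum_(i <- r) P i h) s = \sum_(i <- r) twist f (P i) s.
Proof.
elim: s f P => [|a s IH] f P /=; first by rewrite mulr_sumr.
apply: etrans (@tlift_sum k _ _ k^o I r (fun i (r0 : R) (r1 : H) =>
  twist (fun u => f (r0 :: u)) (fun h => P i (r1 * h)) s) _).
by apply: (@tlift_eq _ _ _ k^o) => r0 r1; apply: (IH _ (fun i h => P i (r1 * h))).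
Qed.

Lemma twistZl c f p s : twist (fun u => c * f u) p s = c * twist f p s.
Proof.
elim: s f p => [|a s IH] f p /=; first by rewrite mulrA.
have fl : linear_map (fun x : k^o => c *: x) by apply/linear_map_scale/linear_map_id.
rewrite -[RHS]/(c *: (_ : k^o)) (tlift_comp _ _ fl).
by apply: (@tlift_eq _ _ _ k^o) => r0 r1; apply: IH.
Qed.

Lemma twistZr c f p s : twist f (fun h => c * p h) s = c * twist f p s.
Proof.
elim: s f p => [|a s IH] f p /=; first by rewrite mulrCA.
have fl : linear_map (fun x : k^o => c *: x) by apply/linear_map_scale/linear_map_id.
rewrite -[RHS]/(c *: (_ : k^o)) (tlift_comp _ _ fl).
by apply: (@tlift_eq _ _ _ k^o) => r0 r1; apply: (IH _ (fun h => p (r1 * h))).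
Qed.

Lemma twist_combl c f f' p s :
  twist (fun u => c * f u + f' u) p s = c * twist f p s + twist f' p s.
Proof.
have := twist_suml [:: true; false] (fun (b : bool) u => if b then c * f u else f' u) p s.
rewrite !big_cons big_nil addr0 twistZl => <-; congr twist; apply: funext => u.
by rewrite !big_cons big_nil addr0.
Qed.

Lemma twist_combr c p p' f s :
  twist f (fun h => c * p h + p' h) s = c * twist f p s + twist f p' s.
Proof.
have := twist_sumr [:: true; false] (fun (b : bool) u => if b then c * p u else p' u) f s.
rewrite !big_cons big_nil addr0 twistZr => <-; congr twist; apply: funext => u.
by rewrite !big_cons big_nil addr0.
Qed.

Lemma twist_tliftl (V W : lmodType k) (F : V -> W -> seq R -> k) t p s :
  twist (fun u => tlift (fun v w => F v w u : k^o) t) p s =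
  tlift (fun v w => twist (F v w) p s : k^o) t.
Proof. exact: twist_suml. Qed.

Lemma twist_tliftr (V W : lmodType k) (P : V -> W -> H -> k) t f s :
  twist f (fun h => tlift (fun v w => P v w h : k^o) t) s =
  tlift (fun v w => twist f (P v w) s : k^o) t.
Proof. exact: twist_sumr. Qed.

Lemma linear_form_mulr p h : linear_form p -> linear_form (fun x => p (h * x)).
Proof. by move=> pl c x y; rewrite mulrDr -scalerAr pl. Qed.

Lemma linear_form_mull p h : linear_form p -> linear_form (fun x => p (x * h)).
Proof. by move=> pl c x y; rewrite mulrDl -scalerAl pl. Qed.

Lemma twist_linear_mul p f s : linear_form p ->
  linear_form (fun h => twist f (fun x => p (h * x)) s).
Proof.
move=> pl c x y; rewrite -twist_combr; congr twist; apply: funext => h.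
by rewrite mulrDl -scalerAl pl.
Qed.

Lemma twist_bilinear f p s : multilinear f -> linear_form p ->
  bilinear_map (fun r0 r1 => twist (fun u => f (r0 :: u)) (fun h => p (r1 * h)) s : k^o).
Proof.
move=> fl pl; apply: bilinear_mapP => [r1 c a b|r0]; last exact: twist_linear_mul.
rewrite -[RHS]/(_ * _ + _) -twist_combl; congr (twist _ _ s : k).
by apply: funext => u; apply: (fl [::]).
Qed.

Lemma twist_multilinear f p : multilinear f -> linear_form p -> multilinear (twist f p).
Proof.
move=> fl pl s; elim: s f p fl pl => [|x s IH] f p fl pl t c a b /=.
  have bl := twist_bilinear t fl pl.
  by rewrite linearP (tlift_linear bl).
apply: etrans (@tlift_comb k _ _ k^o c
  (fun (r0 : R) (r1 : H) => twist (fun u => f (r0 :: u)) (fun h => p (r1 * h)) (s ++ a :: t))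
  (fun (r0 : R) (r1 : H) => twist (fun u => f (r0 :: u)) (fun h => p (r1 * h)) (s ++ b :: t))
  (ρ x)).
apply: (@tlift_eq _ _ _ k^o) => r0 r1; apply: IH; first exact: multilinear_cons.
exact: linear_form_mulr.
Qed.

Lemma twist_supported n f p : supported n f -> supported n (twist f p).
Proof.
move=> f0 s; elim: s n f p f0 => [|a s IH] n f p f0 sn /=.
  by rewrite f0 ?mul0r.
case: n f0 sn => [|n] f0 sn.
  apply: etrans (_ : tlift (fun _ _ => 0 : k^o) (ρ a) = 0); last by rewrite /tlift /bilin_sum big1.
  apply: (@tlift_eq _ _ _ k^o) => r0 r1.
  rewrite (_ : (fun u => _) = fun u => 0 * 0); last by apply: funext => u; rewrite f0 ?mul0r.
  by rewrite (twistZl 0 (fun=> 0)) mul0r.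
apply: etrans (_ : tlift (fun _ _ => 0 : k^o) (ρ a) = 0); last by rewrite /tlift /bilin_sum big1.
apply: (@tlift_eq _ _ _ k^o) => r0 r1; apply: (IH n).
  by move=> u un; apply: f0 => -[].
by move=> E; apply: sn; rewrite /= E.
Qed.

Lemma twist_ncochain n f p : ncochain n f -> linear_form p -> ncochain n (twist f p).
Proof.
move=> [f0 fl] pl; split; [exact: twist_supported|exact: twist_multilinear].
Qed.

Hypothesis rho_graded : preserves_grading g rho.

(** The coaction preserves each R_n, and the augmentation is the projection to
    R_0, where the coaction is trivial. *)
Lemma coact_aug r : tlift (fun r0 r1 => (aug r0 : k) *: r1) (ρ r) = (aug r : k) *: 1.
Proof.
have bl : bilinear_map (fun (r0 : R) (r1 : H) => (aug r0 : k) *: r1) by linear_tac.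
have ll : linear_map (fun r => tlift (fun r0 r1 => (aug r0 : k) *: r1) (ρ r)).
  by apply: linear_map_tlift_arg => //; apply: bundled_linear.
have rl : linear_map (fun r => (aug r : k) *: (1 : H)) by linear_tac.
have aug0 n x : homog g n.+1 x -> (aug x : k) = 0.
  move=> xn; have := gr_degree0 g x; rewrite -{1}xn gr_projK /=.
  by move=> /esym/eqP; rewrite scaler_eq0 oner_eq0 orbF => /eqP.
have [N {1 2}->] := gr_sum g r; rewrite (linear_map_sum ll) (linear_map_sum rl).
apply: eq_bigr => i _; move: (nat_of_ord i) => {}i.
have ri : homog g i (gr_proj g i r) by rewrite /homog gr_projK eqxx.
move: (gr_proj g i r) ri => {}r ri.
case: i ri => [|i] ri.
  have -> : r = (aug r : k) *: 1 by rewrite -gr_degree0.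
  rewrite (linear_mapZ ll) (linear_mapZ rl) rmorph1 [1 in LHS](_ : _ = 1 ⊗ 1) //.
  by rewrite tlift_tpure // rmorph1 scale1r.
rewrite (aug0 i) // scale0r; have [t [tP ->]] := rho_graded ri.
rewrite (linear_map_sum (tlift_linear bl)) big_seq big1 // => q /tP[qi _].
by rewrite tlift_tpure // (aug0 i) // scale0r.
Qed.

(** The coaction is multiplicative and respects the augmentation, so that it
    commutes with every face map of the bar complex. *)
Lemma bar_delta_twist f p s : multilinear f -> linear_form p ->
  bar_delta (twist f p) s = twist (bar_delta f) p s.
Proof.
elim: s f p => [|a [|b s] IH] f p fl pl; first by rewrite /= /bar_delta mul0r.
  rewrite bar_delta1 /=.
  have Pl : linear_form (fun h => f [::] * p h).
    by move=> c x y; rewrite pl mulrDr mulrCA.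
  transitivity (f [::] * p ((aug a : k) *: 1)).
    by rewrite linear_formZ // mulrCA.
  rewrite -coact_aug; apply: etrans (tlift_form _ _ Pl) _.
  apply: (@tlift_eq _ _ _ k^o) => r0 r1.
  by rewrite bar_delta1 linear_formZ // mulr1 mulrCA mulrA.
rewrite bar_delta2.
have -> : twist f p (a * b :: s) = tlift (fun a0 a1 => tlift (fun b0 b1 =>
    twist (fun u => f (a0 * b0 :: u)) (fun h => p (a1 * (b1 * h))) s : k^o) (ρ b)) (ρ a).
  rewrite /= rmorphM tlift_mul; last exact: twist_bilinear.
  apply: (@tlift_eq _ _ _ k^o) => a0 a1; apply: (@tlift_eq _ _ _ k^o) => b0 b1.
  by congr (twist _ _ s : k); apply: funext => h; rewrite mulrA.
have -> : bar_delta (fun v => twist f p (a :: v)) (b :: s) = tlift (fun a0 a1 =>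
    twist (bar_delta (fun u => f (a0 :: u))) (fun h => p (a1 * h)) (b :: s) : k^o) (ρ a).
  rewrite [LHS]bar_delta_sum; apply: eq_bigr => q _; apply: IH.
    exact: multilinear_cons.
  exact: linear_form_mulr.
rewrite -[LHS]addrC -mulN1r.
rewrite -[LHS](@tlift_comb k R H k^o (-1)).
apply: (@tlift_eq _ _ _ k^o) => a0 a1 /=.
rewrite -[LHS](@tlift_comb k R H k^o (-1)).
apply: (@tlift_eq _ _ _ k^o) => b0 b1 /=.
rewrite -[LHS]/(_ * _ + _) -twist_combl; congr twist; apply: funext => u.
by rewrite bar_delta2 mulN1r addrC.
Qed.

Lemma delta_twist f p s : multilinear f -> linear_form p ->
  delta (twist f p) s = twist (delta f) p s.
Proof.
move=> fl pl; case: s => [|a s]; first by rewrite /= mul0r.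
rewrite delta_cons bar_delta_twist // addrC -mulN1r /=.
have Pl := twist_linear_mul f s pl.
have -> : (aug a : k) * twist f p s =
    twist f (fun h => p (((aug a : k) *: 1) * h)) s.
  by rewrite (linear_formZ Pl); congr (_ * twist _ _ _); apply: funext => h; rewrite mul1r.
rewrite -coact_aug.
have -> : twist f (fun h => p (tlift (fun r0 r1 => (aug r0 : k) *: r1) (ρ a) * h)) s =
    tlift (fun r0 r1 => twist (fun u => (aug r0 : k) * f u) (fun h => p (r1 * h)) s : k^o) (ρ a).
  apply: etrans (tlift_form _ _ Pl) _; apply: (@tlift_eq _ _ _ k^o) => r0 r1.
  by rewrite (linear_formZ Pl) twistZl.
rewrite -[LHS](@tlift_comb k R H k^o (-1)).
apply: (@tlift_eq _ _ _ k^o) => a0 a1 /=.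
rewrite -[LHS]/(_ * _ + _) -twist_combl; congr twist; apply: funext => u.
by rewrite mulN1r addrC.
Qed.

Lemma coboundary_twist n f p : linear_form p -> coboundary n f -> coboundary n (twist f p).
Proof.
move=> pl; case: n => [|n].
  move=> f0 s; have -> : f = fun=> 0 * 0 by apply: funext => u; rewrite f0 mul0r.
  by rewrite (twistZl 0 (fun=> 0)) mul0r.
move=> [h hn /funext->]; exists (twist h p); first exact: twist_ncochain.
by move=> s; rewrite delta_twist //; apply: hn.2.
Qed.

Lemma tpow_coact_bilinear n : linear_map (tpow_coact rho (n := n)) ->
  bilinear_map (fun (r : R) (t : tpow n) =>
      tlift (fun r0 r1 => tlift (fun t0 t1 => (r0 ⊗ t0) ⊗ (r1 * t1))
        (tpow_coact rho t)) (ρ r)).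
Proof. by move=> cl; linear_tac. Qed.

Lemma tpow_coact_linear n : linear_map (tpow_coact rho (n := n)).
Proof.
elim: n => [|n IH]; first exact: tpure_linl.
exact/tlift_linear/tpow_coact_bilinear.
Qed.

(** Twisting is dual to the diagonal coaction on chains. *)
Lemma tpow_eval_twist n f p (z : tpow n) : multilinear f -> linear_form p ->
  tpow_eval (twist f p) z = p (tlift (fun t h => tpow_eval f t *: h) (tpow_coact rho z)).
Proof.
have ebl m f' : multilinear f' ->
    bilinear_map (fun (t : tpow m) (h : H) => tpow_eval f' t *: h).
  move=> fl'; have fe := tpow_eval_linear (n := m) fl'.
  apply: bilinear_mapP => [h|t]; last exact/linear_map_scale/linear_map_id.
  exact: (linear_map_scalel (f := tpow_eval f' : tpow m -> k^o)).
elim: n f p z => [|n IH] f p z fl pl.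
  rewrite [tpow_coact _ _]/= tlift_tpure; last exact: ebl.
  by rewrite linear_formZ //= mulrAC.
have al := twist_multilinear fl pl.
have ael := tpow_eval_linear (n := n.+1) al.
have cl := tpow_coact_linear (n := n.+1).
have el := tlift_linear (ebl n.+1 f fl).
apply: (@eq_tens_forms k R (tpow n) (fun z => tpow_eval (n := n.+1) (twist f p) z)
  (fun z => p (tlift (fun t h => tpow_eval f t *: h) (tpow_coact rho (n := n.+1) z)))) => //.
  by move=> c x y; rewrite cl el pl.
move=> r t; rewrite tpow_eval_cons //.
have -> : tpow_eval (fun s => twist f p (r :: s)) t = tlift (fun r0 r1 =>
    tpow_eval (twist (fun u => f (r0 :: u)) (fun h => p (r1 * h))) t : k^o) (ρ r).
  exact: tpow_eval_sum.
rewrite [tpow_coact _ _]tlift_tpure; last exact/tpow_coact_bilinear/tpow_coact_linear.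
rewrite (tlift_comp _ _ el) (tlift_form _ _ pl).
apply: (@tlift_eq _ _ _ k^o) => r0 r1.
rewrite (IH _ _ _ (multilinear_cons r0 fl) (linear_form_mulr r1 pl)).
rewrite (tlift_comp _ _ el) (tlift_form _ _ pl).
apply: etrans (tlift_form _ _ (linear_form_mulr r1 pl)) _.
apply: (@tlift_eq _ _ _ k^o) => t0 t1.
rewrite tlift_tpure; last exact: ebl.
by rewrite tpow_eval_cons // -scalerAr.
Qed.

Lemma twist_counit f s : multilinear f -> twist f (fun h => ε h : k) s = f s.
Proof.
elim: s f => [|a s IH] f fl /=; first by rewrite rmorph1 mulr1.
have fl1 := multilinear_head s fl.
rewrite -[in RHS](coact_counit rho a) -/(ρ a); symmetry.
apply: etrans (tlift_form _ _ fl1) _; apply: (@tlift_eq _ _ _ k^o) => r0 r1.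
rewrite [LHS](linear_formZ fl1) -(IH _ (multilinear_cons r0 fl)).
rewrite -twistZr; congr (twist _ _ s : k); apply: funext => h.
by rewrite rmorphM.
Qed.

Definition convolve (p q : H -> k) (h : H) : k :=
  tlift (fun u v => p u * q v : k^o) (Δ h).

Lemma convolve_linear p q : linear_form p -> linear_form q ->
  linear_form (convolve p q).
Proof.
move=> pl ql c a b; rewrite /convolve linearP.
exact: (tlift_linear (form_mul_bilinear pl ql)).
Qed.

(** The coassociativity of the coaction, one entry at a time. *)
Lemma twist_twist f p q s : multilinear f -> linear_form p -> linear_form q ->
  twist (twist f p) q s = twist f (convolve p q) s.
Proof.
elim: s f p q => [|a s IH] f p q fl pl ql.
  rewrite /= /convolve rmorph1 [1 in RHS](_ : _ = 1 ⊗ 1) //.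
  rewrite (tlift_tpure (U := k^o)) ?mulrA //; exact: form_mul_bilinear.
pose T r00 r01 r1 : k^o :=
  twist (fun u => f (r00 :: u)) (convolve (fun h => p (r01 * h)) (fun h => q (r1 * h))) s.
have Tl : trilinear_map T.
  have cl r01 r1 := convolve_linear (linear_form_mulr r01 pl) (linear_form_mulr r1 ql).
  split=> [r01 r1|r00 r1|r00 r01] c x y.
  - rewrite /T -[RHS]/(_ * _ + _) -twist_combl; congr (twist _ _ s : k).
    by apply: funext => u; apply: (fl [::]).
  - rewrite /T -[RHS]/(_ * _ + _) -twist_combr; congr (twist _ _ s : k).
    apply: funext => h; rewrite /convolve.
    rewrite -[RHS](@tlift_comb k H H k^o); apply: (@tlift_eq _ _ _ k^o) => u v.
    by rewrite mulrDl -scalerAl pl mulrDl -mulrA.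
  rewrite /T -[RHS]/(_ * _ + _) -twist_combr; congr (twist _ _ s : k).
  apply: funext => h; rewrite /convolve.
  rewrite -[RHS](@tlift_comb k H H k^o); apply: (@tlift_eq _ _ _ k^o) => u v.
  by rewrite mulrDl -scalerAl ql mulrDr mulrCA.
transitivity (tlift (fun r0 r1 => tlift (fun r00 r01 => T r00 r01 r1) (ρ r0)) (ρ a) : k).
  rewrite /=; apply: (@tlift_eq _ _ _ k^o) => r0 r1.
  rewrite twist_tliftl; apply: (@tlift_eq _ _ _ k^o) => r00 r01.
  rewrite IH //; [exact: multilinear_cons|exact: linear_form_mulr|exact: linear_form_mulr].
rewrite -(tlift_tassoc_tmapl (f := ρ)) //; last exact: bundled_linear.
rewrite coactA tlift_tmapr //; last exact: bundled_linear.
apply: (@tlift_eq _ _ _ k^o) => r0 r1.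
rewrite -twist_tliftr; congr (twist _ _ s : k); apply: funext => h.
rewrite /convolve rmorphM (@tlift_mul k H H k^o) //.
exact: form_mul_bilinear.
Qed.

End CochainCoaction.

Lemma tens_expand (k : fieldType) (U V : lmodType k) n (v : 'I_n -> V)
    (f : 'I_n -> V -> k) (t : U ⊗ V) :
  (forall i, linear_form (f i)) -> (forall w, w = \sum_i f i w *: v i) ->
  t = \sum_i tlift (fun u w => f i w *: u) t ⊗ v i.
Proof.
move=> fl fv; rewrite -[LHS](tlift_map (b := fun u w => u ⊗ w) t) //.
transitivity (tlift (fun u w => \sum_i (f i w *: u) ⊗ v i) t).
  apply: tlift_eq => u w; rewrite {1}(fv w) (linear_map_sum (tpure_linr u)).
  apply: eq_bigr => i _.
  by rewrite (linear_mapZ (tpure_linr u)) (linear_mapZ (tpure_linl (v i))).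
rewrite tlift_sum; apply: eq_bigr => i _.
by rewrite (tlift_comp _ _ (tpure_linl (v i))).
Qed.

Section YonedaCoaction.
Variables (k : fieldType) (R : algType k) (g : connected_grading R).
Variables (H : algType k) (hH : hopf_structure H) (rho : coaction hH R).
Local Notation aug := (gr_aug g).
Local Notation delta := (delta aug).
Local Notation coboundary := (coboundary aug).
Local Notation Δ := (comul hH).
Local Notation ε := (counit hH).
Local Notation ρ := (coact rho).
Local Notation tpow := (@tpow k R).
Local Notation rtwist := (twist rho).
Implicit Types (f : seq R -> k) (s : seq R) (p q : H -> k).

Hypothesis rho_graded : preserves_grading g rho.
Variable rhoE : forall n, {linear yoneda g n -> tens H (yoneda g n)}.
Hypothesis rhoE_dual : dual_coaction rho rhoE.

Lemma rhoE_pairing n (x : yoneda g n) p (z : tpow n) : linear_form p ->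
  tor_diff aug z = 0 ->
  tlift (fun h y => p h * tpow_eval (rep_cochain y) z : k^o) (rhoE n x) =
  tpow_eval (rtwist (rep_cochain x) p) z.
Proof.
move=> pl z0; rewrite tpow_eval_twist //; last by case: (rep_cochainP x) => -[].
have := congr1 p (rhoE_dual x z0); rewrite (tlift_form _ _ pl) => <-.
apply: (@tlift_eq _ _ _ k^o) => h y.
by rewrite linear_formZ // mulrC.
Qed.

Lemma tor_diff_1 (r : R) : tor_diff aug (tpow_of_list (k := k) 1 [:: r]) = 0.
Proof.
rewrite /tor_diff [tpow_of_list _ _]/= tlift_tpure; last by linear_tac.
rewrite /= tlift_tpure ?subrr //=; apply: bilinear_mapP => [t|a].
  exact: (tpow_act_linearl aug (n := 0) t).
exact: (tpow_act_linear aug (n := 0) a).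
Qed.

(** Chains of degree 1 are cycles, so that on E_1 the duality that defines rhoE
    holds for all of R. *)
Lemma rhoE_pairing1 (x : yoneda g 1) p (r : R) : linear_form p ->
  tlift (fun h y => p h * rep_cochain y [:: r] : k^o) (rhoE 1 x) =
  tlift (fun r0 r1 => rep_cochain x [:: r0] * p r1 : k^o) (ρ r).
Proof.
move=> pl; have := rhoE_pairing x pl (tor_diff_1 r).
have [[_ xl] _] := rep_cochainP x.
rewrite (tpow_eval_list (n := 1)) //; last exact: twist_multilinear.
rewrite [rtwist _ _ _](_ : _ = tlift (fun r0 r1 => rep_cochain x [:: r0] * p r1 : k^o) (ρ r)).
  move=> <-; apply: (@tlift_eq _ _ _ k^o) => h y.
  by rewrite (tpow_eval_list (n := 1)) //; case: (rep_cochainP y) => -[].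
by apply: (@tlift_eq _ _ _ k^o) => r0 r1 /=; rewrite mulr1.
Qed.

Lemma tlift_eq0 (V W : lmodType k) (F : V -> W -> k) t :
  (forall v w, F v w = 0) -> tlift (fun v w => F v w : k^o) t = 0.
Proof. by move=> F0; rewrite /tlift /bilin_sum big1. Qed.

Lemma twist_cup_left (x : yoneda g 1) f p s : linear_form p ->
  rtwist (cup 1 (rep_cochain x) f) p s =
  tlift (fun h y => cup 1 (rep_cochain y) (rtwist f (fun h' => p (h * h'))) s : k^o) (rhoE 1 x).
Proof.
move=> pl; have co_nil (y : yoneda g 1) : rep_cochain y [::] = 0.
  by have [[y0 _] _] := rep_cochainP y; apply: y0.
case: s => [|r s].
  rewrite /= /cup /= co_nil !mul0r tlift_eq0 // => h y.
  by rewrite co_nil mul0r.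
have Pl := twist_linear_mul rho f s pl.
transitivity (tlift (fun h y => rtwist f (fun h' => p (h * h')) s * rep_cochain y [:: r] : k^o)
  (rhoE 1 x) : k).
  rewrite (rhoE_pairing1 x r Pl); apply: (@tlift_eq _ _ _ k^o) => r0 r1.
  rewrite -twistZl; congr (twist _ _ _ s : k); apply: funext => u.
  by rewrite /cup /= take0 drop0.
by apply: (@tlift_eq _ _ _ k^o) => h y; rewrite /cup /= take0 drop0 mulrC.
Qed.

Lemma twist_cup_right n (x : yoneda g 1) f p s : linear_form p -> size s = n.+1 ->
  rtwist (cup n f (rep_cochain x)) p s =
  tlift (fun h y => cup n (rtwist f (fun h' => p (h' * h))) (rep_cochain y) s : k^o) (rhoE 1 x).
Proof.
elim: n f p s => [|n IH] f p [|r s] // pl [sn].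
  case: s sn => // _.
  have Pl : linear_form (fun h => f [::] * p h).
    by move=> c a b; rewrite pl mulrDr mulrCA.
  transitivity (tlift (fun h y => (f [::] * p h) * rep_cochain y [:: r] : k^o) (rhoE 1 x) : k).
    rewrite (rhoE_pairing1 x r Pl); apply: (@tlift_eq _ _ _ k^o) => r0 r1.
    by rewrite /= /cup /= mulr1 mulrCA mulrA.
  by apply: (@tlift_eq _ _ _ k^o) => h y; rewrite /cup /= mul1r.
transitivity (tlift (fun r0 r1 => tlift (fun h y =>
    cup n (rtwist (fun u => f (r0 :: u)) (fun h' => p (r1 * (h' * h)))) (rep_cochain y) s : k^o)
    (rhoE 1 x)) (ρ r) : k).
  apply: (@tlift_eq _ _ _ k^o) => r0 r1.
  exact: (IH (fun u => f (r0 :: u)) _ _ (linear_form_mulr r1 pl)).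
rewrite (@tlift_exchange k R H H (yoneda g 1) k^o).
apply: (@tlift_eq _ _ _ k^o) => h y.
have fl : linear_form (fun c : k^o => (c : k) * rep_cochain y (drop n s)).
  by move=> c a b; rewrite mulrDl -mulrA.
rewrite /cup [rtwist _ _ _]/= [drop _ _]/=; symmetry.
apply: etrans (tlift_form _ _ fl) _.
apply: (@tlift_eq _ _ _ k^o) => r0 r1.
suff -> : (fun h' => p (r1 * h' * h)) = (fun h' => p (r1 * (h' * h))) by [].
by apply: funext => h'; rewrite mulrA.
Qed.

Lemma pairing_comp m n (z : tpow (m + n)) (x : yoneda g m) (y : yoneda g n) :
  tor_diff aug z = 0 ->
  tpow_eval (rep_cochain (ext_comp x y)) z = tpow_eval (cup m (rep_cochain x) (rep_cochain y)) z.
Proof.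
move=> z0; have [xm x0] := rep_cochainP x; have [ym y0] := rep_cochainP y.
apply/eqP; rewrite -subr_eq0 -tpow_evalB ext_comp_class; apply/eqP.
apply: (coboundary_eval _ z0); apply: rep_cochain_class; first exact: cup_ncochain.
exact: cup_cocycle xm ym x0 y0.
Qed.

(** The two sides have the same value on cycles, though not on all chains. *)
Lemma rhoE_twist_coboundary n (y : yoneda g n) p : linear_form p ->
  coboundary n (fun s => tlift (fun h y' => p h * rep_cochain y' s : k^o) (rhoE n y)
                     - rtwist (rep_cochain y) p s).
Proof.
move=> pl; have [ym _] := rep_cochainP y.
apply: coboundary_of_eval => [|z z0].
  apply: ncochainB; last exact: twist_ncochain.
  have M : ncochain n (fun s => \sum_(q <- repr (rhoE n y)) p q.1 * rep_cochain q.2 s).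
    by apply: ncochain_sum => q; case: (rep_cochainP q.2).
  exact M.
rewrite tpow_evalB -rhoE_pairing //.
suff -> : tpow_eval (fun s => tlift (fun h y' => p h * rep_cochain y' s : k^o) (rhoE n y)) z =
    tlift (fun h y' => p h * tpow_eval (rep_cochain y') z : k^o) (rhoE n y) by rewrite subrr.
apply: etrans (tpow_eval_sum _ _ _) _.
by apply: eq_bigr => q _; rewrite tpow_evalZ.
Qed.

Lemma pairing_linear n (z : tpow n) : tor_diff aug z = 0 ->
  linear_form (fun y : yoneda g n => tpow_eval (rep_cochain y) z).
Proof.
move=> z0 c x y; apply/eqP; rewrite -subr_eq0 -tpow_evalZ -tpow_evalD -tpow_evalB.
by apply/eqP; apply: (coboundary_eval _ z0); apply: rep_cochain_comb.
Qed.

Section Volume.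
Variables (N : nat) (l : yoneda g N -> k) (z : tpow N) (c : k) (D : H).

(** A form on the top degree of E that is the pairing with a multiple of a cycle,
    and through which the coaction is multiplication by D. *)
Definition volume_form : Prop :=
  [/\ tor_diff aug z = 0, forall w, l w = c * tpow_eval (rep_cochain w) z
    & forall w, tlift (fun h y => l y *: h) (rhoE N w) = l w *: D].

Hypothesis lvol : volume_form.
Let z0 : tor_diff aug z = 0. Proof. by case: lvol. Qed.
Let l_pairing w : l w = c * tpow_eval (rep_cochain w) z. Proof. by case: lvol. Qed.
Let l_coact w : tlift (fun h y => l y *: h) (rhoE N w) = l w *: D.
Proof. by case: lvol. Qed.

Lemma volume_twist w p : linear_form p ->
  c * tpow_eval (rtwist (rep_cochain w) p) z = l w * p D.
Proof.
move=> pl; transitivity (p (l w *: D)); last exact: linear_formZ.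
rewrite -l_coact -rhoE_pairing //.
have fl : linear_form (fun a : k^o => c * (a : k)).
  by move=> a b d; rewrite mulrDr mulrCA.
apply: etrans (tlift_form _ _ fl) _; symmetry; apply: etrans (tlift_form _ _ pl) _.
apply: (@tlift_eq _ _ _ k^o) => h y.
by rewrite linear_formZ // l_pairing mulrAC mulrA.
Qed.

(** Twisting by p multiplies a cochain that represents w by p D, up to
    coboundaries, and twisting by a convolution product is twisting twice. *)
Lemma volume_group_like w : l w = 1 -> rhoE N w = D ⊗ w -> group_like hH D.
Proof.
move=> lw wD; have [wm w0] := rep_cochainP w; have [_ wl] := wm.
have D1 p : linear_form p -> p D = c * tpow_eval (rtwist (rep_cochain w) p) z.
  by move=> pl; rewrite volume_twist // lw mul1r.
split; last first.
  rewrite (D1 _ (bundled_linear ε : linear_form (ε : H -> k))).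
  rewrite (_ : rtwist (rep_cochain w) _ = rep_cochain w) -?l_pairing //.
  by apply: funext => s; apply: twist_counit.
apply: tens_forms_inj => p q pl ql.
rewrite [RHS](tlift_tpure (U := k^o)); last exact: form_mul_bilinear.
rewrite -[LHS]/(convolve hH p q D) D1; last exact: convolve_linear.
have -> : rtwist (rep_cochain w) (convolve hH p q) = rtwist (rtwist (rep_cochain w) p) q.
  by apply: funext => s; rewrite twist_twist.
have wp : coboundary N (fun s => rtwist (rep_cochain w) p s - p D * rep_cochain w s).
  apply: coboundary_of_eval => [|y y0].
    by apply: ncochainB; [apply: twist_ncochain|apply: ncochainZ].
  rewrite tpow_evalB tpow_evalZ -rhoE_pairing // wD (tlift_tpure (U := k^o)) ?subrr //.
  apply: bilinear_mapP => [v|h] a u u'; first by rewrite pl mulrDl -mulrA.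
  by rewrite (pairing_linear y0) mulrDr mulrCA.
have wpq : coboundary N (fun s =>
    rtwist (rtwist (rep_cochain w) p) q s - p D * rtwist (rep_cochain w) q s).
  apply: eq_coboundary (coboundary_twist rho_graded ql wp) => s.
  rewrite addrC -mulNr -twist_combl; congr (twist _ _ _ s : k).
  by apply: funext => u; rewrite mulNr addrC.
have /eqP := coboundary_eval wpq z0.
by rewrite tpow_evalB tpow_evalZ subr_eq0 => /eqP->; rewrite mulrCA -D1.
Qed.

End Volume.

Lemma cup_sumr m n I (r : seq I) f (F : I -> seq R -> k) (a : I -> k) (z : tpow (m + n)) :
  tpow_eval (cup m f (fun s => \sum_(i <- r) a i * F i s)) z =
  \sum_(i <- r) a i * tpow_eval (cup m f (F i)) z.
Proof.
under [RHS]eq_bigr do rewrite -tpow_evalZ.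
rewrite -tpow_eval_sum; congr (tpow_eval _ z); apply: funext => s.
by rewrite /cup mulr_sumr; apply: eq_bigr => i _; rewrite mulrCA.
Qed.

Lemma cup_suml m n I (r : seq I) f (F : I -> seq R -> k) (a : I -> k) (z : tpow (m + n)) :
  tpow_eval (cup m (fun s => \sum_(i <- r) a i * F i s) f) z =
  \sum_(i <- r) a i * tpow_eval (cup m (F i) f) z.
Proof.
under [RHS]eq_bigr do rewrite -tpow_evalZ.
rewrite -tpow_eval_sum; congr (tpow_eval _ z); apply: funext => s.
by rewrite /cup mulr_suml; apply: eq_bigr => i _; rewrite mulrA.
Qed.

Lemma cup_evalBr m n f h h' (z : tpow (m + n)) : ncochain m f -> delta f =1 (fun=> 0) ->
  tor_diff aug z = 0 -> coboundary n (fun s => h s - h' s) ->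
  tpow_eval (cup m f h) z = tpow_eval (cup m f h') z.
Proof.
move=> fm f0 z0 hh'; apply/eqP; rewrite -subr_eq0 -tpow_evalB; apply/eqP.
rewrite -(coboundary_eval (cup_coboundaryr fm f0 hh') z0); congr (tpow_eval _ z).
by apply: funext => s; rewrite /cup mulrBr.
Qed.

Lemma cup_evalBl m n f h h' (z : tpow (m + n)) : ncochain n f -> delta f =1 (fun=> 0) ->
  tor_diff aug z = 0 -> coboundary m (fun s => h s - h' s) ->
  tpow_eval (cup m h f) z = tpow_eval (cup m h' f) z.
Proof.
move=> fm f0 z0 hh'; apply/eqP; rewrite -subr_eq0 -tpow_evalB; apply/eqP.
rewrite -(coboundary_eval (cup_coboundaryl hh' fm f0) z0); congr (tpow_eval _ z).
by apply: funext => s; rewrite /cup mulrBl.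
Qed.

Local Arguments tpow_eval : simpl never.

(** Since x has degree 1, only the cochain that represents y has to be changed by
    a coboundary to make the coaction multiplicative on cochains. *)
Lemma rhoE_comp_left n (l : yoneda g (1 + n) -> k) z c D (x : yoneda g 1)
    (y : yoneda g n) p :
  volume_form l z c D -> linear_form p ->
  tlift (fun h x' => tlift (fun h' y' => l (ext_comp x' y') * p (h * h') : k^o)
    (rhoE n y)) (rhoE 1 x) = l (ext_comp x y) * p D :> k.
Proof.
move=> lvol pl; have [z0 lE _] := lvol; rewrite -(volume_twist lvol) //.
have -> : tpow_eval (rtwist (rep_cochain (ext_comp x y)) p) z =
    tpow_eval (rtwist (cup 1 (rep_cochain x) (rep_cochain y)) p) z.
  have [xm x0] := rep_cochainP x; have [ym y0] := rep_cochainP y.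
  have := rep_cochain_class (cup_ncochain xm ym) (cup_cocycle xm ym x0 y0).
  rewrite -ext_comp_class => /(coboundary_twist rho_graded pl) /coboundary_eval /(_ z0) E.
  apply/eqP; rewrite -subr_eq0 -tpow_evalB; apply/eqP; rewrite -[RHS]E.
  congr (tpow_eval _ z); apply: funext => s; rewrite addrC -mulN1r -twist_combl.
  by congr (twist _ _ _ s : k); apply: funext => u; rewrite mulN1r addrC.
have -> : rtwist (cup 1 (rep_cochain x) (rep_cochain y)) p = fun s => tlift (fun h x' =>
    cup 1 (rep_cochain x') (rtwist (rep_cochain y) (fun h' => p (h * h'))) s : k^o) (rhoE 1 x).
  by apply: funext => s; rewrite twist_cup_left.
rewrite [tpow_eval _ _]tpow_eval_sum mulr_sumr; apply: eq_bigr => -[h x'] _ /=.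
have [xm x0] := rep_cochainP x'; have phl := linear_form_mulr h pl.
rewrite -(cup_evalBr xm x0 z0 (rhoE_twist_coboundary y phl)).
rewrite cup_sumr mulr_sumr; apply: eq_bigr => -[h' y'] _ /=.
by rewrite lE pairing_comp // -mulrA [p _ * _]mulrC.
Qed.

Lemma rhoE_comp_right n (l : yoneda g (n + 1) -> k) z c D (x : yoneda g 1)
    (y : yoneda g n) p :
  volume_form l z c D -> linear_form p ->
  tlift (fun h x' => tlift (fun h' y' => l (ext_comp y' x') * p (h' * h) : k^o)
    (rhoE n y)) (rhoE 1 x) = l (ext_comp y x) * p D :> k.
Proof.
move=> lvol pl; have [z0 lE _] := lvol; rewrite -(volume_twist lvol) //.
have [xm x0] := rep_cochainP x; have [ym y0] := rep_cochainP y.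
have -> : tpow_eval (rtwist (rep_cochain (ext_comp y x)) p) z =
    tpow_eval (rtwist (cup n (rep_cochain y) (rep_cochain x)) p) z.
  have := rep_cochain_class (cup_ncochain ym xm) (cup_cocycle ym xm y0 x0).
  rewrite -ext_comp_class => /(coboundary_twist rho_graded pl) /coboundary_eval /(_ z0) E.
  apply/eqP; rewrite -subr_eq0 -tpow_evalB; apply/eqP; rewrite -[RHS]E.
  congr (tpow_eval _ z); apply: funext => s; rewrite addrC -mulN1r -twist_combl.
  by congr (twist _ _ _ s : k); apply: funext => u; rewrite mulN1r addrC.
have -> : rtwist (cup n (rep_cochain y) (rep_cochain x)) p = fun s => tlift (fun h x' =>
    cup n (rtwist (rep_cochain y) (fun h' => p (h' * h))) (rep_cochain x') s : k^o) (rhoE 1 x).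
  apply: funext => s; have [sn|sn] := eqVneq (size s) n.+1.
    exact: twist_cup_right.
  have nN : size s <> (n + 1)%N by rewrite addn1; apply/eqP.
  rewrite (twist_ncochain rho (cup_ncochain ym xm) pl).1 // tlift_eq0 // => h x'.
  have [xm' _] := rep_cochainP x'.
  by rewrite (cup_ncochain (twist_ncochain rho ym (linear_form_mull h pl)) xm').1.
rewrite [tpow_eval _ _]tpow_eval_sum mulr_sumr; apply: eq_bigr => -[h x'] _ /=.
have [xm' x0'] := rep_cochainP x'; have phl := linear_form_mull h pl.
rewrite -(cup_evalBl xm' x0' z0 (rhoE_twist_coboundary y phl)).
rewrite cup_suml mulr_sumr; apply: eq_bigr => -[h' y'] _ /=.
by rewrite lE pairing_comp // -mulrA [p _ * _]mulrC.
Qed.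

End YonedaCoaction.

(** * Cohomologous cochains *)

Section Cohomologous.
Variables (k : fieldType) (R : algType k) (g : connected_grading R).
Local Notation aug := (gr_aug g).
Local Notation delta := (delta aug).
Local Notation coboundary := (coboundary aug).
Implicit Types (f : seq R -> k) (s : seq R).

(** Classes have chosen representatives, so that operations on classes agree with
    operations on cochains up to coboundaries only. *)
Definition cohomologous n f f' : Prop := coboundary n (fun s => f s - f' s).

Lemma cohomologous_trans n f f' f'' : cohomologous n f f' ->
  cohomologous n f' f'' -> cohomologous n f f''.
Proof.
move=> ff ff'; apply: eq_coboundary (coboundary_comb 1 ff ff') => s.
by rewrite mul1r addrA subrK.
Qed.

Lemma cohomologous_sym n f f' : cohomologous n f f' -> cohomologous n f' f.
Proof.
move=> ff; apply: eq_coboundary (coboundary_comb (-1) ff (coboundary0 aug n)) => s.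
by rewrite addr0 mulN1r opprB.
Qed.

Lemma cohomologous_refl n f : cohomologous n f f.
Proof. by apply: eq_coboundary (coboundary0 aug n) => s; rewrite subrr. Qed.

Lemma cohomologous_comb n c f f' h h' : cohomologous n f f' ->
  cohomologous n h h' ->
  cohomologous n (fun s => c * f s + h s) (fun s => c * f' s + h' s).
Proof.
move=> ff hh; apply: eq_coboundary (coboundary_comb c ff hh) => s.
by rewrite mulrBr addrACA -opprD.
Qed.

Lemma yoneda_cohomologous n (x y : yoneda g n) f :
  cohomologous n (rep_cochain x) f -> cohomologous n (rep_cochain y) f -> x = y.
Proof.
move=> xf yf; apply: yoneda_eq.
exact: cohomologous_trans xf (cohomologous_sym yf).
Qed.

Lemma rep_ext_comp m n (x : yoneda g m) (y : yoneda g n) :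
  cohomologous (m + n) (rep_cochain (ext_comp x y)) (cup m (rep_cochain x) (rep_cochain y)).
Proof.
have [xm x0] := rep_cochainP x; have [ym y0] := rep_cochainP y.
rewrite ext_comp_class; apply: rep_cochain_class; first exact: cup_ncochain.
exact: cup_cocycle xm ym x0 y0.
Qed.

Lemma rep_cochain0 n : cohomologous n (rep_cochain (0 : yoneda g n)) (fun=> 0).
Proof.
have := rep_cochain_comb (-1) (0 : yoneda g n) 0; rewrite scaler0 addr0.
apply: eq_coboundary => s; by rewrite mulN1r addNr.
Qed.

Lemma ext_comp_linearl m n (y : yoneda g n) :
  linear_map (fun x : yoneda g m => ext_comp x y).
Proof.
move=> c x x'; have [ym y0] := rep_cochainP y.
pose f s := c * cup m (rep_cochain x) (rep_cochain y) s + cup m (rep_cochain x') (rep_cochain y) s.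
apply: (@yoneda_cohomologous _ _ _ f).
  apply: cohomologous_trans (rep_ext_comp _ _) _.
  apply: eq_coboundary (cup_coboundaryl (rep_cochain_comb c x x') ym y0) => s.
  by rewrite /f /cup mulrBl mulrDl mulrA.
apply: cohomologous_trans (rep_cochain_comb _ _ _) _.
by apply: cohomologous_comb; apply: rep_ext_comp.
Qed.

Lemma ext_comp_linearr m n (x : yoneda g m) :
  linear_map (fun y : yoneda g n => ext_comp x y).
Proof.
move=> c y y'; have [xm x0] := rep_cochainP x.
pose f s := c * cup m (rep_cochain x) (rep_cochain y) s + cup m (rep_cochain x) (rep_cochain y') s.
apply: (@yoneda_cohomologous _ _ _ f).
  apply: cohomologous_trans (rep_ext_comp _ _) _.
  apply: eq_coboundary (cup_coboundaryr xm x0 (rep_cochain_comb c y y')) => s.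
  by rewrite /f /cup mulrBr mulrDr mulrCA.
apply: cohomologous_trans (rep_cochain_comb _ _ _) _.
by apply: cohomologous_comb; apply: rep_ext_comp.
Qed.

Lemma ext_comp_degree0 n (x : yoneda g 0) (y : yoneda g n) :
  ext_comp x y = (rep_cochain x [::] *: y : yoneda g n).
Proof.
apply: (@yoneda_cohomologous _ _ _ (cup 0 (rep_cochain x) (rep_cochain y))).
  exact: rep_ext_comp.
rewrite -[_ *: y]addr0; apply: cohomologous_trans (rep_cochain_comb _ _ _) _.
apply: cohomologous_trans (cohomologous_comb _ (cohomologous_refl _ _) (rep_cochain0 n)) _.
apply: eq_coboundary (coboundary0 aug n) => s.
by rewrite /cup take0 drop0 addr0 subrr.
Qed.

(** Otherwise the cochain that represents x would be a coboundary. *)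
Lemma nonzero_pairing n (x : yoneda g n) : x <> 0 ->
  exists2 z : @tpow k R n, tor_diff aug z = 0 & tpow_eval (rep_cochain x) z <> 0.
Proof.
move=> x0; apply: contrapT => nz; apply: x0; have [xm _] := rep_cochainP x.
apply: yoneda_cohomologous (rep_cochain0 n); apply: (@eq_coboundary _ _ _ _ (rep_cochain x)).
  by move=> s; rewrite subr0.
apply: coboundary_of_eval => // z z0; apply: contrapT => xz; apply: nz.
by exists z.
Qed.

End Cohomologous.

(** * Classes of degree one *)

Section DegreeOne.
Variables (k : fieldType) (R : algType k) (g : connected_grading R).
Hypothesis R_gen1 : generated_in_degree1 g.
Local Notation aug := (gr_aug g).
Implicit Types (f : seq R -> k) (s : seq R).

Lemma coboundary1_eq0 f r : coboundary aug 1 f -> f [:: r] = 0.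
Proof. by move=> [h _ ->]; rewrite delta_cons bar_delta1 subrr. Qed.

Lemma rep1_linear r : linear_form (fun x : yoneda g 1 => rep_cochain x [:: r]).
Proof.
move=> c x y; apply/eqP; rewrite -subr_eq0; apply/eqP.
exact: (coboundary1_eq0 r (rep_cochain_comb c x y)).
Qed.

Lemma rep1_linear_arg (x : yoneda g 1) : linear_form (fun r => rep_cochain x [:: r]).
Proof. by have [[_ xl] _] := rep_cochainP x; apply: multilinear_head. Qed.

Lemma rep1_derivation (x : yoneda g 1) a b :
  rep_cochain x [:: a * b] =
  (aug a : k) * rep_cochain x [:: b] + (aug b : k) * rep_cochain x [:: a].
Proof.
have [_ x0] := rep_cochainP x; have := x0 [:: a; b].
rewrite delta_cons bar_delta2 bar_delta1 opprB addrA => /eqP; rewrite subr_eq0 => /eqP E.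
exact: esym E.
Qed.

(** A derivation into the trivial module is determined by its values on
    generators. *)
Lemma rep1_inj (x y : yoneda g 1) :
  (forall r, homog g 1 r -> rep_cochain x [:: r] = rep_cochain y [:: r]) -> x = y.
Proof.
move=> xy; have E : forall r, rep_cochain x [:: r] = rep_cochain y [:: r].
  have one (w : yoneda g 1) : rep_cochain w [:: 1] = 0.
    have := rep1_derivation w 1 1; rewrite mulr1 rmorph1 mul1r => /eqP.
    by rewrite -subr_eq0 opprD addrA subrr add0r oppr_eq0 => /eqP.
  apply: R_gen1 => // [|c a b Ea Eb|a b Ea Eb]; first by rewrite !one.
    by rewrite !(rep1_linear_arg _) Ea Eb.
  by rewrite !rep1_derivation Ea Eb.
apply: yoneda_eq; apply: (@eq_coboundary _ _ _ _ (fun=> 0)); last exact: coboundary0.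
move=> s; have [[x0 _] _] := rep_cochainP x; have [[y0 _] _] := rep_cochainP y.
by case: s => [|r [|r' s]]; [rewrite x0 ?y0|rewrite E|rewrite x0 ?y0]; rewrite ?subrr.
Qed.

Lemma aug_homog n x : homog g n.+1 x -> (aug x : k) = 0.
Proof.
move=> xn; have := gr_degree0 g x; rewrite -{1}xn gr_projK /=.
by move=> /esym/eqP; rewrite scaler_eq0 oner_eq0 orbF => /eqP.
Qed.

(** In a product of homogeneous elements that has degree 1, one factor is a
    scalar. *)
Lemma degree1_derivation (p : R -> k) : linear_form p ->
  (forall n x, n <> 1%N -> homog g n x -> p x = 0) ->
  forall a b, p (a * b) = (aug a : k) * p b + (aug b : k) * p a.
Proof.
move=> pl p0 a b.
have h m x : homog g m (gr_proj g m x) by rewrite /homog gr_projK eqxx.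
have augS (w : R) : linear_form (fun a => (aug a : k) * p w).
  by move=> c x y; rewrite linearP mulrDl -mulrA.
have lhs : linear_form (fun a => p (a * b)).
  by move=> c x y; rewrite mulrDl -scalerAl pl.
have rhs : linear_form (fun a => (aug a : k) * p b + (aug b : k) * p a).
  by move=> c x y; rewrite augS pl !mulrDr addrACA [_ * (c * p x)]mulrCA.
have [N ->] := gr_sum g a; rewrite (linear_form_sum lhs) (linear_form_sum rhs).
apply: eq_bigr => i _; move: (gr_proj g i a) (h i a) => {lhs rhs}a ai.
have lhs : linear_form (fun b => p (a * b)).
  by move=> c x y; rewrite mulrDr -scalerAr pl.
have rhs : linear_form (fun b => (aug a : k) * p b + (aug b : k) * p a).
  by move=> c x y; rewrite augS pl !mulrDr addrACA [_ * (c * p x)]mulrCA.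
have [M ->] := gr_sum g b; rewrite (linear_form_sum lhs) (linear_form_sum rhs).
apply: eq_bigr => j _; move: (gr_proj g j b) (h j b) => {lhs rhs}b bj.
have homog0 x : homog g 0 x -> x = (aug x : k) *: 1.
  by move=> x0; rewrite -gr_degree0.
case: (nat_of_ord i) (nat_of_ord j) ai bj => [|m] [|n] am bn.
- rewrite (p0 0%N a) // (p0 0%N b) // !mulr0 addr0; apply: (p0 0%N) => //.
  by rewrite /homog -am -bn (gr_mul g 0 0).
- rewrite {1}(homog0 a am) -scalerAl mul1r linear_formZ // (aug_homog bn) mul0r.
  by rewrite addr0.
- rewrite {1}(homog0 b bn) -scalerAr mulr1 linear_formZ // (aug_homog am) mul0r.
  by rewrite add0r.
rewrite (aug_homog am) (aug_homog bn) !mul0r addr0.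
apply: (p0 (m.+1 + n.+1)%N); first by rewrite addSn addnS.
by rewrite /homog -am -bn gr_mul.
Qed.

Variables (n : nat) (x : 'I_n -> R).
Hypothesis x1 : forall i, homog g 1 (x i).
Hypothesis x_basis : forall r, homog g 1 r ->
  exists! c : 'rV[k]_n, r = \sum_i c 0 i *: x i.

(** The coordinates on R_1, extended by 0 to the other degrees, are derivations
    and represent the dual basis of Ext^1(k, k). *)
Lemma dual_basis : exists (phi : 'I_n -> R -> k) (a : 'I_n -> yoneda g 1),
  [/\ forall i, linear_form (phi i), forall i j, phi i (x j) = (i == j)%:R,
      forall r, homog g 1 r -> r = \sum_i phi i r *: x i,
      forall i r, rep_cochain (a i) [:: r] = phi i r
    & forall w, w = \sum_i rep_cochain w [:: x i] *: a i].
Proof.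
have homog_proj r : homog g 1 (gr_proj g 1 r) by rewrite /homog gr_projK eqxx.
have /boolp.choice[c cP] : forall r, exists c : 'rV[k]_n,
    gr_proj g 1 r = \sum_i c 0 i *: x i.
  by move=> r; have [c [cE _]] := x_basis (homog_proj r); exists c.
pose phi i r := c r 0 i.
have uniq (d d' : 'rV[k]_n) : \sum_i d 0 i *: x i = \sum_i d' 0 i *: x i -> d = d'.
  move=> E; have hr : homog g 1 (\sum_i d 0 i *: x i).
    rewrite /homog linear_sum; apply: eq_bigr => i _.
    by rewrite linearZ /=; congr (_ *: _); apply: x1.
  have [e [_ eu]] := x_basis hr.
  by rewrite -(eu d) // -(eu d').
have phil i : linear_form (phi i).
  move=> b r r'; rewrite /phi.
  have -> : c (b *: r + r') = b *: c r + c r'; last by rewrite !mxE.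
  apply: uniq; rewrite -cP linearP /= !cP scaler_sumr -big_split.
  by apply: eq_bigr => j _; rewrite !mxE scalerDl scalerA.
have phix i j : phi i (x j) = (i == j)%:R.
  rewrite /phi (_ : c (x j) = \row_l (l == j)%:R) ?mxE //; apply: uniq.
  rewrite -cP x1 (bigD1 j) //= mxE eqxx scale1r big1 ?addr0 // => l /negPf lj.
  by rewrite mxE lj scale0r.
have phi0 i m r : m <> 1%N -> homog g m r -> phi i r = 0.
  move=> m1 rm; rewrite /phi (_ : c r = 0) ?mxE //; apply: uniq.
  rewrite -cP -rm gr_projK; have /eqP/negPf := m1; rewrite eq_sym => ->.
  by rewrite big1 // => l _; rewrite mxE scale0r.
pose f i s := if s is [:: r] then phi i r else 0.
have fm i : ncochain 1 (f i).
  split=> [[|r [|]]//|[|a s] t b u v]; case: t => [|w t] /=; rewrite ?mulr0 ?addr0 //.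
  - exact: phil.
  - by case: s => [|? ?]; rewrite ?mulr0 ?addr0.
  - by case: s => [|? ?]; rewrite ?mulr0 ?addr0.
have f0 i : delta aug (f i) =1 fun=> 0.
  move=> s; have [sn|sn] := eqVneq (size s) 2; last first.
    by apply: (delta_ncochain aug (fm i)).1; apply/eqP.
  case: s sn => [|a [|b [|]]]// _; rewrite delta_cons bar_delta2 bar_delta1 /=.
  rewrite (degree1_derivation (phil i) (@phi0 i)) opprB.
  by rewrite addrA subrr.
pose a i := cochain_class g 1 (f i).
have aE i r : rep_cochain (a i) [:: r] = phi i r.
  apply/eqP; rewrite -subr_eq0; apply/eqP.
  exact: (coboundary1_eq0 r (rep_cochain_class (fm i) (f0 i))).
have xE r : homog g 1 r -> r = \sum_i phi i r *: x i.
  by move=> r1; rewrite -cP r1.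
exists phi, a; split=> // w; apply: rep1_inj => r r1.
rewrite (linear_form_sum (rep1_linear r)) {1}(xE r r1).
rewrite (linear_form_sum (rep1_linear_arg w)); apply: eq_bigr => i _.
by rewrite (linear_formZ (rep1_linear_arg w)) (linear_formZ (rep1_linear r)) aE mulrC.
Qed.

End DegreeOne.

(** * The Frobenius form *)

Section Frobenius.
Variables (k : fieldType) (R : algType k) (g : connected_grading R) (d : nat).
Variables (rev : bool) (l : forall n, {linear yoneda g n -> k^o}).
Hypothesis l_frobenius : yoneda_frobenius rev d l.
Local Notation aug := (gr_aug g).

Lemma frobenius_degree n (x : yoneda g n) : n <> d -> (l n x : k) = 0.
Proof. by case: l_frobenius => _ _ l0 _ _ nd; apply: l0. Qed.

(** The statements for the two orders of composition differ only by exchanging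
    left and right nondegeneracy. *)
Lemma frobenius_left m (x : yoneda g m) :
  (forall n (y : yoneda g n), (l _ (ext_comp x y) : k) = 0) -> x = 0.
Proof.
case: l_frobenius => _ _ _; rewrite /yoneda_form.
by case: (rev) => nl nr xy; [apply: nr|apply: nl].
Qed.

Lemma frobenius_right n (y : yoneda g n) :
  (forall m (x : yoneda g m), (l _ (ext_comp x y) : k) = 0) -> y = 0.
Proof.
case: l_frobenius => _ _ _; rewrite /yoneda_form.
by case: (rev) => nl nr xy; [apply: nl|apply: nr].
Qed.

(** E_0 is spanned by the identity of E, so that the pairing of E_0 with E_d
    shows E_d to be a line. *)
Lemma frobenius_top_inj (y : yoneda g d) : (l d y : k) = 0 -> y = 0.
Proof.
move=> ly; apply: frobenius_right => -[|m] x; last first.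
  by apply: frobenius_degree; rewrite addSn => /eqP; rewrite -addSn -[X in _ == X]add0n eqn_add2r.
by rewrite ext_comp_degree0 linearZ /= ly; apply: mulr0.
Qed.

Lemma form_linearl m n (y : yoneda g n) :
  linear_form (fun x : yoneda g m => l _ (ext_comp x y) : k).
Proof. by move=> c x x'; rewrite ext_comp_linearl linearP. Qed.

Lemma form_linearr m n (x : yoneda g m) :
  linear_form (fun y : yoneda g n => l _ (ext_comp x y) : k).
Proof. by move=> c y y'; rewrite ext_comp_linearr linearP. Qed.

(** If A B = 1 for the matrix A of the form on E_1 x E_q in the basis a and a
    spanning family, then B gives the basis dual to a. *)
Lemma frobenius_dual_basis n q (a : 'I_n -> yoneda g 1) (f : 'I_n -> yoneda g 1 -> k) :
  d = q.+1 -> (forall i, linear_form (f i)) -> (forall i j, f i (a j) = (i == j)%:R) ->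
  (forall w, w = \sum_i f i w *: a i) ->
  exists b : 'I_n -> yoneda g q,
    (forall i j, (l _ (ext_comp (a i) (b j)) : k) = (i == j)%:R) /\
    forall w, w = \sum_i (l _ (ext_comp (a i) w) : k) *: b i.
Proof.
move=> dq fl fa fv; have [/(_ q)[m [c cV]] _ _ _ _] := l_frobenius.
pose A := \matrix_(i < n, j < m) (l _ (ext_comp (a i) (c j)) : k).
have pair0 (x : yoneda g 1) : (forall w : yoneda g q, (l _ (ext_comp x w) : k) = 0) -> x = 0.
  move=> x0; apply: frobenius_left => q' y; have [E|E] := eqVneq q' q.
    by move: y; rewrite E => y; apply: x0.
  by apply: frobenius_degree; rewrite dq add1n => -[] /eqP; apply/negP.
have : row_free A.
  apply: inj_row_free => v vA; pose x := \sum_i v 0 i *: a i.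
  have x0 : x = 0.
    apply: pair0 => w; have [e ->] := cV w.
    rewrite (linear_form_sum (form_linearr x)) big1 // => j _.
    rewrite (linear_formZ (form_linearr x)) (linear_form_sum (form_linearl (c j))).
    have /matrixP/(_ 0 j) := vA; rewrite !mxE => vAj.
    rewrite [X in _ * X](_ : _ = 0) ?mulr0 // -[RHS]vAj; apply: eq_bigr => i _.
    by rewrite (linear_formZ (form_linearl (c j))) mxE.
  apply/rowP => j; rewrite mxE -(linear_form0 (fl j)) -x0 linear_form_sum //.
  rewrite (bigD1 j) //= big1 ?addr0 => [|i ij]; first by rewrite linear_formZ // fa eqxx mulr1.
  by rewrite linear_formZ // fa eq_sym (negPf ij) mulr0.
move=> /row_freeP[B AB].
pose b j := \sum_i B i j *: c i.
have ab i j : (l _ (ext_comp (a i) (b j)) : k) = (i == j)%:R.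
  have /matrixP/(_ i j) := AB; rewrite !mxE => <-.
  rewrite (linear_form_sum (form_linearr (a i))); apply: eq_bigr => r _.
  by rewrite (linear_formZ (form_linearr (a i))) mxE mulrC.
exists b; split=> // w; apply/eqP; rewrite -subr_eq0; apply/eqP.
apply: frobenius_right => p x; have [p1|p1] := eqVneq p 1%N; last first.
  apply: frobenius_degree; rewrite dq -add1n => /eqP; rewrite eqn_add2r.
  exact/negP.
move: x; rewrite p1 => x; rewrite (fv x) (linear_form_sum (form_linearl _)) big1 // => i _.
rewrite (linear_formZ (form_linearl _)); set e := l _ _; suff -> : e = 0 by apply: mulr0.
rewrite /e -scaleN1r addrC (form_linearr (a i)) (linear_form_sum (form_linearr (a i))).
rewrite (bigD1 i) //= big1 ?addr0 => [|j ji].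
  by rewrite (linear_formZ (form_linearr (a i))) ab eqxx mulr1 mulN1r addNr.
by rewrite (linear_formZ (form_linearr (a i))) ab eq_sym (negPf ji) mulr0.
Qed.

End Frobenius.

Section TopDegree.
Variables (k : fieldType) (R : algType k) (g : connected_grading R) (d : nat).
Variables (rev : bool) (l : forall n, {linear yoneda g n -> k^o}).
Hypothesis l_frobenius : yoneda_frobenius rev d l.
Variables (H : algType k) (hH : hopf_structure H) (rho : coaction hH R).
Hypothesis rho_graded : preserves_grading g rho.
Variable rhoE : forall n, {linear yoneda g n -> tens H (yoneda g n)}.
Hypothesis rhoE_dual : dual_coaction rho rhoE.
Variable D : H.
Hypothesis D_codet : homological_codeterminant d rhoE D.

Lemma top_class : exists e : yoneda g d,
  [/\ (l d e : k) = 1, rhoE d e = D ⊗ e & forall w, w = (l d w : k) *: e].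
Proof.
have [e0 ne0 e0D] := D_codet; have le0 : (l d e0 : k) != 0.
  by apply/eqP => /(frobenius_top_inj l_frobenius).
exists ((l d e0 : k)^-1 *: e0).
have le : (l d ((l d e0 : k)^-1 *: e0) : k) = 1.
  by rewrite linearZ /=; apply: mulVf.
split=> // [|w]; first by rewrite linearZ /= e0D (linear_mapZ (tpure_linr D)).
apply/eqP; rewrite -subr_eq0; apply/eqP; apply: (frobenius_top_inj l_frobenius).
have ll : linear_form (l d : _ -> k) := bundled_linear (l d).
by rewrite -scaleNr addrC ll le mulr1 addNr.
Qed.

(** The degree is an equation since 1 + q and q + 1 both occur for it. *)
Lemma top_volume N : N = d -> exists z c, volume_form rhoE (l N : _ -> k) z c D.
Proof.
move=> ->; have [e [le eD ev]] := top_class.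
have e0 : e <> 0 by move=> e0; move: le; rewrite e0 linear0 => /eqP; rewrite eq_sym oner_eq0.
have [z z0 ez] := nonzero_pairing e0; exists z, (tpow_eval (rep_cochain e) z)^-1.
have pl := pairing_linear z0.
split=> // w.
  by rewrite [in RHS](ev w) (linear_formZ pl) mulrCA mulVf ?mulr1 //; apply/eqP.
have bl : bilinear_map (fun (h : H) (y : yoneda g d) => (l d y : k) *: h) by linear_tac.
have rw : rhoE d w = (l d w : k) *: (D ⊗ e) by rewrite {1}(ev w) linearZ /= eD.
by rewrite rw (linear_mapZ (tlift_linear bl)) tlift_tpure // le scale1r.
Qed.

Lemma codeterminant_group_like : group_like hH D.
Proof.
have [e [le eD _]] := top_class; have [z [c lv]] := top_volume erefl.
exact: (volume_group_like rho_graded rhoE_dual lv le eD).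
Qed.

End TopDegree.

(** * The coaction on the generators *)

Section Generators.
Variables (k : fieldType) (R : algType k) (g : connected_grading R).
Variables (H : algType k) (hH : hopf_structure H) (rho : coaction hH R).
Hypothesis rho_graded : preserves_grading g rho.
Variables (n : nat) (x : 'I_n -> R) (phi : 'I_n -> R -> k).
Hypothesis x1 : forall i, homog g 1 (x i).
Hypothesis phil : forall i, linear_form (phi i).
Hypothesis phix : forall i j, phi i (x j) = (i == j)%:R.
Hypothesis phiE : forall r, homog g 1 r -> r = \sum_i phi i r *: x i.
Local Notation ρ := (coact rho).
Local Notation Δ := (comul hH).

Definition coefficient (i j : 'I_n) : H := tlift (fun r0 r1 => phi i r0 *: r1) (ρ (x j)).

Lemma phi_bilinear i : bilinear_map (fun (r0 : R) (r1 : H) => phi i r0 *: r1).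
Proof.
apply: bilinear_mapP => [h|r]; last exact/linear_map_scale/linear_map_id.
by apply: (linear_map_scalel (f := phi i : R -> k^o)); apply: phil.
Qed.

Lemma coact_generator j : ρ (x j) = \sum_i x i ⊗ coefficient i j.
Proof.
have [s [sP E]] := rho_graded (x1 j).
have cE i : coefficient i j = \sum_(p <- s) phi i p.1 *: p.2.
  by rewrite /coefficient E bilin_sum_tpure //; apply: phi_bilinear.
transitivity (\sum_(p <- s) \sum_i x i ⊗ (phi i p.1 *: p.2)).
  rewrite E big_seq [RHS]big_seq; apply: eq_bigr => p /sP[p1 _].
  rewrite {1}(phiE p1) (linear_map_sum (tpure_linl p.2)); apply: eq_bigr => i _.
  by rewrite (linear_mapZ (tpure_linl _)) (linear_mapZ (tpure_linr _)).
rewrite exchange_big; apply: eq_bigr => i _ /=.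
by rewrite cE (linear_map_sum (tpure_linr (x i))).
Qed.

(** Coassociativity and counit of the coaction, read on the coordinates of
    x_j. *)
Lemma coefficient_comatrix : comatrix hH coefficient.
Proof.
split=> i j; last first.
  have := congr1 (phi i) (coact_counit rho (x j)); rewrite phix => <-.
  rewrite (tlift_form _ _ (phil i)).
  have el : linear_form (fun h => counit hH h : k) := bundled_linear (counit hH).
  apply: etrans (tlift_form _ _ el) _; apply: (@tlift_eq _ _ _ k^o) => r0 r1.
  by rewrite (linear_formZ el) (linear_formZ (phil i)) mulrC.
pose T r00 r01 r1 := phi i r00 *: (r01 ⊗ r1 : H ⊗ H).
have Tl : trilinear_map T.
  split=> [h h'|r h'|r h]; rewrite /T.
  - by apply: (linear_map_scalel (f := phi i : R -> k^o)); apply: phil.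
  - exact/linear_map_scale/tpure_linl.
  - exact/linear_map_scale/tpure_linr.
have := congr1 (tlift (fun v y => tlift (T v) y)) (coactA rho (x j)).
rewrite tlift_tassoc_tmapl //; last exact: bundled_linear.
rewrite tlift_tmapr //; last exact: bundled_linear.
rewrite [in LHS]coact_generator bilin_sum_tpure; last first.
  have [T1 T2 T3] := Tl.
  apply: bilinear_mapP => [w|v]; last by apply: linear_map_tlift => *; apply: T3.
  apply: linear_map_tlift_arg; last exact: bundled_linear.
  by apply: bilinear_mapP => *; [apply: T1|apply: T2].
move=> E; rewrite /coefficient (tlift_comp _ _ (bundled_linear (comul hH))).
transitivity (tlift (fun u w => tlift (T u) (Δ w)) (ρ (x j))).
  apply: tlift_eq => r0 r1; rewrite linearZ /= -[in LHS](tlift_map (b := fun u v => u ⊗ v) (Δ r1)) //.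
  by rewrite (tlift_comp _ _ (linear_map_scale _ (@linear_map_id _ _))).
rewrite -E; apply: eq_bigr => q _.
rewrite (tlift_comp _ _ (tpure_linl (coefficient q j))); apply: tlift_eq => r0 r1.
by rewrite (linear_mapZ (tpure_linl _)).
Qed.

End Generators.

Section Twist.
Variables (k : fieldType) (R : algType k) (g : connected_grading R) (q : nat).
Variables (rev : bool) (l : forall n, {linear yoneda g n -> k^o}).
Hypothesis l_frobenius : yoneda_frobenius rev q.+1 l.
Variables (H : algType k) (hH : hopf_structure H) (rho : coaction hH R).
Hypothesis rho_graded : preserves_grading g rho.
Variable rhoE : forall n, {linear yoneda g n -> tens H (yoneda g n)}.
Hypothesis rhoE_dual : dual_coaction rho rhoE.
Variable D : H.
Hypothesis D_codet : homological_codeterminant q.+1 rhoE D.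
Variables (n : nat) (x : 'I_n -> R) (phi : 'I_n -> R -> k) (a : 'I_n -> yoneda g 1).
Variable b : 'I_n -> yoneda g q.
Hypothesis phil : forall i, linear_form (phi i).
Hypothesis a_phi : forall i r, rep_cochain (a i) [:: r] = phi i r.
Hypothesis a_basis : forall w, w = \sum_i rep_cochain w [:: x i] *: a i.
Hypothesis ab : forall i j, (l _ (ext_comp (a i) (b j)) : k) = (i == j)%:R.
Hypothesis b_basis : forall w, w = \sum_i (l _ (ext_comp (a i) w) : k) *: b i.
Local Notation S := (antipode hH).
Local Notation h := (coefficient rho x phi).

Definition pairing_matrix : 'M[k]_n := \matrix_(i, j) (l _ (ext_comp (b j) (a i)) : k).

Lemma rhoE_degree1 i : rhoE 1 (a i) = \sum_j h i j ⊗ a j.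
Proof.
rewrite [LHS](tens_expand _ (fun j => rep1_linear (x j)) a_basis).
apply: eq_bigr => j _; congr (_ ⊗ _); apply: separated => p pl.
rewrite !(tlift_form _ _ pl).
transitivity (tlift (fun u y => p u * rep_cochain y [:: x j] : k^o) (rhoE 1 (a i)) : k).
  by apply: (@tlift_eq _ _ _ k^o) => u y; rewrite linear_formZ // mulrC.
rewrite (rhoE_pairing1 rhoE_dual) //; apply: (@tlift_eq _ _ _ k^o) => r0 r1.
by rewrite linear_formZ // a_phi.
Qed.

Definition dual_coefficient (j i : 'I_n) : H :=
  tlift (fun u w => (l _ (ext_comp (a i) w) : k) *: u) (rhoE q (b j)).

Lemma rhoE_dual_basis j : rhoE q (b j) = \sum_i dual_coefficient j i ⊗ b i.
Proof. exact: (tens_expand _ (fun i => form_linearr l (a i)) b_basis). Qed.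

Lemma double_sum (F : yoneda g 1 -> yoneda g q -> k) (G : H -> H -> k) i j :
  (forall y, linear_form (F^~ y)) -> (forall w, linear_form (F w)) ->
  (forall u, linear_form (G^~ u)) -> (forall u, linear_form (G u)) ->
  tlift (fun u w => tlift (fun u' w' => F w w' * G u u' : k^o) (rhoE q (b j)))
    (rhoE 1 (a i)) =
  \sum_s \sum_r F (a s) (b r) * G (h i s) (dual_coefficient j r) :> k.
Proof.
move=> F1 F2 G1 G2.
have in_bil u w : bilinear_map (fun u' w' => F w w' * G u u' : k^o).
  apply: bilinear_mapP => [w'|u'] c v v'; first by rewrite G2 mulrDr mulrCA.
  by rewrite F2 mulrDl -mulrA.
have out_bil : bilinear_map (fun u w =>
    tlift (fun u' w' => F w w' * G u u' : k^o) (rhoE q (b j)) : k^o).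
  apply: bilinear_mapP => [w|u]; apply: linear_map_tlift => u' w' c v v'.
    by rewrite G1 mulrDr mulrCA.
  by rewrite F1 mulrDl -mulrA.
rewrite rhoE_degree1 (bilin_sum_tpure _ _ _ out_bil); apply: eq_bigr => s _.
by rewrite rhoE_dual_basis (bilin_sum_tpure _ _ _ (in_bil _ _)).
Qed.

(** The coaction on a_i b_j = delta_ij e, where e is sent to D ⊗ e. *)
Lemma coefficient_dual_basis i j :
  \sum_s h i s * dual_coefficient j s = (i == j)%:R * D.
Proof.
apply: separated => p pl; rewrite linear_form_sum //.
have [z [c lv]] := top_volume l_frobenius D_codet (N := 1 + q) erefl.
have := rhoE_comp_left rho_graded rhoE_dual (a i) (b j) lv pl.
rewrite (double_sum (F := fun w w' => l _ (ext_comp w w') : k)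
  (G := fun u u' => p (u * u'))) //; first last.
- by move=> u; apply: linear_form_mulr.
- by move=> u; apply: linear_form_mull.
- by move=> w; apply: form_linearr.
- by move=> w; apply: form_linearl.
rewrite ab => E; rewrite mulr_natl -scaler_nat linear_formZ // -E.
apply: eq_bigr => s _; rewrite (bigD1 s) //= ab eqxx mul1r big1 ?addr0 // => r rs.
by rewrite ab eq_sym (negPf rs) mul0r.
Qed.

(** The coaction on b_j a_i = Q_ij e. *)
Lemma coefficient_dual_basis_rev i j :
  \sum_s \sum_r pairing_matrix s r *: (dual_coefficient j r * h i s) =
  pairing_matrix i j *: D.
Proof.
apply: separated => p pl; rewrite linear_form_sum // linear_formZ // mxE.
have [z [c lv]] := top_volume l_frobenius D_codet (N := q + 1) (addn1 q).
have := rhoE_comp_right rho_graded rhoE_dual (a i) (b j) lv pl.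
rewrite (double_sum (F := fun w w' => l _ (ext_comp w' w) : k)
  (G := fun u u' => p (u' * u))) //; first last.
- by move=> u; apply: linear_form_mull.
- by move=> u; apply: linear_form_mulr.
- by move=> w; apply: form_linearl.
- by move=> w; apply: form_linearr.
move=> <-; apply: eq_bigr => s _; rewrite linear_form_sum //; apply: eq_bigr => r _.
by rewrite linear_formZ // mxE.
Qed.

Variable muE : forall n, {linear yoneda g n -> yoneda g n}.
Hypothesis muE_nakayama : forall m m' (x : yoneda g m) (y : yoneda g m'),
  yoneda_form rev l x y = yoneda_form rev l (muE _ y) x.

(** Which of the two cases occurs depends on the order of the factors in the
    product of E. *)
Lemma pairing_matrix_nakayama (m := \matrix_(i, j) rep_cochain (muE 1 (a i)) [:: x j] : 'M[k]_n) :
  pairing_matrix = m \/ m *m pairing_matrix = 1%:M.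
Proof.
case: rev muE_nakayama => mu; [right|left]; apply/matrixP => i j; rewrite !mxE.
  have := mu _ _ (b j) (a i); rewrite /yoneda_form ab => ->.
  rewrite [in RHS](a_basis (muE 1 (a i))) (linear_form_sum (form_linearr l _)).
  by apply: eq_bigr => s _; rewrite (linear_formZ (form_linearr l _)) !mxE.
have := mu _ _ (b j) (a i); rewrite /yoneda_form => ->.
rewrite (a_basis (muE 1 (a i))) (linear_form_sum (form_linearl l _)).
rewrite (bigD1 j) //= (linear_formZ (form_linearl l _)) ab eqxx mulr1 -a_basis.
rewrite big1 ?addr0 // => s sj.
by rewrite (linear_formZ (form_linearl l _)) ab (negPf sj) mulr0.
Qed.

End Twist.

Section CentralizerPowers.
Variables (k : fieldType) (n : nat).
Implicit Types (P Q M : 'M[k]_n).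

Lemma mx_exprZ c M t : (c *: M) ^+ t = c ^+ t *: M ^+ t.
Proof.
elim: t => [|t IH]; first by rewrite !expr0 scale1r.
by rewrite !exprS IH [LHS](_ : _ = (c *: M) *m (c ^+ t *: M ^+ t)) //
  -scalemxAl -scalemxAr scalerA.
Qed.

(** Centralizers do not change under nonzero scalars and inverses. *)
Lemma centralizer_powers c M Q P t : c != 0 ->
  Q = c *: M \/ (c *: M) *m Q = 1%:M ->
  centralizer (Q ^+ t) P -> centralizer (M ^+ t) P.
Proof.
move=> c0; have unscale : centralizer ((c *: M) ^+ t) P -> centralizer (M ^+ t) P.
  rewrite /centralizer mx_exprZ -scalemxAl -scalemxAr => /(congr1 (fun A => (c ^- t) *: A)).
  by rewrite !scalerA mulVf ?scale1r // expf_neq0.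
case=> [->//|MQ QP]; apply: unscale; have QM := mulmx1C MQ.
have inv (A B : 'M[k]_n) : A *m B = 1%:M -> A ^+ t *m B ^+ t = 1%:M.
  move=> AB; elim: t {QP} => [|t IH]; first exact: mul1mx.
  rewrite exprS exprSr [A * _](_ : _ = A *m A ^+ t) // [_ * B](_ : _ = B ^+ t *m B) //.
  by rewrite mulmxA -(mulmxA A) IH mulmx1.
rewrite /centralizer -[LHS]mul1mx -(inv _ _ MQ) -mulmxA; congr (_ *m _).
by rewrite mulmxA -QP -mulmxA (inv _ _ QM) mulmx1.
Qed.

End CentralizerPowers.

Theorem theorem0p7
  (k : closedFieldType) (char_k : [pchar k] =i pred0)
  (R : algType k) (g : connected_grading R) (d : nat)
  (R_regular : AS_regular g d) (R_gen1 : generated_in_degree1 g)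
  (muR : {lrmorphism R -> R}) (muR_nakayama : nakayama_aut g d muR)
  (rev : bool) (muE : forall n, {linear yoneda g n -> yoneda g n})
  (muE_nakayama : yoneda_nakayama rev d muE)
  (muE_muR : forall (x : yoneda g 1) (r : R), homog g 1 r ->
     yoneda1_eval (muE 1%N x) r = (-1) ^+ d.+1 * yoneda1_eval x (muR r))
  (H : algType k) (hH : hopf_structure H)
  (S_finite : finite_order_antipode hH)
  (rho : coaction hH R) (rho_graded : preserves_grading g rho)
  (rho_faithful : inner_faithful rho)
  (rhoE : forall n, {linear yoneda g n -> tens H (yoneda g n)})
  (rhoE_dual : dual_coaction rho rhoE)
  (D : H) (D_codet : homological_codeterminant d rhoE D)
  (condition :
     (central_nakayama g muR /\ involutory hH /\ central D) \/
     (power_central_nakayama g muR /\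
        exists2 m, (0 < m)%N & central (D ^+ m))) :
  cocommutative hH /\ (finite_dim H -> is_group_algebra hH).
Proof.
suff Hc : cocommutative hH.
  by split=> // H_fd; apply: cocommutative_group_algebra.
(* t is 1 in the first case, and m times the order of S in the second one. *)
have [n [M [t [[x [x1 x_basis muR_x]] Mt Dt St]]]] : exists n (M : 'M[k]_n) t,
    [/\ degree1_matrix g muR M, commutative_set (centralizer (M ^+ t)),
        central (D ^+ t) & forall h, iter (2 * t) (antipode hH) h = h].
  case: condition => [[[n [M [Mx Mc]]] [inv Dc]]|[[n [M [Mx Mc]]] [m m0 Dm]]].
    by exists n, M, 1%N; split.
  have [s s0 Ss] := S_finite; exists n, M, (m * s)%N; split=> //.
  - by move=> P Q cP cQ; apply: Mc; exists (m * s)%N => //; rewrite muln_gt0 m0.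
  - move=> h; rewrite exprM; elim: s {s0 Ss} => [|s IH]; first by rewrite mul1r mulr1.
    by rewrite exprS -mulrA IH !mulrA Dm.
  by move=> h; rewrite mulnA; elim: (2 * m)%N => // r IH; rewrite mulSn iterD IH.
have [phi [a [phil phix phiE a_phi a_basis]]] := dual_basis R_gen1 x1 x_basis.
have coef_com := coefficient_comatrix rho_graded x1 phil phix phiE.
pose h := coefficient rho x phi.
have [_ _ [l [l_frob muE_form]]] := muE_nakayama.
have h_cocom i j : tswap (comul hH (h i j)) = comul hH (h i j).
  case dE: d => [|q]; subst d.
    (* In degree 0 there are no generators: E_1 is paired with nothing. *)
    have ai0 : a i = 0.
      by apply: (frobenius_left l_frob) => m y; apply: (frobenius_degree l_frob).
    have := phix i i; rewrite -a_phi ai0 eqxx (linear_form0 (rep1_linear _)) => /eqP.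
    by rewrite eq_sym oner_eq0.
  have fa i' j' : rep_cochain (a j') [:: x i'] = (i' == j')%:R by rewrite a_phi phix eq_sym.
  have [b [ab b_basis]] := frobenius_dual_basis l_frob erefl
    (fun i => rep1_linear (x i)) fa a_basis.
  have gD := codeterminant_group_like l_frob rho_graded rhoE_dual D_codet.
  have tw := comatrix_twist coef_com
    (coefficient_dual_basis l_frob rho_graded rhoE_dual D_codet a_phi a_basis ab b_basis)
    (coefficient_dual_basis_rev l_frob rho_graded rhoE_dual D_codet a_phi a_basis b_basis).
  apply: (comatrix_cocommutative coef_com Mt) => f fl.
  have := comatrix_centralizes gD tw Dt St fl; apply: (centralizer_powers (c := (-1) ^+ q.+2)).
    by rewrite signr_eq0.
  have -> : (-1) ^+ q.+2 *: M = \matrix_(i, j) rep_cochain (muE 1 (a i)) [:: x j].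
    apply/matrixP => i' j'; rewrite !mxE.
    have := muE_muR (a i') (x j') (x1 j'); rewrite /yoneda1_eval -/(rep_cochain _ _) => ->.
    rewrite -/(rep_cochain _ _) a_phi muR_x (linear_form_sum (phil i')); congr (_ * _).
    rewrite (bigD1 i') //= linear_formZ // phix eqxx mulr1 big1 ?addr0 // => s si.
    by rewrite linear_formZ // phix eq_sym (negPf si) mulr0.
  exact: pairing_matrix_nakayama muE_form.
pose X u := exists i j, u = h i j.
move=> u; apply: (hopf_span_cocommutative (X := X)).
  by move=> _ [i [j ->]]; apply: h_cocom.
have K_sub : hopf_subalgebra hH (hopf_span hH X).
  apply: hopf_span_subalgebra => _ [i [j ->]]; rewrite coef_com.1.
  apply: tens_sub_sum => s _; apply: tens_sub_pure; first by exists i, s.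
  by exists s, j.
apply: (rho_faithful _ K_sub); apply: (coaction_in_subalgebra R_gen1 K_sub).
move=> r r1; have [c [-> _]] := x_basis r r1; rewrite linear_sum.
apply: tens_sub_sum => j _; rewrite linearZ /=.
rewrite -[_ *: _]addr0; apply: tens_subP => //; last exact: tens_sub0.
rewrite (coact_generator rho_graded x1 phil phiE); apply: tens_sub_sum => i _.
by apply: tens_sub_pure => //; apply: hopf_span_gen; exists i, j.
Qed.
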